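(* The system $\mathsf{ACA}_0^\omega$ proves $\mathsf{LUS}'\to\mathsf{WHBU}_{\mathbf m}$.
   Context: Finite types: $0$ is the type of natural numbers, $\sigma\to\tau$ is the type of maps from type $\sigma$ objects to type $\tau$ objects; $1=0\to0$, $n+1=n\to0$. The language $L_\omega$ has variables of all finite types and constants $0,1,<_0,+_0,\times_0,=_0$, combinators and recursors; for $\tau=\tau_1\to\dots\to\tau_k\to0$, $x=_\tau y$ abbreviates $\forall z_1^{\tau_1}\dots z_k^{\tau_k}(xz_1\dots z_k=_0yz_1\dots z_k)$. $\mathsf{RCA}_0^\omega$ is the theory in classical logic with axioms: (1) $0,1,<_0,+_0,\times_0$ form an ordered semi-ring with equality $=_0$; (2) the defining axioms of the combinators $\Pi,\Sigma$ (giving $\lambda$-abstraction); (3) $\mathbf R_0(f,m,0)=m$, $\mathbf R_0(f,m,n+1)=f(n,\mathbf R_0(f,m,n))$; (4) extensionality: $x=_\rho y\to\varphi(x)=_\tau\varphi(y)$ for all $\varphi^{\rho\to\tau}$ and all types; (5) induction for quantifier-free formulas of $L_\omega$ (variables of any type allowed); (6) $\mathsf{QF\text{-}AC}^{1,0}$: $(\forall x^1)(\exists y^0)A(x,y)\to(\exists Y^{2})(\forall x^1)A(x,Y(x))$ for quantifier-free $A$. $\mathsf{ACA}_0^\omega$ is $\mathsf{RCA}_0^\omega$ plus $(\mu^2)$: there is $\mu^2$ such that for all $f^1$, if $(\exists n)(f(n)=0)$ then $\mu(f)$ is the least such $n$, and otherwise $\mu(f)=0$. Reals are represented by sequences of rationals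 $(q_n)$ with $|q_n-q_{n+i}|<2^{-n}$ for all $n,i$; $(q_n)=_{\mathbb R}(r_n)$ iff $|q_n-r_n|\le2^{-n+1}$ for all $n$; functions on $\mathbb R$ or $I=[0,1]$ are type $1\to1$ objects mapping equal reals to equal reals. A subset of $\mathbb R$ is given by $Y:\mathbb R\to\mathbb R$, with $x\in Y$ iff $Y(x)>_{\mathbb R}0$. Continuity is epsilon–delta continuity. Measure convention: statements about Lebesgue measure $\lambda(E)=\inf\{\sum_k|J_k|:(J_k)_{k\in\mathbb N}\text{ a sequence of open intervals with }E\subset\bigcup_kJ_k\}$ are read comparatively, without assuming the infimum exists: $\lambda(E)\ge a$ means that $a\le\sum_k|J_k|$ for each such cover of $E$; $\lambda(E)\le a$ means that for each $\delta>0$ there is such a cover with $\sum_k|J_k|\le a+\delta$; and so on. $E\subseteq[0,1]$ is measurable if $\lambda(E)+\lambda([0,1]\setminus E)\le1$. $f$ is measurable if for all $t\in\mathbb R$ the set $\{x:f(x)>t\}$ is measurable. $\mathsf{LUS}'$: for measurable $f:I\to\mathbb R$ and $\varepsilon>0$, there is a continuous $g:I\to\mathbb R$ such that $\{x\in I:f(x)\ne g(x)\}$ has measure below $\varepsilon$. $\mathsf{WHBU}_{\mathbf m}$: for every measurable $\Psi:[0,1]\to\mathbb R^+$ and $\varepsilon>0$ there are $y_0,\dots,y_n\in[0,1]$ such that the measure of $\bigcup_{i\le n}(y_i-\Psi(y_i),y_i+\Psi(y_i))$ is at least $1-\varepsilon$. *)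

(* Defs.v *)
From Stdlib Require Import List.
Import ListNotations.

Set Implicit Arguments.
Unset Strict Implicit.

Inductive ty : Set :=
| T0 : ty
| Arr : ty -> ty -> ty.

Declare Scope ty_scope.
Delimit Scope ty_scope with ty.
Bind Scope ty_scope with ty.
Notation "s ~> t" := (Arr s t) (at level 58, right associativity) : ty_scope.
Local Open Scope ty_scope.

Notation T1 := (T0 ~> T0).
Notation T2 := (T1 ~> T0).

Definition ty_eq_dec (s t : ty) : {s = t} + {s <> t}.
Proof. decide equality. Defined.

(** Variables are de Bruijn indices, counted separately for each type:
    [Var s n] refers to the [n]-th enclosing quantifier among those binding a
    variable of type [s], and is free if there are at most [n] of them.
    The only recursor with a defining axiom in the theories below is R_0, and it
    is the only one included. *)
Inductive tm : ty -> Type :=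
| Var (s : ty) (n : nat) : tm s
| App (s t : ty) : tm (s ~> t) -> tm s -> tm t
| Zero : tm T0
| One : tm T0
| Plus : tm (T0 ~> T0 ~> T0)
| Times : tm (T0 ~> T0 ~> T0)
| Pi (s t : ty) : tm (s ~> t ~> s)
| Sigma (r s t : ty) : tm ((r ~> s ~> t) ~> (r ~> s) ~> r ~> t)
| Rec0 : tm ((T0 ~> T0 ~> T0) ~> T0 ~> T0 ~> T0).

Inductive form : Type :=
| Bot : form
| Eq0 : tm T0 -> tm T0 -> form
| Lt0 : tm T0 -> tm T0 -> form
| And : form -> form -> form
| Or : form -> form -> form
| Imp : form -> form -> form
| All : ty -> form -> form
| Ex : ty -> form -> form.

Definition Not (A : form) : form := Imp A Bot.

Fixpoint quantifier_free (A : form) : Prop :=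
  match A with
  | Bot | Eq0 _ _ | Lt0 _ _ => True
  | And A B | Or A B | Imp A B => quantifier_free A /\ quantifier_free B
  | All _ _ | Ex _ _ => False
  end.

Definition env_tm : Type := forall s : ty, nat -> tm s.

Fixpoint tsubst (e : env_tm) (t : ty) (x : tm t) : tm t :=
  match x in tm t return tm t with
  | Var s n => e s n
  | App f y => App (tsubst e f) (tsubst e y)
  | Zero => Zero
  | One => One
  | Plus => Plus
  | Times => Times
  | Pi s t => Pi s t
  | Sigma r s t => Sigma r s t
  | Rec0 => Rec0
  end.

(** Increments the indices of type [r]. *)
Definition shift_env (r : ty) : env_tm :=
  fun s n => if ty_eq_dec r s then Var s (S n) else Var s n.

Definition tshift (r : ty) (t : ty) (x : tm t) : tm t := tsubst (shift_env r) x.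

(** The environment [e] moved under a quantifier over [r]. *)
Definition up (r : ty) (e : env_tm) : env_tm :=
  fun s n =>
    if ty_eq_dec r s then
      match n with
      | 0 => Var s 0
      | S m => tshift r (e s m)
      end
    else tshift r (e s n).

Fixpoint fsubst (e : env_tm) (A : form) : form :=
  match A with
  | Bot => Bot
  | Eq0 x y => Eq0 (tsubst e x) (tsubst e y)
  | Lt0 x y => Lt0 (tsubst e x) (tsubst e y)
  | And A B => And (fsubst e A) (fsubst e B)
  | Or A B => Or (fsubst e A) (fsubst e B)
  | Imp A B => Imp (fsubst e A) (fsubst e B)
  | All r A => All r (fsubst (up r e) A)
  | Ex r A => Ex r (fsubst (up r e) A)
  end.

Definition fshift (r : ty) (A : form) : form := fsubst (shift_env r) A.

(** Index 0 of type [r] is replaced by [t], the others of type [r] are lowered. *)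
Definition inst_env (r : ty) (t : tm r) : env_tm :=
  fun s n =>
    match ty_eq_dec r s with
    | left e => match n with
                | 0 => eq_rect r tm t s e
                | S m => Var s m
                end
    | right _ => Var s n
    end.

Definition inst (r : ty) (t : tm r) (A : form) : form := fsubst (inst_env t) A.

(** Index 0 of type 0 is replaced by its successor, nothing else changes. *)
Definition succ_env : env_tm :=
  fun s n =>
    match s as s return tm s with
    | T0 => match n with
            | 0 => App (App Plus (Var T0 0)) One
            | S m => Var T0 (S m)
            end
    | Arr s t => Var (s ~> t) n
    end.

Fixpoint Eq (t : ty) : tm t -> tm t -> form :=
  match t with
  | T0 => fun x y => Eq0 x y
  | Arr s t => fun x y =>
      All s (Eq (App (tshift s x) (Var s 0)) (App (tshift s y) (Var s 0)))
  end.

(** Classical natural deduction.  [Ax] is a set of axioms, whose free variables are read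
    as universally quantified: [fshift] acts on the hypotheses in the
    eigenvariable rules, but the axioms remain available after it. *)

Inductive derives (Ax : form -> Prop) : list form -> form -> Prop :=
| d_ax G A : Ax A -> derives Ax G A
| d_hyp G A : In A G -> derives Ax G A
| d_classic G A : derives Ax (Not A :: G) Bot -> derives Ax G A
| d_andI G A B : derives Ax G A -> derives Ax G B -> derives Ax G (And A B)
| d_andE1 G A B : derives Ax G (And A B) -> derives Ax G A
| d_andE2 G A B : derives Ax G (And A B) -> derives Ax G B
| d_orI1 G A B : derives Ax G A -> derives Ax G (Or A B)
| d_orI2 G A B : derives Ax G B -> derives Ax G (Or A B)
| d_orE G A B C : derives Ax G (Or A B) ->
    derives Ax (A :: G) C -> derives Ax (B :: G) C -> derives Ax G C
| d_impI G A B : derives Ax (A :: G) B -> derives Ax G (Imp A B)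
| d_impE G A B : derives Ax G (Imp A B) -> derives Ax G A -> derives Ax G B
| d_allI G r A : derives Ax (map (fshift r) G) A -> derives Ax G (All r A)
| d_allE G r A (t : tm r) : derives Ax G (All r A) -> derives Ax G (inst t A)
| d_exI G r A (t : tm r) : derives Ax G (inst t A) -> derives Ax G (Ex r A)
| d_exE G r A B : derives Ax G (Ex r A) ->
    derives Ax (A :: map (fshift r) G) (fshift r B) -> derives Ax G B.

Definition proves (Ax : form -> Prop) (A : form) : Prop := derives Ax [] A.

(** [Tm s] and [Fm] are terms and formulas as functions of the number of
    enclosing quantifiers of each type; this makes the index of a bound variable
    computable at each of its occurrences, so that [all] and [ex] can bind Rocq
    variables and no explicit shifts occur below. *)

Definition depth : Type := ty -> nat.
Definition Tm (s : ty) : Type := depth -> tm s.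
Definition Fm : Type := depth -> form.

Definition deeper (r : ty) (d : depth) : depth :=
  fun s => if ty_eq_dec r s then S (d s) else d s.

Definition bound (s : ty) (d : depth) : Tm s := fun d' => Var s (d' s - S (d s)).

Definition all (s : ty) (F : Tm s -> Fm) : Fm :=
  fun d => All s (F (bound s d) (deeper s d)).
Definition ex (s : ty) (F : Tm s -> Fm) : Fm :=
  fun d => Ex s (F (bound s d) (deeper s d)).

Definition closed_form (F : Fm) : form := F (fun _ => 0).

Definition app (s t : ty) (f : Tm (s ~> t)) (x : Tm s) : Tm t :=
  fun d => App (f d) (x d).
Definition zero : Tm T0 := fun _ => Zero.
Definition one : Tm T0 := fun _ => One.
Definition plus (x y : Tm T0) : Tm T0 := fun d => App (App Plus (x d)) (y d).
Definition times (x y : Tm T0) : Tm T0 := fun d => App (App Times (x d)) (y d).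
Definition eq0 (x y : Tm T0) : Fm := fun d => Eq0 (x d) (y d).
Definition lt0 (x y : Tm T0) : Fm := fun d => Lt0 (x d) (y d).
Definition conj (F G : Fm) : Fm := fun d => And (F d) (G d).
Definition impl (F G : Fm) : Fm := fun d => Imp (F d) (G d).
Definition neg (F : Fm) : Fm := fun d => Not (F d).

Declare Scope fm_scope.
Delimit Scope fm_scope with fm.
Notation "\all x : s , F" := (all (fun x : Tm s => F))
  (at level 200, x name, s at level 60, F at level 200, right associativity) : fm_scope.
Notation "\ex x : s , F" := (ex (fun x : Tm s => F))
  (at level 200, x name, s at level 60, F at level 200, right associativity) : fm_scope.
Notation "F ==> G" := (impl F G) (at level 80, right associativity) : fm_scope.
Notation "F &&& G" := (conj F G) (at level 78, right associativity) : fm_scope.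
Notation "! F" := (neg F) (at level 75, right associativity) : fm_scope.
Notation "x =0 y" := (eq0 x y) (at level 70) : fm_scope.
Notation "x <0 y" := (lt0 x y) (at level 70) : fm_scope.
Notation "x + y" := (plus x y) : fm_scope.
Notation "x * y" := (times x y) : fm_scope.
Notation "f @ x" := (app f x) (at level 10, left associativity) : fm_scope.

Declare Scope tm_scope.
Delimit Scope tm_scope with tm.
Notation "f @ x" := (App f x) (at level 10, left associativity) : tm_scope.
Notation "x + y" := (App (App Plus x) y) : tm_scope.
Notation "x * y" := (App (App Times x) y) : tm_scope.

Local Open Scope tm_scope.

Inductive RCA0w : form -> Prop :=
| eq_reflexive (x : tm T0) : RCA0w (Eq0 x x)
| eq_replace (x y : tm T0) (A : form) :
    RCA0w (Imp (Eq0 x y) (Imp (inst x A) (inst y A)))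
| add_assoc (x y z : tm T0) : RCA0w (Eq0 (x + (y + z)) ((x + y) + z))
| add_comm (x y : tm T0) : RCA0w (Eq0 (x + y) (y + x))
| add_zero (x : tm T0) : RCA0w (Eq0 (x + Zero) x)
| mul_assoc (x y z : tm T0) : RCA0w (Eq0 (x * (y * z)) ((x * y) * z))
| mul_comm (x y : tm T0) : RCA0w (Eq0 (x * y) (y * x))
| mul_one (x : tm T0) : RCA0w (Eq0 (x * One) x)
| mul_zero (x : tm T0) : RCA0w (Eq0 (x * Zero) Zero)
| mul_add (x y z : tm T0) : RCA0w (Eq0 (x * (y + z)) ((x * y) + (x * z)))
| lt_irrefl (x : tm T0) : RCA0w (Not (Lt0 x x))
| lt_trans (x y z : tm T0) : RCA0w (Imp (Lt0 x y) (Imp (Lt0 y z) (Lt0 x z)))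
| lt_total (x y : tm T0) : RCA0w (Or (Lt0 x y) (Or (Eq0 x y) (Lt0 y x)))
| lt_zero_one : RCA0w (Lt0 Zero One)
| lt_add (x y z : tm T0) : RCA0w (Imp (Lt0 x y) (Lt0 (x + z) (y + z)))
| lt_mul (x y z : tm T0) :
    RCA0w (Imp (Lt0 Zero z) (Imp (Lt0 x y) (Lt0 (x * z) (y * z))))
| Pi_axiom (s t : ty) (x : tm s) (y : tm t) : RCA0w (Eq (Pi s t @ x @ y) x)
| Sigma_axiom (r s t : ty) (x : tm (r ~> s ~> t)) (y : tm (r ~> s)) (z : tm r) :
    RCA0w (Eq (Sigma r s t @ x @ y @ z) (x @ z @ (y @ z)))
| Rec0_zero (f : tm (T0 ~> T0 ~> T0)) (m : tm T0) :
    RCA0w (Eq0 (Rec0 @ f @ m @ Zero) m)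
| Rec0_succ (f : tm (T0 ~> T0 ~> T0)) (m n : tm T0) :
    RCA0w (Eq0 (Rec0 @ f @ m @ (n + One)) (f @ n @ (Rec0 @ f @ m @ n)))
| extensionality (s t : ty) (x y : tm s) (phi : tm (s ~> t)) :
    RCA0w (Imp (Eq x y) (Eq (phi @ x) (phi @ y)))
(* induction on the variable of type 0 with index 0 *)
| QF_induction (A : form) : quantifier_free A ->
    RCA0w (Imp (inst Zero A)
          (Imp (All T0 (Imp A (fsubst succ_env A))) (All T0 A)))
(* QF-AC^{1,0}: in A, x is [Var T1 0] and y is [Var T0 0]; in the conclusion
   Y is [Var T2 0] *)
| QF_AC10 (A : form) : quantifier_free A ->
    RCA0w (Imp (All T1 (Ex T0 A))
               (Ex T2 (All T1 (inst (Var T2 0 @ (Var T1 0)) (fshift T2 A))))).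

Local Close Scope tm_scope.
Local Open Scope fm_scope.

Definition mu2 : form := closed_form (
  \ex mu : T2, \all f : T1,
    ((\ex n : T0, f @ n =0 zero) ==>
       (f @ (mu @ f) =0 zero) &&& (\all m : T0, m <0 mu @ f ==> ! (f @ m =0 zero)))
    &&& (! (\ex n : T0, f @ n =0 zero) ==> mu @ f =0 zero)).

Definition ACA0w (A : form) : Prop := RCA0w A \/ A = mu2.

(** The natural number [c] codes the pair [(i, j)] via Cantor's bijection, and
    [<a, <b, e>>] codes the rational [(a - b) / (e + 1)]; hence every natural
    number codes exactly one rational. *)

Definition pair_code (c i j : Tm T0) : Fm :=
  c + c =0 (i + j) * (i + j + one) + (j + j).

(** [(q_pos - q_neg) / q_den], with [q_den] positive. *)
Record rational : Type :=
  Rational { q_pos : Tm T0; q_neg : Tm T0; q_den : Tm T0 }.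

Definition decode (c : Tm T0) (F : rational -> Fm) : Fm :=
  \ex a : T0, \ex b : T0, \ex e : T0,
    (\ex p : T0, pair_code c a p &&& pair_code p b e) &&& F (Rational a b (e + one)).

Definition q_lt (q r : rational) : Fm :=
  q_pos q * q_den r + q_neg r * q_den q <0 q_pos r * q_den q + q_neg q * q_den r.
Definition q_le (q r : rational) : Fm := ! q_lt r q.
Definition q_add (q r : rational) : rational :=
  Rational (q_pos q * q_den r + q_pos r * q_den q)
           (q_neg q * q_den r + q_neg r * q_den q)
           (q_den q * q_den r).
Definition q_opp (q : rational) : rational :=
  Rational (q_neg q) (q_pos q) (q_den q).
Definition q_sub (q r : rational) : rational := q_add q (q_opp r).
Definition q_zero : rational := Rational zero zero one.
Definition q_one : rational := Rational one zero one.

(** [|q - r| < s] and [|q - r| <= s] *)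
Definition q_near_lt (q r s : rational) : Fm := q_lt (q_sub q r) s &&& q_lt (q_sub r q) s.
Definition q_near_le (q r s : rational) : Fm := q_le (q_sub q r) s &&& q_le (q_sub r q) s.

(** 2^n as R_0(f, 1, n), where f(k, m) = m + m; the term used for f is
    [Pi (Sigma + I)] with [I = Sigma Pi Pi] the identity of type 0 to 0. *)
Definition double_step : tm (T0 ~> T0 ~> T0) :=
  App (Pi (T0 ~> T0) T0)
      (App (App (Sigma T0 T0 T0) Plus)
           (App (App (Sigma T0 (T0 ~> T0) T0) (Pi T0 (T0 ~> T0))) (Pi T0 T0))).
Definition pow2 (n : Tm T0) : Tm T0 :=
  fun d => App (App (App Rec0 double_step) One) (n d).

(** 2^-n and 2^(1-n) *)
Definition two_pow_neg (n : Tm T0) : rational := Rational one zero (pow2 n).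
Definition two_pow_one_sub (n : Tm T0) : rational := Rational (one + one) zero (pow2 n).

Definition is_real (x : Tm T1) : Fm :=
  \all n : T0, \all i : T0,
    decode (x @ n) (fun q => decode (x @ (n + i)) (fun r =>
      q_near_lt q r (two_pow_neg n))).

(** A real-valued expression: [X n F] says that [F] holds of the [n]-th rational
    in the sequence representing [X].  The sequence of a sum or difference is
    shifted by one, so as to converge at the rate required by [is_real]. *)
Definition real : Type := Tm T0 -> (rational -> Fm) -> Fm.

Definition val (x : Tm T1) : real := fun n F => decode (x @ n) F.
Definition r_zero : real := fun _ F => F q_zero.
Definition r_one : real := fun _ F => F q_one.
Definition r_add (X Y : real) : real :=
  fun n F => X (n + one) (fun q => Y (n + one) (fun r => F (q_add q r))).
Definition r_sub (X Y : real) : real :=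
  fun n F => X (n + one) (fun q => Y (n + one) (fun r => F (q_sub q r))).

Definition r_eq (X Y : real) : Fm :=
  \all n : T0, X n (fun q => Y n (fun r => q_near_le q r (two_pow_one_sub n))).
Definition r_lt (X Y : real) : Fm :=
  \ex n : T0, X n (fun q => Y n (fun r => q_lt (q_add q (two_pow_one_sub n)) r)).
Definition r_le (X Y : real) : Fm := ! r_lt Y X.

Notation "# x" := (val x) (at level 9, x at level 9, format "# x") : fm_scope.
Notation "X +R Y" := (r_add X Y) (at level 50, left associativity) : fm_scope.
Notation "X -R Y" := (r_sub X Y) (at level 50, left associativity) : fm_scope.
Notation "X =R Y" := (r_eq X Y) (at level 70) : fm_scope.
Notation "X <R Y" := (r_lt X Y) (at level 70) : fm_scope.
Notation "X <=R Y" := (r_le X Y) (at level 70) : fm_scope.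

(** [|X - Y| < Z] *)
Definition r_near (X Y Z : real) : Fm := (X -R Y <R Z) &&& (Y -R X <R Z).

Definition pos_real (x : Tm T1) : Fm := is_real x &&& r_zero <R #x.

Definition in_I (x : Tm T1) : Fm := is_real x &&& r_zero <=R #x &&& #x <=R r_one.

Definition is_function_I (f : Tm (T1 ~> T1)) : Fm :=
  (\all x : T1, in_I x ==> is_real (f @ x)) &&&
  (\all x : T1, \all y : T1, in_I x ==> in_I y ==> #x =R #y ==> #(f @ x) =R #(f @ y)).

Definition continuous_I (f : Tm (T1 ~> T1)) : Fm :=
  \all x : T1, in_I x ==>
  \all eps : T1, pos_real eps ==>
  \ex delta : T1, pos_real delta &&&
  \all y : T1, in_I y ==> r_near #x #y #delta ==> r_near #(f @ x) #(f @ y) #eps.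

(** Sets of reals are given by formulas [E : Tm T1 -> Fm].  A sequence of open
    intervals is given by the sequences [a] and [b] of its endpoints, where
    empty intervals [a k = b k] are admitted. *)

Definition is_cover (E : Tm T1 -> Fm) (a b : Tm (T0 ~> T1)) : Fm :=
  (\all k : T0, is_real (a @ k) &&& is_real (b @ k) &&& #(a @ k) <=R #(b @ k)) &&&
  (\all x : T1, is_real x ==> E x ==> \ex k : T0, #(a @ k) <R #x &&& #x <R #(b @ k)).

(** [s n] is the sum of the lengths of the first [n] intervals. *)
Definition partial_sums (a b s : Tm (T0 ~> T1)) : Fm :=
  (\all n : T0, is_real (s @ n)) &&&
  #(s @ zero) =R r_zero &&&
  (\all n : T0, #(s @ (n + one)) =R #(s @ n) +R (#(b @ n) -R #(a @ n))).

Definition cover_with_sums (E : Tm T1 -> Fm) (a b s : Tm (T0 ~> T1)) : Fm :=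
  is_cover E a b &&& partial_sums a b s.

(** [C] is at most the limit of the increasing sequence [s], which may be infinite. *)
Definition le_sum (C : real) (s : Tm (T0 ~> T1)) : Fm :=
  \all c : T1, is_real c ==> #c <R C ==> \ex n : T0, #c <R #(s @ n).

(** The limit of the increasing sequence [s] is at most [C]. *)
Definition sum_le (s : Tm (T0 ~> T1)) (C : real) : Fm :=
  \all n : T0, #(s @ n) <=R C.

Definition measure_ge (E : Tm T1 -> Fm) (C : real) : Fm :=
  \all a : T0 ~> T1, \all b : T0 ~> T1, \all s : T0 ~> T1,
    cover_with_sums E a b s ==> le_sum C s.

(** The measure of [E] is below [C]: some cover has total length below [C]. *)
Definition measure_lt (E : Tm T1 -> Fm) (C : real) : Fm :=
  \ex a : T0 ~> T1, \ex b : T0 ~> T1, \ex s : T0 ~> T1,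
    cover_with_sums E a b s &&&
    \ex c : T1, is_real c &&& #c <R C &&& sum_le s #c.

(** The sum of the measures of [E] and [F] is at most [C]: for each [delta > 0]
    they have covers with total lengths summing to at most [C + delta].  The
    partial sums are increasing, so it suffices to add them termwise. *)
Definition measure_sum_le (E F : Tm T1 -> Fm) (C : real) : Fm :=
  \all delta : T1, pos_real delta ==>
  \ex a : T0 ~> T1, \ex b : T0 ~> T1, \ex s : T0 ~> T1,
  \ex a' : T0 ~> T1, \ex b' : T0 ~> T1, \ex s' : T0 ~> T1,
    cover_with_sums E a b s &&& cover_with_sums F a' b' s' &&&
    \all n : T0, #(s @ n) +R #(s' @ n) <=R C +R #delta.

Definition measurable_set (E : Tm T1 -> Fm) : Fm :=
  measure_sum_le E (fun x => in_I x &&& ! E x) r_one.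

Definition measurable_function (f : Tm (T1 ~> T1)) : Fm :=
  \all t : T1, is_real t ==> measurable_set (fun x => in_I x &&& #t <R #(f @ x)).

Definition LUS' : Fm :=
  \all f : T1 ~> T1, is_function_I f ==> measurable_function f ==>
  \all eps : T1, pos_real eps ==>
  \ex g : T1 ~> T1, is_function_I g &&& continuous_I g &&&
    measure_lt (fun x => in_I x &&& ! (#(f @ x) =R #(g @ x))) #eps.

Definition WHBU_m : Fm :=
  \all Psi : T1 ~> T1,
  is_function_I Psi ==> (\all x : T1, in_I x ==> r_zero <R #(Psi @ x)) ==>
  measurable_function Psi ==>
  \all eps : T1, pos_real eps ==>
  \ex n : T0, \ex y : T0 ~> T1,
    (\all i : T0, i <0 n + one ==> in_I (y @ i)) &&&
    measure_ge
      (fun x => \ex i : T0, i <0 n + one &&&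
         #(y @ i) -R #(Psi @ (y @ i)) <R #x &&& #x <R #(y @ i) +R #(Psi @ (y @ i)))
      (r_one -R #eps).

(* Main.v *)
From HB Require Import structures.
From mathcomp Require Import all_boot all_order all_algebra.
From mathcomp Require Import boolp ring lra.
From Pilot Require Import -(notations) Defs.

(** By completeness of the deductive system it suffices to argue in an
    arbitrary extensional model of ACA_0^omega.  Its numbers may be
    nonstandard, so induction, minima and recursion are only used for predicates
    and functions given by elements of the model; mu^2 closes them under
    quantification over numbers.  The rationals over these numbers form an
    ordered field, and a real is handled through the rationals below and above it.

    Let g be continuous and equal to Psi outside of a union O of intervals of
    total length below eps, and let C = [0,1] \ O.  From the intervals one defines
    points y_q, the least elements of C above rationals q; they are dense in C.
    Near a point x of C the function Psi is bounded below on C, because it agrees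
    there with g and g(x) > 0.  Hence x lies in the ball around a y_q close to it,
    and the balls around all the y_q together with the intervals of O cover [0,1].
    A finite subcover exists by Heine-Borel, and by countable subadditivity each
    cover of the finitely many balls has length at least 1 - eps.  Both of these
    are instances of induction along the rationals of [0,1], which rests on the
    existence of suprema of arithmetical sets. *)

Set Implicit Arguments.
Unset Strict Implicit.
Unset Printing Implicit Defensive.

Notation "s ~> t" := (Arr s t) (at level 58, right associativity).
Notation T1 := (T0 ~> T0).
Notation T2 := (T1 ~> T0).

(** The obstacle is that [Psi] and [g] act on reals, while minima, suprema and induction are
    available only for predicates that quantify over numbers. [Psi] may be a parameter of such a
    predicate, but no condition on all of its values can be part of one. So [Psi] is evaluated along
    a single sequence of reals that is an element of the model, and this sequence has to be found
    without looking at [Psi]: the points y_q depend on the intervals alone. They must lie in C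
    itself. At a point outside C continuity of g says nothing about [Psi], so the balls around the
    rationals, say, may be too small to cover anything, and g may even be negative there. At a point
    of C the balls are controlled because both the point to be covered and the nearby center satisfy
    Psi = g. The only loss of measure is the length of O: a cover of the finitely many balls becomes
    a cover of [0,1] when the intervals of O are added. The number of balls may be nonstandard, just
    like the number n that the conclusion asks for. *)

Section Quotient.

Variables (T : Type) (E : T -> T -> Prop).
Hypothesis E_refl : forall x, E x x.
Hypothesis E_sym : forall x y, E x y -> E y x.
Hypothesis E_trans : forall x y z, E x y -> E y z -> E x z.

(** Classes are predicates, so that propositional extensionality identifies the classes of
    equivalent elements. This serves for terms modulo provable equality and for fractions. *)
Definition quotient : Type := {P : T -> Prop | exists x, P = E x}.

Definition cls (x : T) : quotient := exist _ (E x) (ex_intro _ x erefl).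

Lemma cls_surj (c : quotient) : exists x, cls x = c.
Proof. by case: c => P [x H]; exists x; apply: eq_exist. Qed.

Lemma cls_eq (x y : T) : cls x = cls y <-> E x y.
Proof.
split=> [[H]|H]; first by rewrite H; apply: E_refl.
suff H' : E x = E y by apply: eq_exist.
apply/funext => z; apply/propext; split; apply: E_trans => //.
exact: E_sym.
Qed.

Definition rep (c : quotient) : T := projT1 (cid (cls_surj c)).

Lemma repK (c : quotient) : cls (rep c) = c.
Proof. exact: projT2 (cid (cls_surj c)). Qed.

End Quotient.

(** * Substitution *)

Lemma ty_eq_dec_refl s : ty_eq_dec s s = left (erefl s).
Proof.
case: (ty_eq_dec s s) => [e|[]//].
by rewrite (Prop_irrelevance e (erefl s)).
Qed.

Definition comp (e e' : env_tm) : env_tm := fun s n => tsubst e' (e s n).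

Lemma env_ext (e e' : env_tm) : (forall s n, e s n = e' s n) -> e = e'.
Proof. by move=> H; apply: functional_extensionality_dep => s; apply/funext. Qed.

Lemma tsubst_ext e e' t (x : tm t) :
  (forall s n, e s n = e' s n) -> tsubst e x = tsubst e' x.
Proof. by move/env_ext->. Qed.

Lemma tsubst_comp e e' t (x : tm t) : tsubst e' (tsubst e x) = tsubst (comp e e') x.
Proof. by elim: x => //= s t' f -> x ->. Qed.

Lemma tsubst_id t (x : tm t) : tsubst Var x = x.
Proof. by elim: x => //= s t' f -> x ->. Qed.

Lemma shift_up r e : comp (shift_env r) (up r e) = comp e (shift_env r).
Proof.
apply: env_ext => s n; rewrite /comp /shift_env /up.
by case: (ty_eq_dec r s) => E /=; case: (ty_eq_dec r s).
Qed.

Lemma tshift_up r e t (x : tm t) : tsubst (up r e) (tshift r x) = tshift r (tsubst e x).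
Proof. by rewrite /tshift !tsubst_comp shift_up. Qed.

Lemma up_comp r e e' : comp (up r e) (up r e') = up r (comp e e').
Proof.
apply: env_ext => s n; rewrite /comp /up.
case: (ty_eq_dec r s) => E; last exact: tshift_up.
by case: n => [|n] /=; [case: (ty_eq_dec r s) | apply: tshift_up].
Qed.

Lemma up_id r : up r Var = Var.
Proof.
apply: env_ext => s n; rewrite /up /tshift /= /shift_env.
by case: (ty_eq_dec r s) => E //; case: n.
Qed.

Lemma fsubst_comp e e' A : fsubst e' (fsubst e A) = fsubst (comp e e') A.
Proof.
elim: A e e' => //=.
- by move=> x y e e'; rewrite !tsubst_comp.
- by move=> x y e e'; rewrite !tsubst_comp.
- by move=> A IA B IB e e'; rewrite IA IB.
- by move=> A IA B IB e e'; rewrite IA IB.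
- by move=> A IA B IB e e'; rewrite IA IB.
- by move=> r A IA e e'; rewrite IA up_comp.
- by move=> r A IA e e'; rewrite IA up_comp.
Qed.

Lemma fsubst_id A : fsubst Var A = A.
Proof.
elim: A => //=; try by [move=> x y; rewrite !tsubst_id | move=> A -> B -> ].
- by move=> r A IA; rewrite up_id IA.
- by move=> r A IA; rewrite up_id IA.
Qed.

Lemma shift_inst r (x : tm r) : comp (shift_env r) (inst_env x) = Var.
Proof.
apply: env_ext => s n; rewrite /comp /shift_env /inst_env.
by case E: (ty_eq_dec r s) => [p|p] /=; rewrite E.
Qed.

Lemma tshift_inst r (x : tm r) t (y : tm t) : tsubst (inst_env x) (tshift r y) = y.
Proof. by rewrite /tshift tsubst_comp shift_inst tsubst_id. Qed.

Lemma inst_env0 r (x : tm r) : inst_env x r 0 = x.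
Proof. by rewrite /inst_env ty_eq_dec_refl. Qed.

Lemma inst_envS r (x : tm r) n : inst_env x r n.+1 = Var r n.
Proof. by rewrite /inst_env ty_eq_dec_refl. Qed.

Lemma ty_eq_dec_neq r s (H : r <> s) : exists H' : r <> s, ty_eq_dec r s = right H'.
Proof. by case: (ty_eq_dec r s) => // H'; exists H'. Qed.

Lemma inst_env_neq r (x : tm r) s n : r <> s -> inst_env x s n = Var s n.
Proof. by move=> /ty_eq_dec_neq[p E]; rewrite /inst_env E. Qed.

Lemma up0 r e : up r e r 0 = Var r 0.
Proof. by rewrite /up ty_eq_dec_refl. Qed.

Lemma inst_up r (x : tm r) e :
  comp (inst_env x) e = comp (up r e) (inst_env (tsubst e x)).
Proof.
apply: env_ext => s n; rewrite /comp /up.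
case: (ty_eq_dec r s) => E; last first.
  by rewrite tshift_inst /inst_env; case: (ty_eq_dec r s).
case: _ / E; case: n => [|n] /=; first by rewrite !inst_env0.
by rewrite tshift_inst /inst_env ty_eq_dec_refl.
Qed.

Lemma fsubst_inst r (x : tm r) e A :
  fsubst e (inst x A) = inst (tsubst e x) (fsubst (up r e) A).
Proof. by rewrite /inst !fsubst_comp inst_up. Qed.

Lemma fsubst_fshift r e A : fsubst (up r e) (fshift r A) = fshift r (fsubst e A).
Proof. by rewrite /fshift !fsubst_comp shift_up. Qed.

Lemma fsubst_Eq t (x y : tm t) e : fsubst e (Eq x y) = Eq (tsubst e x) (tsubst e y).
Proof.
elim: t x y e => [|s _ t IH] x y e //=.
by rewrite IH /= !tshift_up up0.
Qed.

Lemma quantifier_free_fsubst e A : quantifier_free A -> quantifier_free (fsubst e A).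
Proof. by elim: A e => //= A IA B IB e [/IA HA /IB HB]; split. Qed.

(** Makes the induction scheme closed under substitution: [succ_env] changes only the variable bound
    by the quantifier, which [up T0 e] leaves alone. *)
Lemma up_succ e : comp succ_env (up T0 e) = comp (up T0 e) succ_env.
Proof.
apply: env_ext => s n; rewrite /comp; case: s => [|s t] /=.
  case: n => [|n] //=; rewrite /tshift tsubst_comp.
  by apply: tsubst_ext => -[|s t] [|m].
rewrite /up /= /tshift tsubst_comp.
by apply: tsubst_ext => -[|s' t'] [|m].
Qed.

Lemma RCA0w_fsubst e A : RCA0w A -> RCA0w (fsubst e A).
Proof.
case=> {A}; try by [intros; rewrite /= ?fsubst_Eq; constructor].
- by move=> x y A /=; rewrite !fsubst_inst; apply: eq_replace.
- move=> A H /=; rewrite fsubst_inst fsubst_comp up_succ -fsubst_comp.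
  exact/QF_induction/quantifier_free_fsubst.
- move=> A H /=.
  have -> : fsubst (up T1 (up T2 e)) (inst (App (Var T2 0) (Var T1 0)) (fshift T2 A)) =
            inst (App (Var T2 0) (Var T1 0)) (fshift T2 (fsubst (up T0 (up T1 e)) A)).
    rewrite /inst /fshift !fsubst_comp; congr (fsubst _ A); apply: env_ext.
    (* The shapes distinguished are just enough for the comparisons of a type with [T0], [T1] and
       [T2] to compute. *)
    case=> [|[|[|? ?] [|? ?]] [|? ?]] [|n] //=; rewrite /comp /up /= /tshift ?tsubst_comp //;
    by apply: tsubst_ext => -[|[|[|? ?] [|? ?]] [|? ?]] [|m].
  exact/QF_AC10/quantifier_free_fsubst.
Qed.

Lemma ACA0w_fsubst e A : ACA0w A -> ACA0w (fsubst e A).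
Proof. by case=> [/RCA0w_fsubst|->]; [left | right]. Qed.

Lemma derives_fsubst G A e :
  derives ACA0w G A -> derives ACA0w (List.map (fsubst e) G) (fsubst e A).
Proof.
move=> D; elim: D e => {G A} /=.
- by move=> G A H e; apply/d_ax/ACA0w_fsubst.
- by move=> G A H e; apply/d_hyp/List.in_map.
- by move=> G A _ IH e; apply: d_classic; apply: IH.
- by move=> G A B _ IA _ IB e; apply: d_andI.
- by move=> G A B _ IH e; apply: d_andE1 (IH e).
- by move=> G A B _ IH e; apply: d_andE2 (IH e).
- by move=> G A B _ IH e; apply: d_orI1.
- by move=> G A B _ IH e; apply: d_orI2.
- by move=> G A B C _ IH _ IA _ IB e; apply: d_orE (IH e) (IA e) (IB e).
- by move=> G A B _ IH e; apply: d_impI.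
- by move=> G A B _ IA _ IB e; apply: d_impE (IA e) (IB e).
- move=> G r A _ IH e; apply: d_allI; have := IH (up r e).
  rewrite !List.map_map; congr derives; apply: List.map_ext => B.
  exact: fsubst_fshift.
- by move=> G r A t _ IH e; rewrite fsubst_inst; apply: d_allE.
- by move=> G r A t _ IH e; apply: (d_exI (t := tsubst e t)); rewrite -fsubst_inst.
- move=> G r A B _ IA _ IB e; apply: d_exE (IA e) _; have := IB (up r e).
  rewrite fsubst_fshift !List.map_map; congr (derives _ (_ :: _)).
  by apply: List.map_ext => C; apply: fsubst_fshift.
Qed.

Lemma derives_weaken G G' A :
  List.incl G G' -> derives ACA0w G A -> derives ACA0w G' A.
Proof.
move=> + D; elim: D G' => {G A}.
- by move=> G A H G' _; apply: d_ax.
- by move=> G A H G' I; apply/d_hyp/I.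
- by move=> G A _ IH G' I; apply: d_classic; apply: IH => B /= [->|/I]; [left|right].
- by move=> G A B _ IA _ IB G' I; apply: d_andI; [apply: IA | apply: IB].
- by move=> G A B _ IH G' I; apply: d_andE1 (IH _ I).
- by move=> G A B _ IH G' I; apply: d_andE2 (IH _ I).
- by move=> G A B _ IH G' I; apply/d_orI1/IH.
- by move=> G A B _ IH G' I; apply/d_orI2/IH.
- move=> G A B C _ IH _ IA _ IB G' I; apply: d_orE (IH _ I) _ _.
    by apply: IA => D /= [->|/I]; [left|right].
  by apply: IB => D /= [->|/I]; [left|right].
- by move=> G A B _ IH G' I; apply: d_impI; apply: IH => D /= [->|/I]; [left|right].
- by move=> G A B _ IA _ IB G' I; apply: d_impE (IA _ I) (IB _ I).
- by move=> G r A _ IH G' I; apply/d_allI/IH/List.incl_map.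
- by move=> G r A t _ IH G' I; apply/d_allE/IH.
- by move=> G r A t _ IH G' I; apply/(d_exI (t := t))/IH.
- move=> G r A B _ IA _ IB G' I; apply: d_exE (IA _ I) _; apply: IB => C /= [->|].
    by left.
  by move=> H; right; apply: List.incl_map H.
Qed.

(** * Completeness *)

Record structure := Structure {
  dom :> ty -> Type;
  ap : forall s t, dom (s ~> t) -> dom s -> dom t;
  i_zero : dom T0;
  i_one : dom T0;
  i_plus : dom (T0 ~> T0 ~> T0);
  i_times : dom (T0 ~> T0 ~> T0);
  i_Pi : forall s t, dom (s ~> t ~> s);
  i_Sigma : forall r s t, dom ((r ~> s ~> t) ~> (r ~> s) ~> r ~> t);
  i_Rec0 : dom ((T0 ~> T0 ~> T0) ~> T0 ~> T0 ~> T0);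
  i_lt : dom T0 -> dom T0 -> Prop }.
Arguments ap {_ _ _}.

Definition env (M : structure) := forall s, nat -> M s.

Fixpoint eval (M : structure) (rho : env M) t (x : tm t) : M t :=
  match x in tm t return M t with
  | Var s n => rho s n
  | App _ _ f y => ap (eval rho f) (eval rho y)
  | Zero => i_zero M
  | One => i_one M
  | Plus => i_plus M
  | Times => i_times M
  | Pi s t => i_Pi M s t
  | Sigma r s t => i_Sigma M r s t
  | Rec0 => i_Rec0 M
  end.

Definition push (M : structure) r (v : M r) (rho : env M) : env M :=
  fun s n =>
    match ty_eq_dec r s with
    | left e => match n with
                | 0 => eq_rect r M v s e
                | S m => rho s m
                end
    | right _ => rho s n
    end.

Fixpoint sat (M : structure) (rho : env M) (A : form) : Prop :=
  match A with
  | Bot => False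
  | Eq0 x y => eval rho x = eval rho y
  | Lt0 x y => i_lt (eval rho x) (eval rho y)
  | And A B => sat rho A /\ sat rho B
  | Or A B => sat rho A \/ sat rho B
  | Imp A B => sat rho A -> sat rho B
  | All r A => forall v : M r, sat (push v rho) A
  | Ex r A => exists v : M r, sat (push v rho) A
  end.

(** As [Eq0] is read as identity, this makes [Eq] identity at every type, so that equations in the
    model can be used for rewriting. *)
Definition extensional (M : structure) :=
  forall s t (f g : M (s ~> t)), (forall x, ap f x = ap g x) -> f = g.

Definition is_model (M : structure) :=
  extensional M /\ forall A, ACA0w A -> forall rho : env M, sat rho A.

(** Says through substitutions that free variables have indices below [k]; the form in which
    freshness is used when a derivation is renamed. *)
Definition bounded (k : nat) (A : form) : Prop :=
  forall e e' : env_tm, (forall s n, (n < k)%N -> e s n = e' s n) -> fsubst e A = fsubst e' A.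

Lemma tm_bounded t (x : tm t) : exists k : nat, forall e e' : env_tm,
  (forall s n, (n < k)%N -> e s n = e' s n) -> tsubst e x = tsubst e' x.
Proof.
elim: x => [s n|s t' f [k Hk] x [l Hl]|||||||]; try by exists 0.
  by exists n.+1 => e e' /= ->.
exists (maxn k l) => e e' H /=.
by rewrite (Hk e e') ?(Hl e e') // => s0 n Hn; apply: H; rewrite leq_max Hn ?orbT.
Qed.

Lemma up_agree k r (e e' : env_tm) : (forall s n, (n < k)%N -> e s n = e' s n) ->
  forall s n, (n < k)%N -> up r e s n = up r e' s n.
Proof.
move=> H s n Hn; rewrite /up.
case: (ty_eq_dec r s) => _; last by rewrite H.
by case: n Hn => // n /ltnW Hn; rewrite H.
Qed.

Lemma form_bounded A : exists k, bounded k A.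
Proof.
elim: A => [|x y|x y|A [k Hk] B [l Hl]|A [k Hk] B [l Hl]|A [k Hk] B [l Hl]
           |r A [k Hk]|r A [k Hk]].
- by exists 0.
- have [k Hk] := tm_bounded x; have [l Hl] := tm_bounded y.
  exists (maxn k l) => e e' H /=.
  by rewrite (Hk e e') ?(Hl e e') // => s0 n Hn; apply: H; rewrite leq_max Hn ?orbT.
- have [k Hk] := tm_bounded x; have [l Hl] := tm_bounded y.
  exists (maxn k l) => e e' H /=.
  by rewrite (Hk e e') ?(Hl e e') // => s0 n Hn; apply: H; rewrite leq_max Hn ?orbT.
- exists (maxn k l) => e e' H /=.
  by rewrite (Hk e e') ?(Hl e e') // => s0 n Hn; apply: H; rewrite leq_max Hn ?orbT.
- exists (maxn k l) => e e' H /=.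
  by rewrite (Hk e e') ?(Hl e e') // => s0 n Hn; apply: H; rewrite leq_max Hn ?orbT.
- exists (maxn k l) => e e' H /=.
  by rewrite (Hk e e') ?(Hl e e') // => s0 n Hn; apply: H; rewrite leq_max Hn ?orbT.
- by exists k => e e' H /=; rewrite (Hk _ _ (up_agree r H)).
- by exists k => e e' H /=; rewrite (Hk _ _ (up_agree r H)).
Qed.

Lemma bounded_le k l A : (k <= l)%N -> bounded k A -> bounded l A.
Proof. by move=> H B e e' E; apply: B => s n Hn; apply/E/leq_trans/H. Qed.

Lemma list_bounded (G : list form) : exists k, forall A, List.In A G -> bounded k A.
Proof.
elim: G => [|A G [k Hk]]; first by exists 0.
have [l Hl] := form_bounded A; exists (maxn k l) => B /= [<-|/Hk].
  by apply: bounded_le Hl; rewrite leq_maxr.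
by apply: bounded_le; rewrite leq_maxl.
Qed.

(** * Countability of the set of formulas *)

Notation code := (GenTree.tree nat).
Notation Leaf := GenTree.Leaf.
Notation Node := GenTree.Node.

Fixpoint ty_code (t : ty) : code :=
  match t with
  | T0 => Leaf 0
  | Arr s t => Node 0 [:: ty_code s; ty_code t]
  end.

Fixpoint tm_code t (x : tm t) : code :=
  match x with
  | Var s n => Node 0 [:: ty_code s; Leaf n]
  | App s t f y => Node 1 [:: ty_code (s ~> t); tm_code f; tm_code y]
  | Zero => Node 2 [::]
  | One => Node 3 [::]
  | Plus => Node 4 [::]
  | Times => Node 5 [::]
  | Pi s t => Node 6 [:: ty_code s; ty_code t]
  | Sigma r s t => Node 7 [:: ty_code r; ty_code s; ty_code t]
  | Rec0 => Node 8 [::]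
  end.

Fixpoint form_code (A : form) : code :=
  match A with
  | Bot => Node 0 [::]
  | Eq0 x y => Node 1 [:: tm_code x; tm_code y]
  | Lt0 x y => Node 2 [:: tm_code x; tm_code y]
  | And A B => Node 3 [:: form_code A; form_code B]
  | Or A B => Node 4 [:: form_code A; form_code B]
  | Imp A B => Node 5 [:: form_code A; form_code B]
  | All r A => Node 6 [:: ty_code r; form_code A]
  | Ex r A => Node 7 [:: ty_code r; form_code A]
  end.

Lemma ty_code_inj : injective ty_code.
Proof. by elim=> [|s IHs t IHt] [|s' t'] //= [/IHs -> /IHt ->]. Qed.

Lemma existT_inj (P : ty -> Type) s (x y : P s) : existT P s x = existT P s y -> x = y.
Proof. exact: (Eqdep_dec.inj_pair2_eq_dec ty ty_eq_dec). Qed.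

(** [App] hides the type of its argument, so the induction has to compare terms whose types are not
    known to agree; hence the dependent pairs. *)
Lemma tm_code_inj s (x : tm s) s' (y : tm s') :
  tm_code x = tm_code y -> existT tm s x = existT tm s' y.
Proof.
elim: x s' y => [s0 n|s0 t0 f IHf x IHx|||||s0 t0|r s0 t0|] s'
  [s1 m|s1 t1 g y|||||s1 t1|r1 s1 t1|] //=.
- by case=> /ty_code_inj -> ->.
- case=> /ty_code_inj Es /ty_code_inj Et; subst=> Hf Hx.
  have := IHf _ _ Hf => /(@existT_inj tm _ _ _) <-.
  by have := IHx _ _ Hx => /(@existT_inj tm _ _ _) <-.
- by case=> /ty_code_inj -> /ty_code_inj ->.
- by case=> /ty_code_inj -> /ty_code_inj -> /ty_code_inj ->.
Qed.

Lemma tm_code_inj0 s : injective (@tm_code s).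
Proof. by move=> x y /tm_code_inj /(@existT_inj tm _ _ _). Qed.

Lemma form_code_inj : injective form_code.
Proof.
elim=> [|x y|x y|A IA B IB|A IA B IB|A IA B IB|r A IA|r A IA]
  [|x' y'|x' y'|A' B'|A' B'|A' B'|r' A'|r' A'] //= [].
- by move=> /tm_code_inj0 -> /tm_code_inj0 ->.
- by move=> /tm_code_inj0 -> /tm_code_inj0 ->.
- by move=> /IA -> /IB ->.
- by move=> /IA -> /IB ->.
- by move=> /IA -> /IB ->.
- by move=> /ty_code_inj -> /IA ->.
- by move=> /ty_code_inj -> /IA ->.
Qed.

Lemma form_enumeration : exists F : nat -> form, forall A, exists n, F n = A.
Proof.
have /choice[F HF] : forall n, exists A, forall B, pickle (form_code B) = n -> B = A.
  move=> n; case: (pselect (exists B, pickle (form_code B) = n)) => [[B HB]|H].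
    exists B => B' H; apply/form_code_inj/(pcan_inj (@pickleK _)).
    by rewrite H HB.
  by exists Bot => B HB; case: H; exists B.
by exists F => A; exists (pickle (form_code A)); rewrite -(HF _ A).
Qed.

(** * Henkin construction of a maximal consistent theory *)

Definition consistent G := ~ derives ACA0w G Bot.

(* Renaming the fresh variable [Var r N] to [Var r 0] and raising the other
   variables of type [r] turns a derivation from the witnessed instance into
   the premise of existential elimination. *)
Lemma consistent_witness G r B N :
  (forall A, List.In A (Ex r B :: B :: G) -> bounded N A) ->
  consistent (Ex r B :: G) -> consistent (inst (Var r N) B :: Ex r B :: G).
Proof.
move=> HN C D; apply: C.
pose e : env_tm := fun s n =>
  if ty_eq_dec r s then (if n == N then Var s 0 else Var s n.+1) else Var s n.
have eShift A : bounded N A -> fsubst e A = fshift r A.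
  apply=> s n Hn; rewrite /e /shift_env.
  case: (pselect (r = s)) => [<-|/ty_eq_dec_neq[p E]]; last by rewrite E.
  by rewrite ty_eq_dec_refl; case: eqP Hn => // ->; rewrite ltnn.
have eB : fsubst e (inst (Var r N) B) = B.
  rewrite /inst fsubst_comp -[RHS]fsubst_id; apply: HN; first by right; left.
  move=> s n Hn; rewrite /comp; case: (pselect (r = s)) => [<-|rs]; last first.
    by rewrite inst_env_neq //=; case: (ty_eq_dec_neq rs) => p E; rewrite /e E.
  case: n Hn => [|n] Hn; rewrite ?inst_env0 ?inst_envS /= /e ty_eq_dec_refl ?eqxx //.
  by case: eqP Hn => // ->; rewrite ltnNge leqnSn.
apply: (d_exE (r := r) (A := B)); first by apply: d_hyp; left.
have := derives_fsubst e D; rewrite /= eB; congr derives; congr (_ :: _).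
rewrite -/(fsubst e (Ex r B)) eShift; last by apply: HN; left.
by congr (_ :: _); apply: List.map_ext_in => A HA; apply/eShift/HN; right; right.
Qed.

Section MaximalConsistent.

Variable (F0 : form).
Hypothesis F0_unprovable : ~ proves ACA0w F0.

Definition formula_enum : nat -> form := projT1 (cid form_enumeration).

Lemma formula_enumP A : exists n, formula_enum n = A.
Proof. exact: projT2 (cid form_enumeration) A. Qed.

(** The witnesses are variables instead of new constants: a stage is a finite list, so all large
    indices are fresh for it. *)
Definition extend (G : list form) (A : form) : list form :=
  if `[< consistent (A :: G) >] then
    match A with
    | Ex r B => inst (Var r (projT1 (cid (list_bounded (A :: B :: G))))) B :: A :: G
    | _ => A :: G
    end
  else G.

Fixpoint stage (n : nat) : list form :=
  match n with
  | 0 => [:: Not F0]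
  | S m => extend (stage m) (formula_enum m)
  end.

Lemma extend_consistent G A : consistent G -> consistent (extend G A).
Proof.
move=> CG; rewrite /extend; case: asboolP => // C.
case: A C => // r B C.
by apply: consistent_witness C; apply: (projT2 (cid (list_bounded _))).
Qed.

Lemma stage_consistent n : consistent (stage n).
Proof.
elim: n => [|n IH]; last exact: extend_consistent.
by move=> D; apply: F0_unprovable; apply: d_classic.
Qed.

Lemma stage_incl m n : (m <= n)%N -> List.incl (stage m) (stage n).
Proof.
move/subnK <-; elim: (n - m)%N => [|k IH]; first exact: List.incl_refl.
apply: List.incl_tran IH _ => A HA; rewrite addSn /= /extend.
case: asboolP => // _; case: (formula_enum _) => *; try by right.
by right; right.
Qed.

Definition thy (A : form) : Prop := exists n, List.In A (stage n).

Lemma thy_list G : (forall A, List.In A G -> thy A) -> exists n, List.incl G (stage n).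
Proof.
elim: G => [|A G IH] H; first by exists 0.
have [n Hn] := IH (fun B HB => H B (or_intror HB)).
have [m Hm] := H A (or_introl erefl).
exists (maxn m n) => B /= [<-|/Hn HB]; first exact: stage_incl (leq_maxl m n) _ Hm.
exact: stage_incl (leq_maxr m n) _ HB.
Qed.

Lemma thy_or_refutes A : thy A \/ exists n, derives ACA0w (stage n) (Not A).
Proof.
have [n <-] := formula_enumP A.
case: (pselect (consistent (formula_enum n :: stage n))) => C.
  left; exists n.+1; rewrite /= /extend; case: asboolP => // _.
  by case: (formula_enum n) => *; try (by left); right; left.
by right; exists n; apply: d_impI; apply: contrapT.
Qed.

(** The hypotheses all occur at one stage. If another stage refuted [A], the later of the two would
    be inconsistent. *)
Lemma thy_derives G A : (forall B, List.In B G -> thy B) -> derives ACA0w G A -> thy A.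
Proof.
move=> /thy_list[n Hn] /(derives_weaken Hn) D.
have [//|[m Dm]] := thy_or_refutes A.
case: (@stage_consistent (maxn m n)); apply: (d_impE (A := A)).
  exact: derives_weaken (stage_incl (leq_maxl _ _)) Dm.
exact: derives_weaken (stage_incl (leq_maxr _ _)) D.
Qed.

Lemma thy_ax A : ACA0w A -> thy A.
Proof. by move=> H; apply: (@thy_derives [::]) => //; apply: d_ax. Qed.

Lemma thy_mp A B : thy (Imp A B) -> thy A -> thy B.
Proof.
move=> HI HA; apply: (@thy_derives [:: Imp A B; A]) => [C /= [<-|[<-|//]]//|].
by apply: d_impE; [apply: d_hyp; left | apply: d_hyp; right; left].
Qed.

Lemma thy_Bot : ~ thy Bot.
Proof. by case=> n Hn; apply: (@stage_consistent n); apply: d_hyp. Qed.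

Lemma thy_Not A : thy (Not A) <-> ~ thy A.
Proof.
split=> [H1 H2|H]; first exact: thy_Bot (thy_mp H1 H2).
have [//|[n D]] := thy_or_refutes A.
by apply: thy_derives D => B HB; exists n.
Qed.

Lemma thy_Imp A B : thy (Imp A B) <-> (thy A -> thy B).
Proof.
split=> [|H]; first exact: thy_mp.
case: (pselect (thy A)) => [/H HB|/thy_Not HA].
  apply: (@thy_derives [:: B]) => [C /= [<-|//]//|].
  by apply/d_impI/d_hyp; right; left.
apply: (@thy_derives [:: Not A]) => [C /= [<-|//]//|].
apply/d_impI/d_classic/(d_impE (A := A)); apply: d_hyp => /=; tauto.
Qed.

Lemma thy_And A B : thy (And A B) <-> thy A /\ thy B.
Proof.
split=> [H|[HA HB]].
  split; apply: (@thy_derives [:: And A B]) => [C /= [<-|//]//|].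
    by apply: (d_andE1 (B := B)); apply: d_hyp; left.
  by apply: (d_andE2 (A := A)); apply: d_hyp; left.
apply: (@thy_derives [:: A; B]) => [C /= [<-|[<-|//]]//|].
by apply: d_andI; apply: d_hyp => /=; tauto.
Qed.

Lemma thy_Or A B : thy (Or A B) <-> thy A \/ thy B.
Proof.
split=> [H|[HA|HB]]; first last.
- apply: (@thy_derives [:: B]) => [C /= [<-|//]//|].
  by apply/d_orI2/d_hyp; left.
- apply: (@thy_derives [:: A]) => [C /= [<-|//]//|].
  by apply/d_orI1/d_hyp; left.
apply: contrapT => /not_orP[/thy_Not HA /thy_Not HB]; apply: thy_Bot.
apply: (@thy_derives [:: Or A B; Not A; Not B]) => [C /= [<-|[<-|[<-|//]]]//|].
apply: (d_orE (A := A) (B := B)); first by apply: d_hyp; left.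
  by apply: (d_impE (A := A)); apply: d_hyp => /=; tauto.
by apply: (d_impE (A := B)); apply: d_hyp => /=; tauto.
Qed.

Lemma thy_Ex r A : thy (Ex r A) <-> exists t : tm r, thy (inst t A).
Proof.
split=> [H|[t Ht]]; last first.
  apply: (@thy_derives [:: inst t A]) => [C /= [<-|//]//|].
  by apply/d_exI/d_hyp; left.
have [n Hn] := formula_enumP (Ex r A).
(* This is the witness that [extend] added when the enumeration reached [Ex r A]. *)
exists (Var r (projT1 (cid (list_bounded (Ex r A :: A :: stage n))))), n.+1.
rewrite /= /extend Hn; case: asboolP => [_|[]]; first by left.
move=> D; apply: thy_Bot; apply: thy_derives D => B /= [<-//|HB].
by exists n.
Qed.

Lemma thy_All r A : thy (All r A) <-> forall t : tm r, thy (inst t A).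
Proof.
split=> [H t|H].
  apply: (@thy_derives [:: All r A]) => [C /= [<-|//]//|].
  by apply/d_allE/d_hyp; left.
apply: contrapT => /thy_Not HA.
suff /thy_Ex[t /thy_Not[]] : thy (Ex r (Not A)) by apply: H.
apply: (@thy_derives [:: Not (All r A)]) => [C /= [<-|//]//|].
apply/d_classic/(d_impE (A := All r A)); first by apply: d_hyp; right; left.
apply/d_allI/d_classic => /=.
apply: (d_impE (A := Ex r (fsubst (up r (shift_env r)) (Not A)))).
  by apply: d_hyp; right; left.
(* The eigenvariable is the counterexample; what remains is that shifting and then instantiating by
   it is the identity. *)
apply: (d_exI (t := Var r 0)); apply: d_hyp; left.
rewrite /inst fsubst_comp -[LHS]fsubst_id; congr fsubst.
apply: env_ext => s m; rewrite /comp /up.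
case: (ty_eq_dec r s) => [p|p]; last first.
  by rewrite tshift_inst /shift_env; case: (ty_eq_dec r s).
destruct p; case: m => [|m] /=; first by rewrite inst_env0.
by rewrite tshift_inst /shift_env ty_eq_dec_refl.
Qed.

Lemma thy_Eq0_refl (x : tm T0) : thy (Eq0 x x).
Proof. by apply/thy_ax; left; apply: eq_reflexive. Qed.

Lemma thy_Eq0_replace (x y : tm T0) A : thy (Eq0 x y) -> thy (inst x A) -> thy (inst y A).
Proof. by move=> H; apply/thy_mp/thy_mp/H/thy_ax; left; apply: eq_replace. Qed.

(** * The term model *)

Definition eqv s (x y : tm s) : Prop := thy (Eq x y).

Lemma eqv_arrow s t (f g : tm (s ~> t)) :
  eqv f g <-> forall x, eqv (App f x) (App g x).
Proof.
rewrite /eqv thy_All; apply: iff_sym; rewrite /inst.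
by split=> H x; have := H x; rewrite fsubst_Eq /= !tshift_inst inst_env0.
Qed.

Lemma eqv_refl s (x : tm s) : eqv x x.
Proof.
by elim: s x => [|s _ t IH] x; [exact: thy_Eq0_refl | apply/eqv_arrow].
Qed.

Lemma eqv_sym s (x y : tm s) : eqv x y -> eqv y x.
Proof.
elim: s x y => [|s _ t IH] x y; last by move=> /eqv_arrow H; apply/eqv_arrow => z; apply: IH.
move=> H; have := thy_Eq0_replace (A := Eq0 (Var T0 0) (tshift T0 x)) H.
by rewrite /inst /= !tshift_inst !inst_env0; apply; apply: thy_Eq0_refl.
Qed.

Lemma eqv_trans s (x y z : tm s) : eqv x y -> eqv y z -> eqv x z.
Proof.
elim: s x y z => [|s _ t IH] x y z; last first.
  by move=> /eqv_arrow H /eqv_arrow H'; apply/eqv_arrow => u; apply: IH (H u) (H' u).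
move=> H H'; have := thy_Eq0_replace (A := Eq0 (tshift T0 x) (Var T0 0)) H'.
by rewrite /inst /= !tshift_inst !inst_env0; apply.
Qed.

(** Replacing the function is the definition of [Eq] at arrow types; replacing the argument is
    exactly the extensionality axiom. *)
Lemma eqv_app s t (f g : tm (s ~> t)) (x y : tm s) :
  eqv f g -> eqv x y -> eqv (App f x) (App g y).
Proof.
move=> /eqv_arrow Hf Hx; apply: eqv_trans (Hf y).
by apply: thy_mp Hx; apply/thy_ax; left; apply: extensionality.
Qed.

Lemma eqv_lt (x y x' y' : tm T0) : eqv x x' -> eqv y y' -> thy (Lt0 x y) -> thy (Lt0 x' y').
Proof.
move=> Hx Hy H.
have := thy_Eq0_replace (A := Lt0 (Var T0 0) (tshift T0 y)) Hx.
rewrite /inst /= !tshift_inst !inst_env0 => /(_ H) {}H.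
have := thy_Eq0_replace (A := Lt0 (tshift T0 x') (Var T0 0)) Hy.
by rewrite /inst /= !tshift_inst !inst_env0 => /(_ H).
Qed.

Definition class s : Type := quotient (@eqv s).

Definition tcls s (x : tm s) : class s := cls (@eqv s) x.

Lemma tcls_eq s (x y : tm s) : tcls x = tcls y <-> eqv x y.
Proof. exact: (cls_eq (@eqv_refl s) (@eqv_sym s) (@eqv_trans s)). Qed.

Lemma tcls_surj s (c : class s) : exists x, tcls x = c.
Proof. exact: cls_surj. Qed.

Lemma trepK s (c : class s) : tcls (rep c) = c.
Proof. exact: repK. Qed.

Definition term_model : structure := {|
  dom := class;
  ap := fun s t f x => tcls (App (rep f) (rep x));
  i_zero := tcls Zero;
  i_one := tcls One;
  i_plus := tcls Plus;
  i_times := tcls Times;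
  i_Pi := fun s t => tcls (Pi s t);
  i_Sigma := fun r s t => tcls (Sigma r s t);
  i_Rec0 := tcls Rec0;
  i_lt := fun x y => thy (Lt0 (rep x) (rep y)) |}.

Lemma ap_cls s t (f : tm (s ~> t)) (x : tm s) :
  @ap term_model s t (tcls f) (tcls x) = tcls (App f x).
Proof. by apply/tcls_eq/eqv_app; apply/tcls_eq/trepK. Qed.

Lemma term_model_extensional : extensional term_model.
Proof.
move=> s t f g H; rewrite -(trepK f) -(trepK g); apply/tcls_eq/eqv_arrow => x.
by apply/tcls_eq; rewrite -!ap_cls !trepK; apply: H.
Qed.

Definition cls_env (e : env_tm) : env term_model := fun s n => tcls (e s n).

Lemma cls_env_surj (rho : env term_model) : exists e, rho = cls_env e.
Proof.
exists (fun s n => rep (rho s n)).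
by apply: functional_extensionality_dep => s; apply/funext => n; rewrite /cls_env trepK.
Qed.

Lemma eval_cls e t (x : tm t) : eval (cls_env e) x = tcls (tsubst e x).
Proof. by elim: x => //= s t' f -> x ->; apply: ap_cls. Qed.

Lemma push_cls r (v : tm r) e :
  push (tcls v : term_model r) (cls_env e) = cls_env (comp (up r e) (inst_env v)).
Proof.
apply: functional_extensionality_dep => s; apply/funext => n.
rewrite /push /cls_env /comp /up.
case: (ty_eq_dec r s) => p; last by rewrite tshift_inst.
by destruct p; case: n => [|n] /=; rewrite ?inst_env0 ?tshift_inst.
Qed.

(** Every element is the class of a term, so the quantifier cases reduce to [thy_All] and [thy_Ex],
    where the witnesses enter. *)
Lemma truth e A : sat (cls_env e) A <-> thy (fsubst e A).
Proof.
elim: A e => [|x y|x y|A IA B IB|A IA B IB|A IA B IB|r A IA|r A IA] e /=.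
- by split=> // /thy_Bot.
- by rewrite !eval_cls tcls_eq.
- rewrite !eval_cls; split; apply: eqv_lt; apply/tcls_eq; rewrite trepK //.
- by rewrite thy_And IA IB.
- by rewrite thy_Or IA IB.
- by rewrite thy_Imp IA IB.
- have E v : sat (push (tcls v : term_model r) (cls_env e)) A <->
              thy (inst v (fsubst (up r e) A)).
    by rewrite push_cls IA /inst fsubst_comp.
  rewrite thy_All; split=> H v; first exact/E.
  by have [x <-] := tcls_surj v; apply/E.
- have E v : sat (push (tcls v : term_model r) (cls_env e)) A <->
              thy (inst v (fsubst (up r e) A)).
    by rewrite push_cls IA /inst fsubst_comp.
  rewrite thy_Ex; split=> -[v]; last by move/E; exists (tcls v).
  by have [x <-] := tcls_surj v => /E; exists x.
Qed.

Lemma term_model_is_model : is_model term_model.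
Proof.
split=> [|A HA rho]; first exact: term_model_extensional.
have [e ->] := cls_env_surj rho.
(* An assignment amounts to a substitution, and substitution instances of axioms are axioms. *)
exact/truth/thy_ax/ACA0w_fsubst.
Qed.

Lemma term_model_refutes : ~ sat (cls_env Var) F0.
Proof.
move/truth; rewrite fsubst_id; apply/thy_Not.
by exists 0; left.
Qed.

End MaximalConsistent.

Theorem completeness (F : form) :
  (forall M, is_model M -> forall rho : env M, sat rho F) -> proves ACA0w F.
Proof.
move=> H; apply: contrapT => HF.
exact: (term_model_refutes HF) (H _ (term_model_is_model HF) _).
Qed.

(** * The statement in a model *)

(* The definitions of this section copy those of the formulas with the same
   names, so that [sat] of such a formula unfolds to them by conversion. *)
Module Sem.
Section Sem.

Variable M : structure.
Notation N := (M T0).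

Definition plus (x y : N) : N := ap (ap (i_plus M) x) y.
Definition times (x y : N) : N := ap (ap (i_times M) x) y.
Notation zero := (i_zero M).
Notation one := (i_one M).

Definition pair_code (c i j : N) : Prop :=
  plus c c = plus (times (plus i j) (plus (plus i j) one)) (plus j j).

Record rational := Rational { q_pos : N; q_neg : N; q_den : N }.

Definition decode (c : N) (F : rational -> Prop) : Prop :=
  exists a b e, (exists p, pair_code c a p /\ pair_code p b e) /\
    F (Rational a b (plus e one)).

Definition q_lt (q r : rational) : Prop :=
  i_lt (plus (times (q_pos q) (q_den r)) (times (q_neg r) (q_den q)))
       (plus (times (q_pos r) (q_den q)) (times (q_neg q) (q_den r))).
Definition q_le (q r : rational) : Prop := q_lt r q -> False.
Definition q_add (q r : rational) : rational :=
  Rational (plus (times (q_pos q) (q_den r)) (times (q_pos r) (q_den q)))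
           (plus (times (q_neg q) (q_den r)) (times (q_neg r) (q_den q)))
           (times (q_den q) (q_den r)).
Definition q_opp (q : rational) : rational := Rational (q_neg q) (q_pos q) (q_den q).
Definition q_sub (q r : rational) : rational := q_add q (q_opp r).
Definition q_zero : rational := Rational zero zero one.
Definition q_one : rational := Rational one zero one.
Definition q_near_lt (q r s : rational) : Prop :=
  q_lt (q_sub q r) s /\ q_lt (q_sub r q) s.
Definition q_near_le (q r s : rational) : Prop :=
  q_le (q_sub q r) s /\ q_le (q_sub r q) s.

Definition double_step : M (T0 ~> T0 ~> T0) :=
  ap (i_Pi M (T0 ~> T0) T0)
     (ap (ap (i_Sigma M T0 T0 T0) (i_plus M))
         (ap (ap (i_Sigma M T0 (T0 ~> T0) T0) (i_Pi M T0 (T0 ~> T0))) (i_Pi M T0 T0))).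
Definition pow2 (n : N) : N := ap (ap (ap (i_Rec0 M) double_step) one) n.
Definition two_pow_neg (n : N) : rational := Rational one zero (pow2 n).
Definition two_pow_one_sub (n : N) : rational := Rational (plus one one) zero (pow2 n).

Definition is_real (x : M T1) : Prop :=
  forall n i : N, decode (ap x n) (fun q => decode (ap x (plus n i)) (fun r =>
    q_near_lt q r (two_pow_neg n))).

Definition real : Type := N -> (rational -> Prop) -> Prop.

Definition val (x : M T1) : real := fun n F => decode (ap x n) F.
Definition r_zero : real := fun _ F => F q_zero.
Definition r_one : real := fun _ F => F q_one.
Definition r_add (X Y : real) : real :=
  fun n F => X (plus n one) (fun q => Y (plus n one) (fun r => F (q_add q r))).
Definition r_sub (X Y : real) : real :=
  fun n F => X (plus n one) (fun q => Y (plus n one) (fun r => F (q_sub q r))).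
Definition r_eq (X Y : real) : Prop :=
  forall n, X n (fun q => Y n (fun r => q_near_le q r (two_pow_one_sub n))).
Definition r_lt (X Y : real) : Prop :=
  exists n, X n (fun q => Y n (fun r => q_lt (q_add q (two_pow_one_sub n)) r)).
Definition r_le (X Y : real) : Prop := r_lt Y X -> False.
Definition r_near (X Y Z : real) : Prop := r_lt (r_sub X Y) Z /\ r_lt (r_sub Y X) Z.

Definition pos_real (x : M T1) : Prop := is_real x /\ r_lt r_zero (val x).
Definition in_I (x : M T1) : Prop :=
  is_real x /\ r_le r_zero (val x) /\ r_le (val x) r_one.
Definition is_function_I (f : M (T1 ~> T1)) : Prop :=
  (forall x, in_I x -> is_real (ap f x)) /\
  (forall x y, in_I x -> in_I y -> r_eq (val x) (val y) ->
    r_eq (val (ap f x)) (val (ap f y))).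
Definition continuous_I (f : M (T1 ~> T1)) : Prop :=
  forall x, in_I x -> forall eps, pos_real eps -> exists delta, pos_real delta /\
  forall y, in_I y -> r_near (val x) (val y) (val delta) ->
    r_near (val (ap f x)) (val (ap f y)) (val eps).

Definition is_cover (E : M T1 -> Prop) (a b : M (T0 ~> T1)) : Prop :=
  (forall k, is_real (ap a k) /\ is_real (ap b k) /\
    r_le (val (ap a k)) (val (ap b k))) /\
  (forall x, is_real x -> E x ->
    exists k, r_lt (val (ap a k)) (val x) /\ r_lt (val x) (val (ap b k))).
Definition partial_sums (a b s : M (T0 ~> T1)) : Prop :=
  (forall n, is_real (ap s n)) /\
  r_eq (val (ap s zero)) r_zero /\
  (forall n, r_eq (val (ap s (plus n one)))
    (r_add (val (ap s n)) (r_sub (val (ap b n)) (val (ap a n))))).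
Definition cover_with_sums (E : M T1 -> Prop) (a b s : M (T0 ~> T1)) : Prop :=
  is_cover E a b /\ partial_sums a b s.
Definition le_sum (C : real) (s : M (T0 ~> T1)) : Prop :=
  forall c, is_real c -> r_lt (val c) C -> exists n, r_lt (val c) (val (ap s n)).
Definition sum_le (s : M (T0 ~> T1)) (C : real) : Prop :=
  forall n, r_le (val (ap s n)) C.
Definition measure_ge (E : M T1 -> Prop) (C : real) : Prop :=
  forall a b s, cover_with_sums E a b s -> le_sum C s.
Definition measure_lt (E : M T1 -> Prop) (C : real) : Prop :=
  exists a b s, cover_with_sums E a b s /\
    exists c, is_real c /\ r_lt (val c) C /\ sum_le s (val c).
Definition measure_sum_le (E F : M T1 -> Prop) (C : real) : Prop :=
  forall delta, pos_real delta -> exists a b s a' b' s',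
    cover_with_sums E a b s /\ cover_with_sums F a' b' s' /\
    forall n, r_le (r_add (val (ap s n)) (val (ap s' n))) (r_add C (val delta)).
Definition measurable_set (E : M T1 -> Prop) : Prop :=
  measure_sum_le E (fun x => in_I x /\ (E x -> False)) r_one.
Definition measurable_function (f : M (T1 ~> T1)) : Prop :=
  forall t, is_real t -> measurable_set (fun x => in_I x /\ r_lt (val t) (val (ap f x))).

Definition LUS' : Prop :=
  forall f, is_function_I f -> measurable_function f ->
  forall eps, pos_real eps ->
  exists g, is_function_I g /\ continuous_I g /\
    measure_lt (fun x => in_I x /\ (r_eq (val (ap f x)) (val (ap g x)) -> False)) (val eps).

Definition WHBU_m : Prop :=
  forall Psi, is_function_I Psi -> (forall x, in_I x -> r_lt r_zero (val (ap Psi x))) ->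
  measurable_function Psi ->
  forall eps, pos_real eps ->
  exists n (y : M (T0 ~> T1)),
    (forall i, i_lt i (plus n one) -> in_I (ap y i)) /\
    measure_ge
      (fun x => exists i, i_lt i (plus n one) /\
         r_lt (r_sub (val (ap y i)) (val (ap Psi (ap y i)))) (val x) /\
         r_lt (val x) (r_add (val (ap y i)) (val (ap Psi (ap y i)))))
      (r_sub r_one (val eps)).

Definition mu2 : Prop :=
  exists mu : M T2, forall f : M T1,
    ((exists n, ap f n = zero) ->
       ap f (ap mu f) = zero /\ (forall m, i_lt m (ap mu f) -> ap f m = zero -> False))
    /\ (((exists n, ap f n = zero) -> False) -> ap mu f = zero).

End Sem.
End Sem.

Lemma sat_statement M (rho : env M) :
  sat rho (closed_form (impl Defs.LUS' Defs.WHBU_m)) = (Sem.LUS' M -> Sem.WHBU_m M).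
Proof. reflexivity. Qed.
Lemma sat_mu2 M (rho : env M) : sat rho mu2 = Sem.mu2 M.
Proof. reflexivity. Qed.

Import Order.TTheory GRing.Theory Num.Theory.
Local Open Scope ring_scope.

(** * Arithmetic in a model *)

Lemma push0 (M : structure) r (v : M r) (rho : env M) : push v rho r 0 = v.
Proof. by rewrite /push ty_eq_dec_refl. Qed.

Lemma eval_tsubst (M : structure) (rho : env M) e t (x : tm t) :
  eval rho (tsubst e x) = eval (fun s n => eval rho (e s n)) x.
Proof. by elim: x => //= s t' f -> x ->. Qed.

Lemma eval_tshift (M : structure) r (v : M r) (rho : env M) t (x : tm t) :
  eval (push v rho) (tshift r x) = eval rho x.
Proof.
rewrite /tshift eval_tsubst; congr (eval _ x).
apply: functional_extensionality_dep => s; apply/funext => n.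
by rewrite /shift_env; case E: (ty_eq_dec r s) => [p|p] /=; rewrite /push E.
Qed.

Lemma push_up (M : structure) r (v : M r) (rho : env M) e :
  (fun s n => eval (push v rho) (up r e s n)) = push v (fun s n => eval rho (e s n)).
Proof.
apply: functional_extensionality_dep => s; apply/funext => n.
rewrite /up {2}/push; case: (ty_eq_dec r s) => p; last by rewrite eval_tshift.
by destruct p; case: n => [|n]; rewrite ?eval_tshift //= push0.
Qed.

Lemma sat_fsubst (M : structure) (rho : env M) e A :
  sat rho (fsubst e A) <-> sat (fun s n => eval rho (e s n)) A.
Proof.
elim: A rho e => [|x y|x y|A IA B IB|A IA B IB|A IA B IB|r A IA|r A IA] rho e /=;
  rewrite ?eval_tsubst ?IA ?IB //.
- by split=> H v; have := H v; rewrite IA push_up.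
- by split=> -[v H]; exists v; move: H; rewrite IA push_up.
Qed.

Lemma sat_inst (M : structure) (rho : env M) r (x : tm r) A :
  sat rho (inst x A) <-> sat (push (eval rho x) rho) A.
Proof.
rewrite /inst sat_fsubst; suff -> : (fun s n => eval rho (inst_env x s n)) =
  push (eval rho x) rho by [].
apply: functional_extensionality_dep => s; apply/funext => n.
rewrite /inst_env /push; case: (ty_eq_dec r s) => // p.
by destruct p; case: n.
Qed.

Lemma sat_Eq (M : structure) (rho : env M) t (x y : tm t) : extensional M ->
  sat rho (Eq x y) <-> eval rho x = eval rho y.
Proof.
move=> ext; elim: t x y rho => [|s _ t IH] x y rho //=; split=> [H|E v].
  by apply: ext => v; have /IH := H v; rewrite /= !eval_tshift push0.
by apply/IH; rewrite /= !eval_tshift E.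
Qed.

(** Bundling the proof lets the algebraic structures on [N M] be inferred from [M]. *)
Record model := Model { model_structure :> structure; modelP : is_model model_structure }.

Definition N (M : model) : Type := M T0.

HB.instance Definition _ (M : model) := gen_eqMixin (N M).
HB.instance Definition _ (M : model) := gen_choiceMixin (N M).

Section Arithmetic.

Variable M : model.
Notation N := (N M).

Definition n0 : N := i_zero M.
Definition n1 : N := i_one M.
Definition addN (x y : N) : N := Sem.plus x y.
Definition mulN (x y : N) : N := Sem.times x y.
Definition ltN (x y : N) : Prop := i_lt x y.

(** Every type is inhabited, so an axiom can be evaluated in an assignment that specifies only the
    variables at issue. *)
Fixpoint point (t : ty) : M t :=
  match t with
  | T0 => i_zero M
  | s ~> t => ap (i_Pi M t s) (point t)
  end.

Definition env0 : env M := fun s _ => point s.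
Definition env3 (x y z : N) : env M := push (x : M T0) (push (y : M T0) (push (z : M T0) env0)).

Lemma axiom A (rho : env M) : RCA0w A -> sat rho A.
Proof. by move=> H; apply: (proj2 (modelP M)); left. Qed.

Local Notation V0 := (Var T0 0).
Local Notation V1 := (Var T0 1).
Local Notation V2 := (Var T0 2).

Lemma addNA : associative addN.
Proof. move=> x y z; exact: (axiom (env3 x y z) (Defs.add_assoc V0 V1 V2)). Qed.
Lemma addNC : commutative addN.
Proof. move=> x y; exact: (axiom (env3 x y n0) (Defs.add_comm V0 V1)). Qed.
Lemma addN0 : right_id n0 addN.
Proof. move=> x; exact: (axiom (env3 x n0 n0) (Defs.add_zero V0)). Qed.
Lemma mulNA : associative mulN.
Proof. move=> x y z; exact: (axiom (env3 x y z) (Defs.mul_assoc V0 V1 V2)). Qed.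
Lemma mulNC : commutative mulN.
Proof. move=> x y; exact: (axiom (env3 x y n0) (Defs.mul_comm V0 V1)). Qed.
Lemma mulN1 : right_id n1 mulN.
Proof. move=> x; exact: (axiom (env3 x n0 n0) (Defs.mul_one V0)). Qed.
Lemma mulN0 : right_zero n0 mulN.
Proof. move=> x; exact: (axiom (env3 x n0 n0) (Defs.mul_zero V0)). Qed.
Lemma mulNDr : right_distributive mulN addN.
Proof. move=> x y z; exact: (axiom (env3 x y z) (Defs.mul_add V0 V1 V2)). Qed.
Lemma ltN_irr x : ~ ltN x x.
Proof. exact: (axiom (env3 x n0 n0) (Defs.lt_irrefl V0)). Qed.
Lemma ltN_trans x y z : ltN x y -> ltN y z -> ltN x z.
Proof. exact: (axiom (env3 x y z) (Defs.lt_trans V0 V1 V2)). Qed.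
Lemma ltN_total x y : ltN x y \/ x = y \/ ltN y x.
Proof. exact: (axiom (env3 x y n0) (Defs.lt_total V0 V1)). Qed.
Lemma ltN01 : ltN n0 n1.
Proof. exact: (axiom env0 Defs.lt_zero_one). Qed.
Lemma ltN_add2r z x y : ltN x y -> ltN (addN x z) (addN y z).
Proof. exact: (axiom (env3 x y z) (Defs.lt_add V0 V1 V2)). Qed.
Lemma ltN_mul2r z x y : ltN n0 z -> ltN x y -> ltN (mulN x z) (mulN y z).
Proof. exact: (axiom (env3 x y z) (Defs.lt_mul V0 V1 V2)). Qed.

Lemma PiE s t (x : M s) (y : M t) : ap (ap (i_Pi M s t) x) y = x.
Proof.
have /sat_Eq := axiom (push y (push x env0)) (Pi_axiom (tshift t (Var s 0)) (Var t 0)).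
move=> /(_ (proj1 (modelP M))) /=.
by rewrite push0 (eval_tshift _ _ (Var s 0)) /= push0.
Qed.

Lemma SigmaE r s t (x : M (r ~> s ~> t)) (y : M (r ~> s)) (z : M r) :
  ap (ap (ap (i_Sigma M r s t) x) y) z = ap (ap x z) (ap y z).
Proof.
have /sat_Eq := axiom (push z (push y (push x env0)))
  (Sigma_axiom (tshift r (tshift (r ~> s) (Var (r ~> s ~> t) 0)))
               (tshift r (Var (r ~> s) 0)) (Var r 0)).
move=> /(_ (proj1 (modelP M))) /=.
by rewrite push0 !eval_tshift /= !push0.
Qed.

Lemma Rec0_0 (f : M (T0 ~> T0 ~> T0)) (m : N) : ap (ap (ap (i_Rec0 M) f) m) n0 = m.
Proof.
exact: (axiom (push (m : M T0) (push f env0)) (Rec0_zero (Var (T0 ~> T0 ~> T0) 0) V0)).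
Qed.

Lemma Rec0_S (f : M (T0 ~> T0 ~> T0)) (m n : N) :
  ap (ap (ap (i_Rec0 M) f) m) (addN n n1) =
  ap (ap f n) (ap (ap (ap (i_Rec0 M) f) m) n).
Proof.
exact: (axiom (push (m : M T0) (push (n : M T0) (push f env0)))
  (Rec0_succ (Var (T0 ~> T0 ~> T0) 0) V0 V1)).
Qed.

Lemma qf_induction A (rho : env M) (P : N -> Prop) : quantifier_free A ->
  (forall n : N, sat (push (n : M T0) rho) A <-> P n) ->
  P n0 -> (forall n, P n -> P (addN n n1)) -> forall n, P n.
Proof.
move=> qA HP P0 PS n; apply/HP.
apply: (axiom rho (QF_induction qA)); first by apply/sat_inst/HP.
move=> {}n /HP /PS HS; apply/sat_fsubst.
suff -> : (fun s k => eval (push n rho) (succ_env s k)) =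
  push (addN n n1 : M T0) rho by apply/HP.
apply: functional_extensionality_dep => -[|s t]; apply/funext => -[|k] //=.
Qed.

Lemma add0N : left_id n0 addN.
Proof. by move=> x; rewrite addNC addN0. Qed.
Lemma mul1N : left_id n1 mulN.
Proof. by move=> x; rewrite mulNC mulN1. Qed.
Lemma mul0N : left_zero n0 mulN.
Proof. by move=> x; rewrite mulNC mulN0. Qed.
Lemma mulNDl : left_distributive mulN addN.
Proof. by move=> x y z; rewrite !(mulNC _ z) mulNDr. Qed.

HB.instance Definition _ := GRing.isNmodule.Build N addNA addNC add0N.
HB.instance Definition _ :=
  GRing.Nmodule_isComPzSemiRing.Build N mulNA mulNC mul1N mulNDl mul0N.

Lemma ltNS (x : N) : ltN x (x + 1).
Proof. by have := ltN_add2r x ltN01; rewrite -[addN _ _]/(0 + x) add0r addNC. Qed.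

Lemma ltN_add2l (z x y : N) : ltN x y -> ltN (z + x) (z + y).
Proof. by rewrite ![z + _]addrC; apply: ltN_add2r. Qed.

(** The axioms of an ordered semi-ring admit negative elements; that 0 is the least element comes
    from induction. *)
Lemma N_eq0_or_gt0 (x : N) : x = 0 \/ ltN 0 x.
Proof.
apply: (@qf_induction (Or (Eq0 V0 Zero) (Lt0 Zero V0)) env0 (fun x => x = 0 \/ ltN 0 x)) => //.
  by left.
by move=> n [->|H]; right; [apply: ltNS | apply: ltN_trans H (ltNS n)].
Qed.

Lemma ltN0_neq (x : N) : ltN 0 x <-> x <> 0.
Proof.
split=> [H E|]; first by apply: (@ltN_irr x); rewrite {1}E.
by case: (N_eq0_or_gt0 x).
Qed.

Lemma addN_eq0 (x y : N) : x + y = 0 -> x = 0 /\ y = 0.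
Proof.
move=> E; have H (u v : N) : u + v = 0 -> u = 0.
  case: (N_eq0_or_gt0 u) => // Hu; have : ltN 0 (u + v); last by move/ltN0_neq.
  case: (N_eq0_or_gt0 v) => [->|Hv]; first by rewrite addr0.
  by apply: ltN_trans Hu _; have := ltN_add2l u Hv; rewrite addr0.
by split; [apply: H E | apply: (H y x); rewrite addrC].
Qed.

Lemma addNI (z x y : N) : x + z = y + z -> x = y.
Proof.
have [H|[//|H]] := ltN_total x y => E; case: (@ltN_irr (x + z)).
  by rewrite {2}E; apply: ltN_add2r.
by rewrite {1}E; apply: ltN_add2r.
Qed.

Lemma ltN_add2rE (z x y : N) : ltN (x + z) (y + z) <-> ltN x y.
Proof.
split; last exact: ltN_add2r.
have [//|[->/ltN_irr//|H H']] := ltN_total x y.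
by case: (@ltN_irr (x + z)); apply: ltN_trans H' _; apply: ltN_add2r.
Qed.

Lemma ltN_mul2rE (z x y : N) : z <> 0 -> ltN (x * z) (y * z) <-> ltN x y.
Proof.
move=> /ltN0_neq z0; split; last exact: ltN_mul2r.
have [//|[->/ltN_irr//|H H']] := ltN_total x y.
by case: (@ltN_irr (x * z)); apply: ltN_trans H' _; apply: ltN_mul2r.
Qed.

Lemma mulNI (z x y : N) : z <> 0 -> x * z = y * z -> x = y.
Proof.
move=> z0 E; have [H|[//|H]] := ltN_total x y; have := H; rewrite -(ltN_mul2rE _ _ z0) E;
by move/ltN_irr.
Qed.

(** The recursion step is [Pi], which returns the index and drops the previous value. Cut-off
    subtraction, iterated [pred_fun], later writes comparisons as equations with right-hand side 0,
    the form to which mu^2 applies. *)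
Definition pred_fun : M T1 := ap (ap (i_Rec0 M) (i_Pi M T0 T0)) (0 : N).
Definition predN (x : N) : N := ap pred_fun x.
Definition sub_fun : M (T0 ~> T0 ~> T0) := ap (i_Rec0 M) (ap (i_Pi M T1 T0) pred_fun).
Definition subN (x y : N) : N := ap (ap sub_fun x) y.

Lemma predN0 : predN 0 = 0.
Proof. exact: Rec0_0. Qed.
Lemma predNS x : predN (x + 1) = x.
Proof. by rewrite /predN Rec0_S PiE. Qed.
Lemma subN0 x : subN x 0 = x.
Proof. exact: Rec0_0. Qed.
Lemma subNS x y : subN x (y + 1) = predN (subN x y).
Proof. by rewrite /subN Rec0_S PiE. Qed.

(** Terms denoting the two functions, for use in induction formulas. *)
Definition pred_tm : tm T1 := App (App Rec0 (Pi T0 T0)) Zero.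
Definition sub_tm : tm (T0 ~> T0 ~> T0) := App Rec0 (App (Pi T1 T0) pred_tm).

Lemma predNK x : x = 0 \/ predN x + 1 = x.
Proof.
apply: (@qf_induction
  (Or (Eq0 V0 Zero) (Eq0 (App (App Plus (App pred_tm V0)) One) V0)) env0
  (fun x => x = 0 \/ predN x + 1 = x)) => //; first by left.
by move=> n _; right; rewrite predNS.
Qed.

Lemma subNK x y : ltN x y \/ subN x y + y = x.
Proof.
apply: (@qf_induction
  (Or (Lt0 V1 V0) (Eq0 (App (App Plus (App (App sub_tm V1) V0)) V0) V1)) (push (x : M T0) env0)
  (fun y => ltN x y \/ subN x y + y = x)) => //.
  by right; rewrite subN0 -[RHS]addr0.
move=> n [H|H]; first by left; apply: ltN_trans H (ltNS n).
rewrite subNS -[addN _ _]/(n + 1); have [E|E] := predNK (subN x n).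
  by left; rewrite -H E add0r; apply: ltNS.
by right; rewrite [n + 1]addrC addrA E.
Qed.

Lemma subN_add x y : subN x (x + y) = 0.
Proof.
apply: (@qf_induction
  (Eq0 (App (App sub_tm V1) (App (App Plus V1) V0)) Zero) (push (x : M T0) env0)
  (fun y => subN x (x + y) = 0)) => //.
  have [/ltN_irr//|E] := subNK x x; rewrite addr0.
  by apply: (@addNI x); rewrite E add0r.
by move=> n H; rewrite -[addN _ _]/(n + 1) addrA subNS H predN0.
Qed.

Lemma ltN_sub x y : ltN x y <-> subN y x <> 0.
Proof.
split=> [H E|H].
  have [H'|] := subNK y x; first exact: (@ltN_irr x (ltN_trans H H')).
  by rewrite E add0r => E'; apply: (@ltN_irr x); rewrite {2}E'.
have [//|E] := subNK x y; case: H; rewrite -E addrC; exact: subN_add.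
Qed.

Lemma ltN_exists x y : ltN x y -> exists z, y = x + z + 1.
Proof.
move=> H; have [H'|E] := subNK y x; first by case: (@ltN_irr x (ltN_trans H H')).
move/ltN_sub: H; have [//|E' _] := predNK (subN y x).
by exists (predN (subN y x)); rewrite -addrA E' addrC E.
Qed.

Lemma ltNSE x y : ltN x (y + 1) <-> ~ ltN y x.
Proof.
split=> [H /ltN_exists[z E]|H].
  move: H; rewrite E ltN_add2rE => H; apply: (@ltN_irr y).
  case: (N_eq0_or_gt0 z) => [z0|z0]; first by move: H; rewrite z0 addr0.
  by apply: ltN_trans H; have := ltN_add2l y z0; rewrite addr0.
have [H'|[->|//]] := ltN_total x y; last exact: ltNS.
exact: ltN_trans H' (ltNS y).
Qed.

Lemma subN_eq0 x y : subN x y + subN y x = 0 <-> x = y.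
Proof.
split=> [/addN_eq0[E E']|->]; last by rewrite -{2 4}[y]addr0 subN_add addr0.
by have [/ltN_sub//|[//|/ltN_sub//]] := ltN_total x y.
Qed.

Lemma subN1_eq0 x : subN 1 x = 0 <-> x <> 0.
Proof.
rewrite -ltN0_neq; split=> [E|H].
  by apply: contrapT; rewrite -ltNSE add0r => /ltN_sub.
by apply: contrapT => /ltN_sub; rewrite -[1]add0r ltNSE.
Qed.

End Arithmetic.

(** * Internal functions and arithmetical predicates *)

Section Internal.

Variable M : model.
Notation N := (N M).

(* A context lists the types of the variables of a function, the innermost
   variable first. *)
Fixpoint ctx (G : list ty) : Type :=
  match G with [::] => unit | r :: G => (M r * ctx G)%type end.

(** The innermost variable becomes the last argument, so that abstracting it ([internal_lam]) leaves
    the same element of the model. *)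
Fixpoint curried (G : list ty) (t : ty) : ty :=
  match G with [::] => t | r :: G => curried G (r ~> t) end.

Fixpoint apps (G : list ty) (t : ty) : M (curried G t) -> ctx G -> M t :=
  match G return M (curried G t) -> ctx G -> M t with
  | [::] => fun F _ => F
  | r :: G => fun F g => ap (@apps G (r ~> t) F g.2) g.1
  end.

Definition internal G t (f : ctx G -> M t) : Prop := exists F, forall g, apps F g = f g.

Lemma internal_lam G r t (f : ctx (r :: G) -> M t) : internal f ->
  exists L : ctx G -> M (r ~> t), internal L /\ forall g x, ap (L g) x = f (x, g).
Proof.
case=> F HF; exists (apps (G := G) F); split; first by exists F.
by move=> g x; rewrite -HF.
Qed.

Lemma internal_unlam G r t (L : ctx G -> M (r ~> t)) :
  internal L -> internal (fun g : ctx (r :: G) => ap (L g.2) g.1).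
Proof. by case=> F HF; exists F => g /=; rewrite HF. Qed.

Lemma internal_eq G t (f f' : ctx G -> M t) :
  (forall g, f g = f' g) -> internal f -> internal f'.
Proof. by move/funext->. Qed.

(** Bracket abstraction: [Pi] adds a variable to a constant, [Sigma] distributes a variable over an
    application. The two claims need each other when the context grows. *)
Lemma internal_const_ap G :
  (forall t (c : M t), internal (fun _ : ctx G => c)) /\
  (forall s t (f : ctx G -> M (s ~> t)) (h : ctx G -> M s),
    internal f -> internal h -> internal (fun g => ap (f g) (h g))).
Proof.
elim: G => [|r G [IC IA]].
  split=> [t c|s t f h [F HF] [H HH]]; first by exists c.
  by exists (ap F H) => g /=; rewrite -(HF g) -(HH g).
split=> [t c|s t f h].
  by apply: internal_eq (internal_unlam (IC _ (ap (i_Pi M t r) c))) => g; rewrite PiE.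
move=> /internal_lam[L [IL EL]] /internal_lam[K [IK EK]].
have := internal_unlam (IA _ _ _ _ (IA _ _ _ _ (IC _ (i_Sigma M r s t)) IL) IK).
by apply: internal_eq => -[x g]; rewrite SigmaE EL EK.
Qed.

Lemma internal_const G t (c : M t) : internal (fun _ : ctx G => c).
Proof. exact: (proj1 (internal_const_ap G)). Qed.

Lemma internal_ap G s t (f : ctx G -> M (s ~> t)) (h : ctx G -> M s) :
  internal f -> internal h -> internal (fun g => ap (f g) (h g)).
Proof. exact: (proj2 (internal_const_ap G)). Qed.

Lemma internal_fst G r : internal (fun g : ctx (r :: G) => g.1).
Proof.
apply: internal_eq (internal_unlam (internal_const G
  (ap (ap (i_Sigma M r (r ~> r) r) (i_Pi M r (r ~> r))) (i_Pi M r r)))) => g.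
by rewrite SigmaE PiE.
Qed.

Lemma internal_snd G r t (f : ctx G -> M t) :
  internal f -> internal (fun g : ctx (r :: G) => f g.2).
Proof.
move=> If; have := internal_unlam (internal_ap (internal_const G (i_Pi M t r)) If).
by apply: internal_eq => g; rewrite PiE.
Qed.

Definition internalN G (f : ctx G -> N) : Prop := @internal G T0 f.

Lemma internal_add G (f h : ctx G -> N) :
  internalN f -> internalN h -> internalN (fun g => f g + h g).
Proof. by move=> If Ih; apply: internal_ap Ih; apply: internal_ap If; apply: internal_const. Qed.

Lemma internal_mul G (f h : ctx G -> N) :
  internalN f -> internalN h -> internalN (fun g => f g * h g).
Proof. by move=> If Ih; apply: internal_ap Ih; apply: internal_ap If; apply: internal_const. Qed.

Lemma internal_sub G (f h : ctx G -> N) :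
  internalN f -> internalN h -> internalN (fun g => subN (f g) (h g)).
Proof. by move=> If Ih; apply: internal_ap Ih; apply: internal_ap If; apply: internal_const. Qed.

(** The value 0 means true. Connectives are computed with sums and cut-off subtraction; a quantifier
    over numbers is evaluated at the least zero found by mu^2. The context may contain variables of
    any type. *)
Definition arith G (P : ctx G -> Prop) : Prop :=
  exists f : ctx G -> N, internalN f /\ forall g, P g <-> f g = 0.

Lemma arith_iff G (P Q : ctx G -> Prop) : (forall g, P g <-> Q g) -> arith P -> arith Q.
Proof. by move=> PQ [f [If Hf]]; exists f; split=> // g; rewrite -PQ. Qed.

Lemma arith_eq G (f h : ctx G -> N) :
  internalN f -> internalN h -> arith (fun g => f g = h g).
Proof.
move=> If Ih; exists (fun g => subN (f g) (h g) + subN (h g) (f g)).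
by split=> [|g]; [apply: internal_add; apply: internal_sub | rewrite subN_eq0].
Qed.

Lemma arith_not G (P : ctx G -> Prop) : arith P -> arith (fun g => ~ P g).
Proof.
move=> [f [If Hf]]; exists (fun g => subN 1 (f g)).
by split=> [|g]; [apply: internal_sub If; apply: internal_const | rewrite subN1_eq0 Hf].
Qed.

Lemma arith_and G (P Q : ctx G -> Prop) :
  arith P -> arith Q -> arith (fun g => P g /\ Q g).
Proof.
move=> [f [If Hf]] [h [Ih Hh]]; exists (fun g => f g + h g).
split=> [|g]; first exact: internal_add.
by rewrite Hf Hh; split=> [[-> ->]|/addN_eq0//]; rewrite addr0.
Qed.

Lemma arith_imp G (P Q : ctx G -> Prop) :
  arith P -> arith Q -> arith (fun g => P g -> Q g).
Proof.
move=> aP aQ; apply: arith_iff (arith_not (arith_and aP (arith_not aQ))) => g.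
by case: (pselect (Q g)) => ?; tauto.
Qed.

Lemma arith_or G (P Q : ctx G -> Prop) :
  arith P -> arith Q -> arith (fun g => P g \/ Q g).
Proof.
move=> aP aQ; apply: arith_iff (arith_imp (arith_not aP) aQ) => g.
by case: (pselect (P g)) => ?; tauto.
Qed.

Lemma arith_lt G (f h : ctx G -> N) :
  internalN f -> internalN h -> arith (fun g => ltN (f g) (h g)).
Proof.
move=> If Ih; have := arith_not (arith_eq (internal_sub Ih If) (internal_const G (0 : N))).
by apply: arith_iff => g; rewrite ltN_sub.
Qed.

Lemma mu_exists : Sem.mu2 M.
Proof.
rewrite -(sat_mu2 (env0 M)).
by apply: (proj2 (modelP M)); right.
Qed.

Definition mu : M T2 := projT1 (cid mu_exists).

Lemma muP (f : M T1) (n : N) : ap f n = 0 :> N -> ap f (ap mu f) = 0 :> N.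
Proof. by move=> H; apply: (proj1 (proj1 (projT2 (cid mu_exists) f) _)); exists n. Qed.

Lemma mu_min (f : M T1) (n m : N) :
  ap f n = 0 :> N -> ltN m (ap mu f) -> ap f m = 0 :> N -> False.
Proof.
by move=> H; apply: (proj2 (proj1 (projT2 (cid mu_exists) f) _)); exists n.
Qed.

Lemma arith_char G (P : N -> ctx G -> Prop) :
  arith (fun g : ctx (T0 :: G) => P g.1 g.2) ->
  exists L : ctx G -> M T1, internal L /\ forall g n, P n g <-> ap (L g) n = 0 :> N.
Proof.
case=> f [/internal_lam[L [IL EL]] Hf]; exists L; split=> // g n.
by rewrite EL; apply: (Hf (n, g)).
Qed.

Lemma arith_least G (P : N -> ctx G -> Prop) :
  arith (fun g : ctx (T0 :: G) => P g.1 g.2) ->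
  exists f : ctx G -> N, internalN f /\ forall g n, P n g ->
    P (f g) g /\ forall m, ltN m (f g) -> ~ P m g.
Proof.
move=> /arith_char[L [IL HP]].
exists (fun g => ap mu (L g)); split; first by apply: internal_ap IL; apply: internal_const.
move=> g n /HP Pn; split; first by apply/HP; apply: muP Pn.
by move=> m /(mu_min Pn) H /HP.
Qed.

(** The least witness is a choice function. *)
Lemma arith_choice G (P : N -> ctx G -> Prop) :
  arith (fun g : ctx (T0 :: G) => P g.1 g.2) -> (forall g, exists n, P n g) ->
  exists f : ctx G -> N, internalN f /\ forall g, P (f g) g.
Proof.
move=> /arith_least[f [If Hf]] H; exists f; split=> // g.
by have [n /Hf[]] := H g.
Qed.

Lemma arith_ex G (P : N -> ctx G -> Prop) :
  arith (fun g : ctx (T0 :: G) => P g.1 g.2) -> arith (fun g => exists n, P n g).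
Proof.
move=> /arith_char[L [IL HP]].
exists (fun g => ap (L g) (ap mu (L g))); split.
  by apply: (internal_ap IL); apply: internal_ap IL; apply: internal_const.
move=> g; split=> [[n /HP]|/HP]; first exact: muP.
by exists (ap mu (L g)).
Qed.

Lemma arith_all G (P : N -> ctx G -> Prop) :
  arith (fun g : ctx (T0 :: G) => P g.1 g.2) -> arith (fun g => forall n, P n g).
Proof.
move=> aP; apply: arith_iff (arith_not (arith_ex (P := fun n g => ~ P n g) (arith_not aP))) => g.
split=> [H n|H [n]]; last by apply.
by apply: contrapT => Hn; apply: H; exists n.
Qed.

(** Classically, a proposition in which no variable of the context occurs has a constant
    characteristic function, whatever it speaks about. *)
Lemma arith_true G (P : Prop) : arith (fun _ : ctx G => P).
Proof.
case: (pselect P) => p.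
  apply: arith_iff (arith_eq (internal_const G (0 : N)) (internal_const G (0 : N))).
  by split.
apply: arith_iff (arith_not (arith_eq (internal_const G (0 : N)) (internal_const G (0 : N)))).
by move=> _; split=> // -[].
Qed.

(** The characteristic function is an element [F] of the model, so this is the quantifier-free
    induction on [F x = 0] with parameter [F]. *)
Lemma N_ind (P : N -> Prop) : arith (fun g : ctx [:: T0] => P g.1) ->
  P 0 -> (forall n, P n -> P (n + 1)) -> forall n, P n.
Proof.
case=> f [[F HF] Hf] P0 PS.
have HP n : P n <-> ap F n = 0 :> N by rewrite (Hf (n, tt)) -HF.
apply: (@qf_induction M (Eq0 (App (Var T1 0) (Var T0 0)) Zero) (push F (env0 M))) => //.
by move=> n; rewrite HP.
Qed.

End Internal.

Arguments internal_fst {M G r}.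
Arguments internal_snd {M G r t f}.
Arguments internal_const {M G t}.

(* Proves that a function is internal, or a predicate arithmetical, by
   recursion on the way it is written. *)
Ltac internality :=
  cbv beta;
  first
  [ exact (internal_const _)
  | exact internal_fst
  | exact (internal_snd internal_fst)
  | exact (internal_snd (internal_snd internal_fst))
  | exact (internal_snd (internal_snd (internal_snd internal_fst)))
  | exact (internal_snd (internal_snd (internal_snd (internal_snd internal_fst))))
  | exact (internal_snd (internal_snd (internal_snd (internal_snd (internal_snd internal_fst)))))
  | match goal with
    | H : internalN ?f |- _ =>
      first [ exact H | exact (internal_snd H) | exact (internal_snd (internal_snd H))
            | exact (internal_snd (internal_snd (internal_snd H)))
            | exact (internal_snd (internal_snd (internal_snd (internal_snd H)))) ]
    | H : internal ?f |- _ =>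
      first [ exact H | exact (internal_snd H) | exact (internal_snd (internal_snd H))
            | exact (internal_snd (internal_snd (internal_snd H)))
            | exact (internal_snd (internal_snd (internal_snd (internal_snd H)))) ]
    end
  | (apply: internal_add || apply: internal_mul || apply: internal_ap); internality ].

(** A hook, redefined once comparisons of rationals and quantifiers over them can be treated. *)
Ltac arithmetic_leaf := fail.

Ltac arithmetic :=
  cbv beta;
  lazymatch goal with
  | |- arith (fun _ => ?P) => exact (arith_true _ P)
  | |- arith (fun g => _ /\ _) => apply: arith_and; arithmetic
  | |- arith (fun g => _ \/ _) => apply: arith_or; arithmetic
  | |- arith (fun g => ~ _) => apply: arith_not; arithmetic
  | |- arith (fun g => exists _, _) => first [apply: arith_ex; arithmetic | arithmetic_leaf]
  | |- arith (fun g => _ -> _) =>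
    first [apply: arith_imp; arithmetic | apply: arith_all; arithmetic | arithmetic_leaf]
  | |- arith (fun g => ltN _ _) => apply: arith_lt; internality
  | |- arith (fun g => _ = _) => first [apply: arith_eq; internality | arithmetic_leaf]
  | |- _ => arithmetic_leaf
  end.

(** * The rationals of a model *)

Section Rationals.

Variable M : model.
Notation N := (N M).

(* [Frac p n e] stands for [(p - n) / (e + 1)]. *)
Record frac := Frac { fpos : N; fneg : N; fden : N }.

Definition fequiv (x y : frac) : Prop :=
  fpos x * (fden y + 1) + fneg y * (fden x + 1) = fpos y * (fden x + 1) + fneg x * (fden y + 1).

Lemma N_succ_neq0 (x : N) : x + 1 <> 0.
Proof. by case/addN_eq0 => _ /(proj1 (ltN0_neq _) (ltN01 M)). Qed.

Lemma fequiv_refl x : fequiv x x. Proof. by []. Qed.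
Lemma fequiv_sym x y : fequiv x y -> fequiv y x. Proof. by []. Qed.
Lemma fequiv_trans x y z : fequiv x y -> fequiv y z -> fequiv x z.
Proof.
case: x y z => [p1 n1 e1] [p2 n2 e2] [p3 n3 e3]; rewrite /fequiv /= => E12 E23.
(* Without negatives in [N], the middle fraction is eliminated by cancelling its denominator as a
   factor and its numerators as a summand. *)
apply: (mulNI (@N_succ_neq0 e2)).
apply: (@addNI _ (n2 * (e1 + 1) * (e3 + 1) + p2 * (e1 + 1) * (e3 + 1))).
transitivity ((p1 * (e2 + 1) + n2 * (e1 + 1)) * (e3 + 1) +
              (p2 * (e3 + 1) + n3 * (e2 + 1)) * (e1 + 1)); first ring.
by rewrite E12 E23; ring.
Qed.

Definition Q : Type := quotient fequiv.

HB.instance Definition _ := gen_eqMixin Q.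
HB.instance Definition _ := gen_choiceMixin Q.

Definition mkq (p n e : N) : Q := cls fequiv (Frac p n e).

Lemma mkq_surj (q : Q) : exists p n e, mkq p n e = q.
Proof. by have [[p n e] H] := cls_surj q; exists p, n, e. Qed.

Lemma mkq_eq p n e p' n' e' :
  mkq p n e = mkq p' n' e' <-> p * (e' + 1) + n' * (e + 1) = p' * (e + 1) + n * (e' + 1).
Proof. exact: (cls_eq fequiv_refl fequiv_sym fequiv_trans). Qed.

Lemma mkq_rep (q : Q) : mkq (fpos (rep q)) (fneg (rep q)) (fden (rep q)) = q.
Proof. by rewrite -[RHS]repK; case: (rep q). Qed.

(** Denominators are stored minus one, and (e+1)(e'+1) = (e e' + e + e') + 1. *)
Definition addq (x y : Q) : Q :=
  let: Frac p n e := rep x in let: Frac p' n' e' := rep y in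
  mkq (p * (e' + 1) + p' * (e + 1)) (n * (e' + 1) + n' * (e + 1)) (e * e' + e + e').

Definition oppq (x : Q) : Q := mkq (fneg (rep x)) (fpos (rep x)) (fden (rep x)).

Definition mulq (x y : Q) : Q :=
  let: Frac p n e := rep x in let: Frac p' n' e' := rep y in
  mkq (p * p' + n * n') (p * n' + n * p') (e * e' + e + e').

Lemma addqE p n e p' n' e' : addq (mkq p n e) (mkq p' n' e') =
  mkq (p * (e' + 1) + p' * (e + 1)) (n * (e' + 1) + n' * (e + 1)) (e * e' + e + e').
Proof.
rewrite /addq; have := mkq_rep (mkq p n e); have := mkq_rep (mkq p' n' e').
case: (rep _) (rep _) => [p1 n1 e1] [p2 n2 e2] /= /mkq_eq E1 /mkq_eq E2; apply/mkq_eq.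
transitivity ((p1 * (e + 1) + n * (e1 + 1)) * ((e2 + 1) * (e' + 1)) +
              (p2 * (e' + 1) + n' * (e2 + 1)) * ((e1 + 1) * (e + 1))); first ring.
by rewrite E1 E2; ring.
Qed.

Lemma oppqE p n e : oppq (mkq p n e) = mkq n p e.
Proof.
rewrite /oppq; have := mkq_rep (mkq p n e).
case: (rep _) => [p1 n1 e1] /= /mkq_eq E; apply/mkq_eq.
by rewrite addrC -E addrC.
Qed.

Lemma mulqE p n e p' n' e' : mulq (mkq p n e) (mkq p' n' e') =
  mkq (p * p' + n * n') (p * n' + n * p') (e * e' + e + e').
Proof.
rewrite /mulq; have := mkq_rep (mkq p n e); have := mkq_rep (mkq p' n' e').
case: (rep _) (rep _) => [p1 n1 e1] [p2 n2 e2] /= /mkq_eq E1 /mkq_eq E2.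
(* The representatives of the two factors are exchanged one at a time. *)
transitivity (mkq (p * p2 + n * n2) (p * n2 + n * p2) (e * e2 + e + e2)); apply/mkq_eq.
  transitivity ((e2 + 1) * (p2 * (p1 * (e + 1) + n * (e1 + 1)) +
                            n2 * (p * (e1 + 1) + n1 * (e + 1)))); first ring.
  transitivity ((e2 + 1) * (p2 * (p * (e1 + 1) + n1 * (e + 1)) +
                            n2 * (p1 * (e + 1) + n * (e1 + 1)))); last ring.
  by rewrite E2.
transitivity ((e + 1) * (p * (p2 * (e' + 1) + n' * (e2 + 1)) +
                         n * (p' * (e2 + 1) + n2 * (e' + 1)))); first ring.
transitivity ((e + 1) * (p * (p' * (e2 + 1) + n2 * (e' + 1)) +
                         n * (p2 * (e' + 1) + n' * (e2 + 1)))); last ring.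
by rewrite E1.
Qed.

Definition zeroq : Q := mkq 0 0 0.
Definition oneq : Q := mkq 1 0 0.

Lemma addqA : associative addq.
Proof.
move=> x y z; have [p [n [e <-]]] := mkq_surj x; have [p' [n' [e' <-]]] := mkq_surj y.
have [p'' [n'' [e'' <-]]] := mkq_surj z; rewrite !addqE; apply/mkq_eq; ring.
Qed.
Lemma addqC : commutative addq.
Proof.
move=> x y; have [p [n [e <-]]] := mkq_surj x; have [p' [n' [e' <-]]] := mkq_surj y.
rewrite !addqE; apply/mkq_eq; ring.
Qed.
Lemma add0q : left_id zeroq addq.
Proof. move=> x; have [p [n [e <-]]] := mkq_surj x; rewrite addqE; apply/mkq_eq; ring. Qed.
Lemma addNq : left_inverse zeroq oppq addq.
Proof. move=> x; have [p [n [e <-]]] := mkq_surj x; rewrite oppqE addqE; apply/mkq_eq; ring. Qed.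
Lemma mulqA : associative mulq.
Proof.
move=> x y z; have [p [n [e <-]]] := mkq_surj x; have [p' [n' [e' <-]]] := mkq_surj y.
have [p'' [n'' [e'' <-]]] := mkq_surj z; rewrite !mulqE; apply/mkq_eq; ring.
Qed.
Lemma mulqC : commutative mulq.
Proof.
move=> x y; have [p [n [e <-]]] := mkq_surj x; have [p' [n' [e' <-]]] := mkq_surj y.
rewrite !mulqE; apply/mkq_eq; ring.
Qed.
Lemma mul1q : left_id oneq mulq.
Proof. move=> x; have [p [n [e <-]]] := mkq_surj x; rewrite mulqE; apply/mkq_eq; ring. Qed.
Lemma mulqDl : left_distributive mulq addq.
Proof.
move=> x y z; have [p [n [e <-]]] := mkq_surj x; have [p' [n' [e' <-]]] := mkq_surj y.
have [p'' [n'' [e'' <-]]] := mkq_surj z; rewrite !(addqE, mulqE); apply/mkq_eq; ring.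
Qed.
Lemma oneq_neq0 : oneq != zeroq.
Proof.
apply/eqP => /mkq_eq; rewrite !(mul1r, mul0r, addr0, add0r) => /(proj1 (ltN0_neq _)).
by apply; apply: ltN01.
Qed.

HB.instance Definition _ := GRing.isZmodule.Build Q addqA addqC add0q addNq.
HB.instance Definition _ := GRing.Zmodule_isComNzRing.Build Q mulqA mulqC mul1q mulqDl oneq_neq0.

Lemma N_compare (p n : N) : exists z, p = n + z \/ n = p + z.
Proof.
have [/ltN_exists[z ->]|[->|/ltN_exists[z ->]]] := ltN_total p n.
- by exists (z + 1); right; rewrite addrA.
- by exists 0; left; rewrite addr0.
- by exists (z + 1); left; rewrite addrA.
Qed.

Lemma mkq_sign (q : Q) : exists p e, q = mkq p 0 e \/ q = - mkq p 0 e.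
Proof.
have [p [n [e <-]]] := mkq_surj q; have [z [->|->]] := N_compare p n; exists z, e; [left|right].
  by apply/mkq_eq; ring.
by rewrite -[- _]/(oppq _) oppqE; apply/mkq_eq; ring.
Qed.

Lemma invq_exists (q : Q) : q != 0 -> exists r, r * q = 1.
Proof.
suff H p e : mkq p 0 e != 0 -> exists r, r * mkq p 0 e = 1.
  have [p [e [->|->]]] := mkq_sign q; first exact: H.
  by rewrite oppr_eq0 => /H[r Hr]; exists (- r); rewrite mulrNN.
move=> /eqP q0; have [E|[z Ez]] : p = 0 \/ exists z, p = z + 1.
    by have [->|<-] := predNK p; [left | right; exists (predN p)].
  by case: q0; rewrite E; apply/mkq_eq; ring.
exists (mkq (e + 1) 0 z); rewrite -[_ * _]/(mulq _ _) mulqE Ez; apply/mkq_eq; ring.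
Qed.

Definition invq (q : Q) : Q :=
  match pselect (exists r, r * q = 1) with left H => projT1 (cid H) | right _ => 0 end.

Lemma mulVq (q : Q) : q != 0 -> invq q * q = 1.
Proof.
move=> /invq_exists H; rewrite /invq; case: pselect => // H'.
exact: projT2 (cid H').
Qed.

Lemma invq0 : invq 0 = 0.
Proof.
rewrite /invq; case: pselect => // H; exfalso; case: H => r.
by rewrite mulr0 => /esym/eqP; rewrite (negPf (oner_neq0 _)).
Qed.

HB.instance Definition _ := GRing.ComNzRing_isField.Build Q mulVq invq0.

Definition geQ0 (q : Q) : bool := `[< exists p e, q = mkq p 0 e >].
Definition leQ (x y : Q) : bool := geQ0 (y - x).
Definition normq (x : Q) : Q := if leQ 0 x then x else - x.

Lemma leQ0 x : leQ 0 x = geQ0 x. Proof. by rewrite /leQ subr0. Qed.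

Lemma leQ0_add x y : leQ 0 x -> leQ 0 y -> leQ 0 (x + y).
Proof.
rewrite !leQ0 => /asboolP[p [e ->]] /asboolP[p' [e' ->]]; apply/asboolP.
rewrite -[_ + _]/(addq _ _) addqE !mul0r addr0.
by exists (p * (e' + 1) + p' * (e + 1)), (e * e' + e + e').
Qed.

Lemma leQ0_mul x y : leQ 0 x -> leQ 0 y -> leQ 0 (x * y).
Proof.
rewrite !leQ0 => /asboolP[p [e ->]] /asboolP[p' [e' ->]]; apply/asboolP.
rewrite -[_ * _]/(mulq _ _) mulqE !mul0r !mulr0 !addr0.
by exists (p * p'), (e * e' + e + e').
Qed.

Lemma leQ0_anti x : leQ 0 x -> leQ x 0 -> x = 0.
Proof.
rewrite leQ0 /leQ sub0r => /asboolP[p [e Ex]] /asboolP[p' [e' Ex']].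
suff p0 : p = 0 by rewrite Ex p0; apply/mkq_eq; ring.
move: Ex'; rewrite Ex -[- _]/(oppq _) oppqE => /mkq_eq.
rewrite !mul0r !addr0 => /esym/addN_eq0[_] E.
by apply: (mulNI (@N_succ_neq0 e')); rewrite mul0r.
Qed.

Lemma leQ_sub x y : leQ 0 (y - x) = leQ x y.
Proof. by rewrite leQ0. Qed.

Lemma leQ0_total x : leQ 0 x || leQ x 0.
Proof.
rewrite leQ0 /leQ sub0r; have [p [e [->|->]]] := mkq_sign x; apply/orP.
  by left; apply/asboolP; exists p, e.
by right; rewrite opprK; apply/asboolP; exists p, e.
Qed.

Lemma normqN x : normq (- x) = normq x.
Proof.
rewrite /normq -{1}(sub0r x) leQ_sub opprK.
case: ifP => H; case: ifP => H' //; last by have := leQ0_total x; rewrite H H'.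
by rewrite (leQ0_anti H' H) oppr0.
Qed.

Lemma ge0_normq x : leQ 0 x -> normq x = x.
Proof. by rewrite /normq => ->. Qed.

HB.instance Definition _ := Num.IntegralDomain_isLeReal.Build Q
  leQ0_add leQ0_mul leQ0_anti leQ_sub leQ0_total normqN ge0_normq (fun _ _ => erefl).

Definition iota (n : N) : Q := mkq n 0 0.

Lemma iota0 : iota 0 = 0. Proof. by []. Qed.
Lemma iota1 : iota 1 = 1. Proof. by []. Qed.
Lemma iotaD x y : iota (x + y) = iota x + iota y.
Proof. rewrite -[RHS]/(addq _ _) addqE; apply/mkq_eq; ring. Qed.
Lemma iotaM x y : iota (x * y) = iota x * iota y.
Proof. rewrite -[RHS]/(mulq _ _) mulqE; apply/mkq_eq; ring. Qed.
Lemma iota_inj : injective iota.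
Proof. by move=> x y /mkq_eq; rewrite !mul0r !addr0 add0r !mulr1. Qed.
Lemma iota_ge0 x : 0 <= iota x.
Proof. by rewrite -[0 <= _]/(leQ _ _) leQ0; apply/asboolP; exists x, 0. Qed.
Lemma iota_lt x y : iota x < iota y <-> ltN x y.
Proof.
have H u v : ltN u v -> iota u < iota v.
  move=> /ltN_exists[z ->]; rewrite !iotaD iota1.
  have := iota_ge0 z; lra.
split; last exact: H.
have [//|[->|/H H1 H2]] := ltN_total x y; first by rewrite ltxx.
by have := lt_trans H1 H2; rewrite ltxx.
Qed.

Lemma iota_le_S x y : iota x < iota y -> iota x + 1 <= iota y.
Proof.
move=> /iota_lt /ltN_exists[z ->]; rewrite !iotaD iota1.
have := iota_ge0 z; lra.
Qed.

Lemma mkqE p n e : mkq p n e = (iota p - iota n) / (iota e + 1).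
Proof.
have e0 : iota e + 1 != 0 by apply: lt0r_neq0; have := iota_ge0 e; lra.
apply: (mulIf e0); rewrite mulfVK // -iota1 -iotaD.
apply: (addIr (iota n)); rewrite subrK.
rewrite -[X in X + _]/(mulq _ _) -[LHS]/(addq _ _) mulqE addqE; apply/mkq_eq; ring.
Qed.

End Rationals.

(** * Codes of rationals *)

Section Codes.

Variable M : model.
Notation N := (N M).
Notation Q := (Q M).
Notation iota := (@iota M).

Lemma pair_codeE (c i j : N) :
  Sem.pair_code c i j <-> c + c = (i + j) * (i + j + 1) + (j + j).
Proof. by []. Qed.

Lemma arith_pair_code G (c i j : ctx M G -> N) : internalN c -> internalN i -> internalN j ->
  arith (fun g => Sem.pair_code (c g : M T0) (i g) (j g)).
Proof. by move=> Ic Ii Ij; apply: arith_eq; internality. Qed.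

Lemma pair_code_exists (i j : N) : exists c : N, Sem.pair_code (c : M T0) i j.
Proof.
have [k Hk] : exists k : N, k + k = (i + j) * (i + j + 1).
  move: (i + j); apply: N_ind.
  - arithmetic.
  - by exists 0; rewrite addr0 mul0r.
  - move=> n [k Hk]; exists (k + (n + 1)).
    transitivity ((k + k) + ((n + 1) + (n + 1))); first ring.
    by rewrite Hk; ring.
exists (k + j); apply/pair_codeE.
by rewrite -Hk addrACA.
Qed.

(** Induction along the diagonals: after (i+1, j) comes (i, j+1), and after (0, j) the next diagonal
    starts with (j+1, 0). *)
Lemma pair_code_total (c : N) : exists i j : N, Sem.pair_code (c : M T0) i j.
Proof.
move: c; apply: N_ind.
- apply: (@arith_ex M [:: T0] (fun i g => exists j : N, Sem.pair_code (g.1 : M T0) i j)).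
  apply: (@arith_ex M [:: T0; T0] (fun j g => Sem.pair_code (g.2.1 : M T0) g.1 j)).
  by apply: arith_pair_code; internality.
- by exists 0, 0; apply/pair_codeE; rewrite !addr0 mul0r.
- move=> c [i [j /pair_codeE H]]; have [E|E] := predNK i.
    exists (j + 1), 0; apply/pair_codeE; rewrite E in H.
    transitivity ((c + c) + (1 + 1)); first ring.
    by rewrite H; ring.
  move: (predN i) E H => k <- H; exists k, (j + 1); apply/pair_codeE.
  transitivity ((c + c) + (1 + 1)); first ring.
  by rewrite H; ring.
Qed.

(** With s = a + b, twice a code on diagonal s is at most s(s+1) + 2s, which is less than
    (s+1)(s+2), the least such value on the next diagonal. *)
Lemma pair_code_sum_lt (a b a' b' : N) :
  (a + b) * (a + b + 1) + (b + b) = (a' + b') * (a' + b' + 1) + (b' + b') ->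
  ~ ltN (a + b) (a' + b').
Proof.
move=> /(congr1 iota) E /iota_lt /iota_le_S; move: E; rewrite !(iotaD, iotaM) iota1.
have := iota_ge0 a; have := iota_ge0 b; have := iota_ge0 a'; have := iota_ge0 b'.
move: (iota a) (iota b) (iota a') (iota b') => x y x' y' *; nra.
Qed.

Lemma pair_code_inj (c i j i' j' : N) :
  Sem.pair_code (c : M T0) i j -> Sem.pair_code (c : M T0) i' j' -> i = i' /\ j = j'.
Proof.
move=> /pair_codeE H /pair_codeE; rewrite {}H => H.
have [H'|[E|H']] := ltN_total (i + j) (i' + j').
- by case: (pair_code_sum_lt H H').
- have Ej : j = j'.
    apply: iota_inj; move: H; rewrite E => /(congr1 iota); rewrite !iotaD.
    by move: (iota j) (iota j') (iota _) => x y z; lra.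
  by split=> //; move: E; rewrite Ej => /addNI.
- by case: (pair_code_sum_lt (esym H) H').
Qed.

Definition codes (c a b e : N) : Prop :=
  exists p : N, Sem.pair_code (c : M T0) a p /\ Sem.pair_code (p : M T0) b e.

Lemma codes_total (c : N) : exists a b e, codes c a b e.
Proof.
have [a [p Hp]] := pair_code_total c; have [b [e He]] := pair_code_total p.
by exists a, b, e, p.
Qed.

Lemma codes_inj c a b e a' b' e' :
  codes c a b e -> codes c a' b' e' -> [/\ a = a', b = b' & e = e'].
Proof.
move=> [p [H1 H2]] [p' [H1' H2']]; have [-> E] := pair_code_inj H1 H1'.
by rewrite -E in H2'; have [-> ->] := pair_code_inj H2 H2'.
Qed.

Lemma codes_exists a b e : exists c, codes c a b e.
Proof.
have [p Hp] := pair_code_exists b e; have [c Hc] := pair_code_exists a p.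
by exists c, p.
Qed.

Lemma arith_codes G (c a b e : ctx M G -> N) : internalN c -> internalN a -> internalN b ->
  internalN e -> arith (fun g => codes (c g) (a g) (b g) (e g)).
Proof.
move=> Ic Ia Ib Ie.
apply: (@arith_ex M G (fun p g => Sem.pair_code (c g : M T0) (a g) p /\ Sem.pair_code (p : M T0) (b g) (e g))).
by apply: arith_and; apply: arith_pair_code; internality.
Qed.

Lemma dec_exists c : exists q : Q, exists a b e, codes c a b e /\ q = mkq a b e.
Proof. by have [a [b [e H]]] := codes_total c; exists (mkq a b e), a, b, e. Qed.

Definition dec (c : N) : Q := projT1 (cid (dec_exists c)).

Lemma decE c a b e : codes c a b e -> dec c = mkq a b e.
Proof.
move=> H; have [a' [b' [e' [H' E]]]] := projT2 (cid (dec_exists c)).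
by rewrite /dec E; have [-> -> ->] := codes_inj H H'.
Qed.

Lemma dec_surj (q : Q) : exists c, dec c = q.
Proof.
have [a [b [e <-]]] := mkq_surj q; have [c Hc] := codes_exists a b e.
by exists c; apply: decE.
Qed.

(** [Q] is a quotient outside the model, so a function into it is represented by internal functions
    for numerator and denominator. *)
Definition repq G (f : ctx M G -> Q) : Prop := exists p n e : ctx M G -> N,
  [/\ internalN p, internalN n, internalN e & forall g, f g = mkq (p g) (n g) (e g)].

Lemma repq_eq G (f h : ctx M G -> Q) : (forall g, f g = h g) -> repq f -> repq h.
Proof. by move/funext->. Qed.

Lemma repq_dec G (c : ctx M G -> N) : internalN c -> repq (fun g => dec (c g)).
Proof.
move=> Ic.
have [a [Ia Ha]] : exists a : ctx M G -> N, internalN a /\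
    forall g, exists b e, codes (c g) (a g) b e.
  apply: (@arith_choice _ G (fun a g => exists b e, codes (c g) a b e)) => [|g].
    apply: (@arith_ex _ (T0 :: G) (fun b g => exists e, codes (c g.2) g.1 b e)).
    apply: (@arith_ex _ (T0 :: T0 :: G) (fun e g => codes (c g.2.2) g.2.1 g.1 e)).
    by apply: arith_codes; internality.
  exact: codes_total.
have [b [Ib Hb]] : exists b : ctx M G -> N, internalN b /\
    forall g, exists e, codes (c g) (a g) (b g) e.
  apply: (@arith_choice _ G (fun b g => exists e, codes (c g) (a g) b e)) => //.
  apply: (@arith_ex _ (T0 :: G) (fun e g => codes (c g.2) (a g.2) g.1 e)).
  by apply: arith_codes; internality.
have [e [Ie He]] : exists e : ctx M G -> N, internalN e /\
    forall g, codes (c g) (a g) (b g) (e g).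
  apply: (@arith_choice _ G (fun e g => codes (c g) (a g) (b g) e)) => //.
  by apply: arith_codes; internality.
by exists a, b, e; split=> // g; apply: decE.
Qed.

Lemma repq_code G (f : ctx M G -> Q) :
  repq f -> exists c : ctx M G -> N, internalN c /\ forall g, dec (c g) = f g.
Proof.
move=> [p [n [e [Ip In Ie Hf]]]].
have [c [Ic Hc]] : exists c : ctx M G -> N, internalN c /\
    forall g, codes (c g) (p g) (n g) (e g).
  apply: (@arith_choice _ G (fun c g => codes c (p g) (n g) (e g))) => [|g].
    by apply: arith_codes; internality.
  exact: codes_exists.
by exists c; split=> // g; rewrite Hf; apply: decE.
Qed.

Lemma repq_mkq G (p n e : ctx M G -> N) : internalN p -> internalN n -> internalN e ->
  repq (fun g => mkq (p g) (n g) (e g)).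
Proof. by move=> Ip In Ie; exists p, n, e. Qed.

Lemma repq_const G (q : Q) : repq (fun _ : ctx M G => q).
Proof.
have [p [n [e <-]]] := mkq_surj q.
by apply: repq_mkq; internality.
Qed.

Lemma repq_add G (f h : ctx M G -> Q) : repq f -> repq h -> repq (fun g => f g + h g).
Proof.
move=> [p [n [e [Ip In Ie Hf]]]] [p' [n' [e' [Ip' In' Ie' Hh]]]].
apply: (repq_eq (f := fun g => mkq (p g * (e' g + 1) + p' g * (e g + 1))
  (n g * (e' g + 1) + n' g * (e g + 1)) (e g * e' g + e g + e' g))) => [g|].
  by rewrite Hf Hh -addqE.
by apply: repq_mkq; internality.
Qed.

Lemma repq_opp G (f : ctx M G -> Q) : repq f -> repq (fun g => - f g).
Proof.
move=> [p [n [e [Ip In Ie Hf]]]].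
apply: (repq_eq (f := fun g => mkq (n g) (p g) (e g))) => [g|]; last exact: repq_mkq.
by rewrite Hf -oppqE.
Qed.

Lemma repq_sub G (f h : ctx M G -> Q) : repq f -> repq h -> repq (fun g => f g - h g).
Proof. by move=> Rf Rh; apply: repq_add => //; apply: repq_opp. Qed.

Lemma repq_mul G (f h : ctx M G -> Q) : repq f -> repq h -> repq (fun g => f g * h g).
Proof.
move=> [p [n [e [Ip In Ie Hf]]]] [p' [n' [e' [Ip' In' Ie' Hh]]]].
apply: (repq_eq (f := fun g => mkq (p g * p' g + n g * n' g)
  (p g * n' g + n g * p' g) (e g * e' g + e g + e' g))) => [g|].
  by rewrite Hf Hh -mulqE.
by apply: repq_mkq; internality.
Qed.

Lemma repq_iota G (f : ctx M G -> N) : internalN f -> repq (fun g => iota (f g)).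
Proof. by move=> If; apply: repq_mkq; internality. Qed.

Lemma repq_snd G r (f : ctx M G -> Q) : repq f -> repq (fun g : ctx M (r :: G) => f g.2).
Proof.
move=> [p [n [e [Ip In Ie Hf]]]]; exists (fun g => p g.2), (fun g => n g.2), (fun g => e g.2).
by split=> //; apply: internal_snd.
Qed.

Lemma mkq_lt (p n e p' n' e' : N) : mkq p n e < mkq p' n' e' <->
  ltN (p * (e' + 1) + n' * (e + 1)) (p' * (e + 1) + n * (e' + 1)).
Proof.
rewrite -iota_lt !mkqE !(iotaD, iotaM) iota1.
have := iota_ge0 e; have := iota_ge0 e'.
move: (iota e) (iota e') (iota p) (iota p') (iota n) (iota n') => d d' x x' y y' Hd' Hd.
have P : 0 < d + 1 by lra.
have P' : 0 < d' + 1 by lra.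
rewrite ltr_pdivrMr // mulrAC ltr_pdivlMr //.
split; lra.
Qed.

Lemma arith_qlt G (f h : ctx M G -> Q) : repq f -> repq h -> arith (fun g => f g < h g).
Proof.
move=> [p [n [e [Ip In Ie Hf]]]] [p' [n' [e' [Ip' In' Ie' Hh]]]].
apply: (arith_iff (P := fun g => ltN (p g * (e' g + 1) + n' g * (e g + 1))
  (p' g * (e g + 1) + n g * (e' g + 1)))) => [g|].
  by rewrite Hf Hh mkq_lt.
by apply: arith_lt; internality.
Qed.

Lemma arith_qle G (f h : ctx M G -> Q) : repq f -> repq h -> arith (fun g => f g <= h g).
Proof.
move=> Rf Rh; apply: arith_iff (arith_not (arith_qlt Rh Rf)) => g.
by rewrite leNgt; split=> [/negP|/negP].
Qed.

Lemma arith_qeq G (f h : ctx M G -> Q) : repq f -> repq h -> arith (fun g => f g = h g).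
Proof.
move=> Rf Rh; apply: arith_iff (arith_and (arith_qle Rf Rh) (arith_qle Rh Rf)) => g.
by split=> [[H H']|->//]; apply/eqP; rewrite eq_le H H'.
Qed.

Lemma arith_qex G (P : Q -> ctx M G -> Prop) :
  arith (fun g : ctx M (T0 :: G) => P (dec g.1) g.2) -> arith (fun g => exists q, P q g).
Proof.
move=> /(arith_ex (P := fun c g => P (dec c) g)) aP; apply: arith_iff aP => g.
split=> [[c Hc]|[q]]; first by exists (dec c).
by have [c <-] := dec_surj q => Hc; exists c.
Qed.

Lemma arith_qall G (P : Q -> ctx M G -> Prop) :
  arith (fun g : ctx M (T0 :: G) => P (dec g.1) g.2) -> arith (fun g => forall q, P q g).
Proof.
move=> /(arith_all (P := fun c g => P (dec c) g)) aP; apply: arith_iff aP => g.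
split=> [H q|H c]; last exact: H.
by have [c <-] := dec_surj q.
Qed.

(** Allows definitions by cases: the least code of the value is an internal function. *)
Lemma repq_graph G (f : ctx M G -> Q) :
  arith (fun g : ctx M (T0 :: G) => dec g.1 = f g.2) -> repq f.
Proof.
move=> /(arith_choice (P := fun c g => dec c = f g)) [|c [Ic Hc]].
  by move=> g; apply: dec_surj.
exact: repq_eq Hc (repq_dec Ic).
Qed.

(* Sums are computed by primitive recursion on codes. *)
Lemma repq_sum G (f : N -> ctx M G -> Q) : repq (fun g : ctx M (T0 :: G) => f g.1 g.2) ->
  exists S : N -> ctx M G -> Q, [/\ repq (fun g : ctx M (T0 :: G) => S g.1 g.2),
    forall g, S 0 g = 0 & forall n g, S (n + 1) g = S n g + f n g].
Proof.
move=> Rf.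
have [c0 Hc0] := dec_surj 0.
have [h [Ih Hh]] : exists h : ctx M (T0 :: T0 :: G) -> N, internalN h /\
    forall g, dec (h g) = dec g.1 + f g.2.1 g.2.2.
  apply: repq_code; apply: repq_add; first by apply: repq_dec; internality.
  exact: (repq_snd _ Rf).
have [L [IL EL]] := internal_lam Ih; have [K [IK EK]] := internal_lam IL.
exists (fun n g => dec (ap (ap (ap (i_Rec0 M) (K g)) c0) n)); split.
- have IK' := internal_snd IK (r := T0).
  apply: repq_dec; apply: (internal_ap (internal_ap (internal_ap _ IK') _) _); internality.
- by move=> g; rewrite Rec0_0.
- by move=> n g; rewrite Rec0_S EK EL Hh.
Qed.

End Codes.

(** * Powers of two *)

Section Powers.

Variable M : model.
Notation N := (N M).
Notation Q := (Q M).
Notation iota := (@iota M).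

Definition pow2 (n : N) : N := Sem.pow2 (n : M T0).

Lemma pow2_0 : pow2 0 = 1.
Proof. exact: Rec0_0. Qed.

Lemma pow2_S n : pow2 (n + 1) = pow2 n + pow2 n.
Proof. by rewrite /pow2 /Sem.pow2 Rec0_S /Sem.double_step PiE !SigmaE PiE. Qed.

Lemma pow2_gt n : iota n < iota (pow2 n).
Proof.
apply/iota_lt; move: n; apply: N_ind.
- by apply: arith_lt; rewrite /pow2; internality.
- by rewrite pow2_0; apply: ltN01.
move=> n /iota_lt H; apply/iota_lt; rewrite pow2_S !iotaD iota1.
by have := iota_le_S H; have := iota_ge0 n; lra.
Qed.

Definition eps (n : N) : Q := (iota (pow2 n))^-1.

Lemma pow2_gt0 n : 0 < iota (pow2 n).
Proof. exact: le_lt_trans (iota_ge0 n) (pow2_gt n). Qed.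

Lemma eps_gt0 n : 0 < eps n.
Proof. by rewrite invr_gt0 pow2_gt0. Qed.

Lemma eps0 : eps 0 = 1.
Proof. by rewrite /eps pow2_0 iota1 invr1. Qed.

Lemma eps_double n : eps n = eps (n + 1) + eps (n + 1).
Proof.
rewrite /eps pow2_S iotaD; have := pow2_gt0 n; move: (iota _) => x x0.
by field; apply/andP; split; apply: lt0r_neq0 => //; lra.
Qed.

Lemma repq_eps G (f : ctx M G -> N) : internalN f -> repq (fun g => eps (f g)).
Proof.
move=> If; apply: (repq_eq (f := fun g => mkq 1 0 (predN (pow2 (f g))))) => [g|].
  have [E|E] := predNK (pow2 (f g)); last by rewrite mkqE -iota1 -iotaD E iota0 subr0 iota1 mul1r.
  by have := pow2_gt0 (f g); rewrite E iota0 ltxx.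
by apply: repq_mkq; rewrite /predN /pow2 /Sem.pow2; internality.
Qed.

End Powers.

Ltac rationality :=
  cbv beta;
  first
  [ exact (repq_const _ _)
  | apply: repq_dec; internality
  | apply: repq_eps; internality
  | apply: repq_iota; internality
  | match goal with
    | H : repq ?f |- _ =>
      first [ exact H | exact (repq_snd _ H) | exact (repq_snd _ (repq_snd _ H))
            | exact (repq_snd _ (repq_snd _ (repq_snd _ H))) ]
    end
  | (apply: repq_sub || apply: repq_add || apply: repq_opp || apply: repq_mul); rationality ].

Ltac arithmetic_leaf ::=
  lazymatch goal with
  | |- arith (fun g => is_true (_ < _)) => apply: arith_qlt; rationality
  | |- arith (fun g => is_true (_ <= _)) => apply: arith_qle; rationality
  | |- arith (fun g => _ = _) => apply: arith_qeq; rationality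
  | |- arith (fun g => exists _ : Q _, _) => apply: arith_qex; arithmetic
  | |- arith (fun g => forall _ : Q _, _) => apply: arith_qall; arithmetic
  end.

(** * Reals as sequences of rationals *)

Section RationalSequences.
Variable M : model.
Notation N := (N M).
Notation Q := (Q M).
Notation iota := (@iota M).
Notation eps := (@eps M).

Lemma eps_add n k : eps (n + k) <= eps n.
Proof.
move: k; apply: N_ind; first by arithmetic.
  by rewrite addr0.
move=> k H; have := eps_double (n + k); rewrite -addrA => E.
have := eps_gt0 (n + (k + 1)); lra.
Qed.

(** [Q] is archimedean relative to the numbers of the model: a positive fraction with denominator
    e+1 is at least 1/(e+1), and e+1 < 2^(e+1). *)
Lemma eps_small (q : Q) : 0 < q -> exists n, eps n < q.
Proof.
have [p [n [e <-]]] := mkq_surj q; rewrite mkqE => H.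
exists (e + 1); rewrite /eps.
have e1 : 0 < iota e + 1 by have := iota_ge0 e; lra.
move: H; rewrite pmulr_lgt0 ?invr_gt0 // subr_gt0 => /iota_le_S H.
apply: (@lt_le_trans _ _ (iota e + 1)^-1).
  have := pow2_gt (e + 1); rewrite iotaD iota1 => H'.
  by rewrite ltf_pV2 // posrE //; apply: lt_trans H'.
by rewrite -[X in X <= _]mul1r ler_wpM2r ?invr_ge0; lra.
Qed.

(* Reals are handled as sequences of rationals, and compared with rationals:
   [below q X] and [above X q] mean [q < X] and [X < q]. *)
Definition rseq : Type := N -> Q.

Definition isreal (X : rseq) : Prop := forall n i : N,
  X n - X (n + i) < eps n /\ X (n + i) - X n < eps n.

Definition below (q : Q) (X : rseq) : Prop := exists n, q + eps n < X n.
Definition above (X : rseq) (q : Q) : Prop := exists n, X n + eps n < q.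

(** Trades a margin that depends on one index for a fixed margin at all later indices, so that
    conditions on several reals can be compared at a common index. *)
Lemma below_eventually q X : isreal X ->
  below q X <-> exists2 d, 0 < d & exists n, forall i, q + d < X (n + i).
Proof.
move=> HX; split=> [[n Hn]|[d d0 [n Hn]]].
  exists ((X n - eps n - q)); first lra.
  by exists n => i; have [H1 H2] := HX n i; lra.
have [i Hi] := eps_small d0; exists (n + i); have := Hn i.
by have := eps_add i n; rewrite addrC; lra.
Qed.

Lemma above_eventually q X : isreal X ->
  above X q <-> exists2 d, 0 < d & exists n, forall i, X (n + i) + d < q.
Proof.
move=> HX; split=> [[n Hn]|[d d0 [n Hn]]].
  exists ((q - X n - eps n)); first lra.
  by exists n => i; have [H1 H2] := HX n i; lra.
have [i Hi] := eps_small d0; exists (n + i); have := Hn i.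
by have := eps_add i n; rewrite addrC; lra.
Qed.

Lemma below_ub q X n : isreal X -> below q X -> q < X n + eps n.
Proof.
move=> HX /(below_eventually _ HX)[d d0 [m Hm]].
have := Hm n; rewrite [m + n]addrC; have [H1 H2] := HX n m; lra.
Qed.

Lemma above_lb q X n : isreal X -> above X q -> X n - eps n < q.
Proof.
move=> HX /(above_eventually _ HX)[d d0 [m Hm]].
have := Hm n; rewrite [m + n]addrC; have [H1 H2] := HX n m; lra.
Qed.

Lemma below_lt_above p X q : isreal X -> below p X -> above X q -> p < q.
Proof. by move=> HX [n Hn] /(above_lb n HX); lra. Qed.

Lemma located X p q : p < q -> below p X \/ above X q.
Proof.
move=> pq; have [n Hn] : exists n, eps n < (q - p) / 2 by apply: eps_small; lra.
have [H|H] := ltP (p + eps n) (X n); first by left; exists n.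
by right; exists n; lra.
Qed.

Lemma below_le p q X : p <= q -> below q X -> below p X.
Proof. by move=> pq [n Hn]; exists n; lra. Qed.

Lemma above_le p q X : p <= q -> above X p -> above X q.
Proof. by move=> pq [n Hn]; exists n; lra. Qed.

Lemma below_open q X : below q X -> exists2 p, q < p & below p X.
Proof. by move=> [n Hn]; exists ((X n - eps n + q) / 2); [lra | exists n; lra]. Qed.

Lemma above_open q X : above X q -> exists2 p, p < q & above X p.
Proof. by move=> [n Hn]; exists ((X n + eps n + q) / 2); [lra | exists n; lra]. Qed.

Lemma approx X (d : Q) : 0 < d -> exists p, below p X /\ above X (p + d).
Proof.
move=> d0; have [n Hn] : exists n, eps n < d / 4 by apply: eps_small; lra.
exists (X n - d / 2); split; exists n; lra.
Qed.

Definition sadd (X Y : rseq) : rseq := fun n => X (n + 1) + Y (n + 1).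
Definition ssub (X Y : rseq) : rseq := fun n => X (n + 1) - Y (n + 1).

Lemma isreal_add X Y : isreal X -> isreal Y -> isreal (sadd X Y).
Proof.
move=> HX HY n i; rewrite /sadd [n + i + 1]addrAC eps_double.
have [? ?] := HX (n + 1) i; have [? ?] := HY (n + 1) i; split; lra.
Qed.

Lemma isreal_sub X Y : isreal X -> isreal Y -> isreal (ssub X Y).
Proof.
move=> HX HY n i; rewrite /ssub [n + i + 1]addrAC eps_double.
have [? ?] := HX (n + 1) i; have [? ?] := HY (n + 1) i; split; lra.
Qed.

Lemma below_add q X Y : isreal X -> isreal Y ->
  below q (sadd X Y) <-> exists u v, [/\ below u X, below v Y & q = u + v].
Proof.
move=> HX HY; split=> [[n]|[u [v [/(below_eventually _ HX)[d d0 [n Hn]]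
    /(below_eventually _ HY)[d' d0' [n' Hn']] ->]]]].
  rewrite /sadd eps_double; set e := eps _; set x := X _; set y := Y _ => H.
  (* The slack in the inequality is split evenly between the two summands. *)
  pose d := (x + y - (q + (e + e))) / 2.
  exists (x - e - d), (y - e - d); split; last by rewrite /d; lra.
    by exists (n + 1); rewrite -/e -/x /d; lra.
  by exists (n + 1); rewrite -/e -/y /d; lra.
apply/below_eventually; first exact: isreal_add.
exists (d + d'); first lra.
exists (n + n') => i; rewrite /sadd.
have := Hn (n' + i + 1); have := Hn' (n + i + 1); rewrite !addrA [n' + n]addrC; lra.
Qed.

Lemma above_add q X Y : isreal X -> isreal Y ->
  above (sadd X Y) q <-> exists u v, [/\ above X u, above Y v & q = u + v].
Proof.
move=> HX HY; split=> [[n]|[u [v [/(above_eventually _ HX)[d d0 [n Hn]]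
    /(above_eventually _ HY)[d' d0' [n' Hn']] ->]]]].
  rewrite /sadd eps_double; set e := eps _; set x := X _; set y := Y _ => H.
  pose d := (q - (x + y + (e + e))) / 2.
  exists (x + e + d), (y + e + d); split; last by rewrite /d; lra.
    by exists (n + 1); rewrite -/e -/x /d; lra.
  by exists (n + 1); rewrite -/e -/y /d; lra.
apply/above_eventually; first exact: isreal_add.
exists (d + d'); first lra.
exists (n + n') => i; rewrite /sadd.
have := Hn (n' + i + 1); have := Hn' (n + i + 1); rewrite !addrA [n' + n]addrC; lra.
Qed.

Lemma below_sub q X Y : isreal X -> isreal Y ->
  below q (ssub X Y) <-> exists u v, [/\ below u X, above Y v & q = u - v].
Proof.
move=> HX HY; split=> [[n]|[u [v [/(below_eventually _ HX)[d d0 [n Hn]]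
    /(above_eventually _ HY)[d' d0' [n' Hn']] ->]]]].
  rewrite /ssub eps_double; set e := eps _; set x := X _; set y := Y _ => H.
  pose d := (x - y - (q + (e + e))) / 2.
  exists (x - e - d), (y + e + d); split; last by rewrite /d; lra.
    by exists (n + 1); rewrite -/e -/x /d; lra.
  by exists (n + 1); rewrite -/e -/y /d; lra.
apply/below_eventually; first exact: isreal_sub.
exists (d + d'); first lra.
exists (n + n') => i; rewrite /ssub.
have := Hn (n' + i + 1); have := Hn' (n + i + 1); rewrite !addrA [n' + n]addrC; lra.
Qed.

Lemma above_sub q X Y : isreal X -> isreal Y ->
  above (ssub X Y) q <-> exists u v, [/\ above X u, below v Y & q = u - v].
Proof.
move=> HX HY; split=> [[n]|[u [v [/(above_eventually _ HX)[d d0 [n Hn]]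
    /(below_eventually _ HY)[d' d0' [n' Hn']] ->]]]].
  rewrite /ssub eps_double; set e := eps _; set x := X _; set y := Y _ => H.
  pose d := (q - (x - y + (e + e))) / 2.
  exists (x + e + d), (y - e - d); split; last by rewrite /d; lra.
    by exists (n + 1); rewrite -/e -/x /d; lra.
  by exists (n + 1); rewrite -/e -/y /d; lra.
apply/above_eventually; first exact: isreal_sub.
exists (d + d'); first lra.
exists (n + n') => i; rewrite /ssub.
have := Hn (n' + i + 1); have := Hn' (n + i + 1); rewrite !addrA [n' + n]addrC; lra.
Qed.

Definition slt (X Y : rseq) : Prop := exists n, X n + 2 * eps n < Y n.
Definition seqv (X Y : rseq) : Prop := forall n,
  X n - Y n <= 2 * eps n /\ Y n - X n <= 2 * eps n.

Lemma sltP X Y : isreal X -> isreal Y ->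
  slt X Y <-> exists q, above X q /\ below q Y.
Proof.
move=> HX HY; split=> [[n Hn]|[q [/(above_eventually _ HX)[d d0 [n Hn]]
    /(below_eventually _ HY)[d' d0' [n' Hn']]]]].
  (* The factor 2 in [slt] leaves [eps n] on either side of the midpoint. *)
  by exists ((X n + Y n) / 2); split; exists n; lra.
have [k Hk] := eps_small d0; have [k' Hk'] := eps_small d0'.
exists (n + n' + k + k').
have := Hn (n' + k + k'); have := Hn' (n + k + k').
rewrite !addrA [n' + n]addrC.
have := eps_add k (n + n' + k'); have := eps_add k' (n + n' + k).
have -> : k + (n + n' + k') = n + n' + k + k' by ring.
have -> : k' + (n + n' + k) = n + n' + k + k' by ring.
lra.
Qed.

Lemma seqv_below q X Y : isreal X -> isreal Y -> seqv X Y -> below q X -> below q Y.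
Proof.
move=> HX HY E /(below_eventually _ HX)[d d0 [n Hn]]; apply/below_eventually => //.
exists (d / 2); first lra.
have [k Hk] : exists k, eps k < d / 4 by apply: eps_small; lra.
exists (n + k) => i; rewrite -addrA; have := Hn (k + i); have [H _] := E (n + (k + i)).
have := eps_add k (n + i); rewrite [k + _]addrCA; lra.
Qed.

Lemma seqv_sym X Y : seqv X Y -> seqv Y X.
Proof. by move=> H n; have [] := H n. Qed.

Lemma seqv_above q X Y : isreal X -> isreal Y -> seqv X Y -> above X q -> above Y q.
Proof.
move=> HX HY E /(above_eventually _ HX)[d d0 [n Hn]]; apply/above_eventually => //.
exists (d / 2); first lra.
have [k Hk] : exists k, eps k < d / 4 by apply: eps_small; lra.
exists (n + k) => i; rewrite -addrA; have := Hn (k + i); have [_ H] := E (n + (k + i)).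
have := eps_add k (n + i); rewrite [k + _]addrCA; lra.
Qed.

(** In contrast to [frac], these fractions carry the denominator itself. *)
Definition rv (r : Sem.rational M) : Q :=
  (iota (Sem.q_pos r) - iota (Sem.q_neg r)) / iota (Sem.q_den r).
Definition good (r : Sem.rational M) : Prop := 0 < iota (Sem.q_den r).

(* [S] only depends on the values of fractions, and its [n]-th fraction has the
   value [X n]. *)
Definition reads (S : Sem.real M) (X : rseq) : Prop := forall (n : N) F (P : Q -> Prop),
  (forall r, good r -> F r <-> P (rv r)) -> S n F <-> P (X n).

Definition sval (x : M T1) : rseq := fun n => dec (ap x n).

Lemma decode_dec (c : N) F (P : Q -> Prop) : (forall r, good r -> F r <-> P (rv r)) ->
  Sem.decode (c : M T0) F <-> P (dec c).
Proof.
move=> H.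
have G (a b e : N) : good (Sem.Rational (a : M T0) b (Sem.plus e (1 : N))).
  by rewrite /good -[Sem.q_den _]/(e + 1) iotaD iota1; have := iota_ge0 e; lra.
have R (a b e : N) : rv (Sem.Rational (a : M T0) b (Sem.plus e (1 : N))) = mkq a b e.
  by rewrite mkqE -iota1 -iotaD.
split=> [[a [b [e [Hc HF]]]]|HP].
  by move/(H _ (G a b e)): HF; rewrite (R a b e) -(decE Hc).
have [a [b [e Hc]]] := codes_total c; exists a, b, e; split=> //.
by apply/(H _ (G a b e)); rewrite (R a b e) -(decE Hc).
Qed.

Lemma reads_val x : reads (Sem.val x) (sval x).
Proof. by move=> n F P H; apply: decode_dec. Qed.

Lemma q_lt_rv r s : good r -> good s -> Sem.q_lt r s <-> rv r < rv s.
Proof.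
case: r s => [p n d] [p' n' d']; rewrite /good /rv /Sem.q_lt /= => D D'.
rewrite -[i_lt _ _]/(ltN ((p : N) * (d' : N) + (n' : N) * (d : N))
  ((p' : N) * (d : N) + (n : N) * (d' : N))) -iota_lt !(iotaD, iotaM).
rewrite ltr_pdivrMr // mulrAC ltr_pdivlMr //.
move: (iota p) (iota n) (iota d) (iota p') (iota n') (iota d') => *; split; lra.
Qed.

Lemma q_le_rv r s : good r -> good s -> Sem.q_le r s <-> rv r <= rv s.
Proof.
move=> Gr Gs; rewrite /Sem.q_le q_lt_rv // leNgt; split=> [/negP|/negP] //.
Qed.

Lemma q_add_rv r s : good r -> good s ->
  good (Sem.q_add r s) /\ rv (Sem.q_add r s) = rv r + rv s.
Proof.
case: r s => [p n d] [p' n' d']; rewrite /good /rv /Sem.q_add /= => D D'.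
rewrite -[Sem.times d d']/((d : N) * (d' : N)).
rewrite -[Sem.plus (Sem.times p d') (Sem.times p' d)]/((p : N) * (d' : N) + (p' : N) * (d : N)).
rewrite -[Sem.plus (Sem.times n d') (Sem.times n' d)]/((n : N) * (d' : N) + (n' : N) * (d : N)).
rewrite !(iotaD, iotaM); split; first exact: mulr_gt0.
move: (iota p) (iota n) (iota d) (iota p') (iota n') (iota d') D D' => a b c a' b' c' D D'.
by field; rewrite !lt0r_neq0.
Qed.

Lemma q_opp_rv r : good r -> good (Sem.q_opp r) /\ rv (Sem.q_opp r) = - rv r.
Proof.
case: r => [p n d]; rewrite /good /rv /= => D; split=> //.
by rewrite -mulNr opprB.
Qed.

Lemma q_sub_rv r s : good r -> good s ->
  good (Sem.q_sub r s) /\ rv (Sem.q_sub r s) = rv r - rv s.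
Proof.
move=> Gr Gs; have [Go Eo] := q_opp_rv Gs; have [Ga Ea] := q_add_rv Gr Go.
by split=> //; rewrite Ea Eo.
Qed.

Lemma q_zero_rv : good (Sem.q_zero M) /\ rv (Sem.q_zero M) = 0.
Proof. by rewrite /good /rv /= iota0 iota1 subr0 mul0r. Qed.

Lemma q_one_rv : good (Sem.q_one M) /\ rv (Sem.q_one M) = 1.
Proof. by rewrite /good /rv /= iota0 iota1 subr0 mul1r invr1. Qed.

Lemma two_pow_neg_rv (n : N) : good (Sem.two_pow_neg (n : M T0)) /\
  rv (Sem.two_pow_neg (n : M T0)) = eps n.
Proof.
split; first exact: pow2_gt0.
by rewrite /rv /= iota0 iota1 subr0 mul1r.
Qed.

Lemma two_pow_one_sub_rv (n : N) : good (Sem.two_pow_one_sub (n : M T0)) /\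
  rv (Sem.two_pow_one_sub (n : M T0)) = 2 * eps n.
Proof.
split; first exact: pow2_gt0.
rewrite /rv /= iota0 subr0 -[Sem.plus _ _]/((1 : N) + 1) iotaD iota1.
by congr (_ * _).
Qed.

End RationalSequences.

(** * Reals of the model and their suprema *)

Section Reals.

Variable M : model.
Notation N := (N M).
Notation Q := (Q M).
Notation iota := (@iota M).
Notation eps := (@eps M).
Notation rseq := (rseq M).
Implicit Types (X Y : rseq) (S T : Sem.real M) (x y : M T1).

Lemma is_realE (x : M T1) : Sem.is_real x <-> isreal (sval x).
Proof.
suff H (n i : N) : Sem.decode (ap x n : M T0) (fun q =>
      Sem.decode (ap x (Sem.plus n i) : M T0) (fun r =>
        Sem.q_near_lt q r (Sem.two_pow_neg (n : M T0)))) <->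
    (sval x n - sval x (n + i) < eps n /\ sval x (n + i) - sval x n < eps n).
  by split=> Hx n i; apply/H/Hx.
apply: (@decode_dec _ (ap x n) _
  (fun q => q - sval x (n + i) < eps n /\ sval x (n + i) - q < eps n)) => r Gr.
apply: (@decode_dec _ (ap x (n + i)) _
  (fun q => rv r - q < eps n /\ q - rv r < eps n)) => s Gs.
have [Ge <-] := two_pow_neg_rv n; have [G1 <-] := q_sub_rv Gr Gs.
have [G2 <-] := q_sub_rv Gs Gr.
by rewrite /Sem.q_near_lt !q_lt_rv.
Qed.

Lemma reads_zero : reads (@Sem.r_zero M) (fun _ => 0).
Proof. by move=> n F P H; have [G <-] := q_zero_rv M; apply: H. Qed.

Lemma reads_one : reads (@Sem.r_one M) (fun _ => 1).
Proof. by move=> n F P H; have [G <-] := q_one_rv M; apply: H. Qed.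

Lemma reads_add S T X Y : reads S X -> reads T Y -> reads (Sem.r_add S T) (sadd X Y).
Proof.
move=> HX HY n F P H; refine (HX (n + 1) _ (fun q => P (q + Y (n + 1))) _) => r Gr.
refine (HY (n + 1) _ (fun q => P (rv r + q)) _) => s Gs.
by have [G <-] := q_add_rv Gr Gs; apply: H.
Qed.

Lemma reads_sub S T X Y : reads S X -> reads T Y -> reads (Sem.r_sub S T) (ssub X Y).
Proof.
move=> HX HY n F P H; refine (HX (n + 1) _ (fun q => P (q - Y (n + 1))) _) => r Gr.
refine (HY (n + 1) _ (fun q => P (rv r - q)) _) => s Gs.
by have [G <-] := q_sub_rv Gr Gs; apply: H.
Qed.

Lemma reads_lt S T X Y : reads S X -> reads T Y -> Sem.r_lt S T <-> slt X Y.
Proof.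
move=> HX HY; suff H (n : N) : S n (fun q => T n (fun r =>
    Sem.q_lt (Sem.q_add q (Sem.two_pow_one_sub (n : M T0))) r)) <-> X n + 2 * eps n < Y n.
  by split=> -[n /H Hn]; exists n.
apply: (HX n _ (fun q => q + 2 * eps n < Y n)) => r Gr.
apply: (HY n _ (fun q => rv r + 2 * eps n < q)) => s Gs.
have [Ge <-] := two_pow_one_sub_rv n; have [G <-] := q_add_rv Gr Ge.
by rewrite q_lt_rv.
Qed.

Lemma reads_eq S T X Y : reads S X -> reads T Y -> Sem.r_eq S T <-> seqv X Y.
Proof.
move=> HX HY; suff H (n : N) : S n (fun q => T n (fun r =>
    Sem.q_near_le q r (Sem.two_pow_one_sub (n : M T0)))) <->
    (X n - Y n <= 2 * eps n /\ Y n - X n <= 2 * eps n).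
  by split=> Hn n; apply/H/Hn.
apply: (HX n _ (fun q => q - Y n <= 2 * eps n /\ Y n - q <= 2 * eps n)) => r Gr.
apply: (HY n _ (fun q => rv r - q <= 2 * eps n /\ q - rv r <= 2 * eps n)) => s Gs.
have [Ge <-] := two_pow_one_sub_rv n; have [G1 <-] := q_sub_rv Gr Gs.
have [G2 <-] := q_sub_rv Gs Gr.
by rewrite /Sem.q_near_le !q_le_rv.
Qed.

Lemma r_ltE S T X Y : reads S X -> reads T Y -> isreal X -> isreal Y ->
  Sem.r_lt S T <-> exists q, above X q /\ below q Y.
Proof. by move=> HX HY RX RY; rewrite (reads_lt HX HY) sltP. Qed.

Lemma isreal_const (q : Q) : isreal (fun _ : N => q).
Proof. by move=> n i; rewrite subrr eps_gt0. Qed.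

Lemma below_const (p q : Q) : below p (fun _ : N => q) <-> p < q.
Proof.
split=> [[n Hn]|H]; first by have := eps_gt0 n; lra.
have [n Hn] : exists n, eps n < q - p by apply: eps_small; lra.
by exists n; lra.
Qed.

Lemma above_const (p q : Q) : above (fun _ : N => q) p <-> q < p.
Proof.
split=> [[n Hn]|H]; first by have := eps_gt0 n; lra.
have [n Hn] : exists n, eps n < p - q by apply: eps_small; lra.
by exists n; lra.
Qed.

Lemma val_ltE x y : Sem.is_real x -> Sem.is_real y ->
  Sem.r_lt (Sem.val x) (Sem.val y) <-> exists q, above (sval x) q /\ below q (sval y).
Proof. by move=> /is_realE Rx /is_realE Ry; apply: r_ltE => //; apply: reads_val. Qed.

Lemma zero_ltE x : Sem.is_real x ->
  Sem.r_lt (@Sem.r_zero M) (Sem.val x) <-> exists2 q, 0 < q & below q (sval x).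
Proof.
move=> /is_realE Rx; rewrite (r_ltE reads_zero (@reads_val _ x) (isreal_const 0) Rx).
by split=> [[q [/above_const]]|[q q0]]; exists q => //; split=> //; apply/above_const.
Qed.

Definition inI (X : rseq) : Prop :=
  [/\ isreal X, forall q, above X q -> 0 < q & forall q, below q X -> q < 1].

Lemma in_IE x : Sem.in_I x <-> inI (sval x).
Proof.
have E X Y S T : reads S X -> reads T Y -> isreal X -> isreal Y ->
    Sem.r_le S T <-> forall q, above Y q -> ~ below q X.
  move=> HX HY RX RY; rewrite /Sem.r_le (r_ltE HY HX RY RX).
  by split=> [H q H1 H2|H [q [H1 H2]]]; [apply: H; exists q | apply: H H1 H2].
split=> [[/is_realE Rx [H0 H1]]|[Rx H0 H1]].
  have {}H0 := proj1 (E _ _ _ _ reads_zero (@reads_val _ x) (isreal_const 0) Rx) H0.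
  have {}H1 := proj1 (E _ _ _ _ (@reads_val _ x) reads_one Rx (isreal_const 1)) H1.
  split=> // q.
    by move=> /above_open[p pq /H0]; rewrite below_const => /negP; rewrite -leNgt; lra.
  move=> /below_open[p qp Hp]; case: (ltP 1 p) => [p1|]; last by lra.
  by case: (H1 p) => //; apply/above_const.
split; first exact/is_realE; split.
  apply/(E _ _ _ _ reads_zero (@reads_val _ x) (isreal_const 0) Rx) => q /H0.
  by rewrite below_const; lra.
apply/(E _ _ _ _ (@reads_val _ x) reads_one Rx (isreal_const 1)) => q.
by rewrite above_const => H /H1; lra.
Qed.

Lemma real_of_repq G (X : N -> ctx M G -> Q) :
  repq (fun g : ctx M (T0 :: G) => X g.1 g.2) ->
  exists Y : ctx M G -> M T1, internal Y /\ forall g n, sval (Y g) n = X n g.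
Proof.
move=> /repq_code[c [Ic Hc]]; have [L [IL EL]] := internal_lam Ic.
by exists L; split=> // g n; rewrite /sval EL Hc.
Qed.

Lemma const_real (q : Q) : exists x : M T1, Sem.is_real x /\ sval x = fun _ => q.
Proof.
have [Y [_ HY]] := @real_of_repq [::] (fun _ _ => q) (repq_const _ _).
have E : sval (Y tt) = fun _ => q by apply/funext => n; rewrite HY.
by exists (Y tt); split=> //; apply/is_realE; rewrite E; apply: isreal_const.
Qed.

(* The [n]-th approximation is the least multiple of [eps (n + 1)] that no
   element of the set exceeds. *)
Lemma supremum G (P : Q -> ctx M G -> Prop) :
  arith (fun g : ctx M (T0 :: G) => P (dec g.1) g.2) ->
  exists Y : ctx M G -> M T1, internal Y /\ forall g,
    [/\ inI (sval (Y g)),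
        forall t, 0 <= t -> t <= 1 -> P t g -> ~ above (sval (Y g)) t &
        forall u, below u (sval (Y g)) ->
          u < 0 \/ exists t, [/\ u < t, 0 <= t, t <= 1 & P t g]].
Proof.
move=> /(arith_char (P := fun c g => P (dec c) g))[L [IL HL]].
pose T (x : Q) g := exists c : N, [/\ x < dec c, 0 <= dec c, dec c <= 1 & P (dec c) g].
have [j [Ij Hj]] : exists j : ctx M (T0 :: G) -> N, internalN j /\ forall g n,
    ~ T (iota n * eps ((g.1 : N) + 1)) g.2 ->
    ~ T (iota (j g) * eps ((g.1 : N) + 1)) g.2 /\
    forall m, ltN m (j g) -> ~ ~ T (iota m * eps ((g.1 : N) + 1)) g.2.
  apply: (@arith_least _ (T0 :: G) (fun n g => ~ T (iota n * eps ((g.1 : N) + 1)) g.2)).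
  apply: (arith_iff (P := fun g : ctx M (T0 :: T0 :: G) => ~ exists c : N,
    iota (g.1 : N) * eps ((g.2.1 : N) + 1) < dec c /\ 0 <= dec c /\ dec c <= 1 /\
    ap (L g.2.2) c = 0 :> N)).
    move=> g; split=> H [c Hc]; apply: H; exists c.
      by case: Hc => ? ? ? /HL.
    by case: Hc => ? [? [? /HL]].
  arithmetic.
have R : repq (fun g : ctx M (T0 :: G) => iota (j (g.1, g.2)) * eps ((g.1 : N) + 1)).
  apply: (repq_eq (f := fun g => iota (j g) * eps ((g.1 : N) + 1))) => [[]//|].
  rationality.
have [Y [IY HY]] := real_of_repq (X := fun n g => iota (j (n, g)) * eps (n + 1)) R.
exists Y; split=> // g.
have {HY} HY n : sval (Y g) n = iota (j (n, g)) * eps (n + 1) by [].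
have ub n t : 0 <= t -> t <= 1 -> P t g -> t <= sval (Y g) n.
  have [nT _] : ~ T (sval (Y g) n) g /\ forall m, ltN m (j (n, g)) -> ~ ~ T (iota m * eps (n + 1)) g.
    (* [pow2 (n + 1)] steps of length [eps (n + 1)] reach 1, which no element of the set in [0,1]
       exceeds; so the least multiple exists. *)
    rewrite HY; apply: (Hj (n, g) (pow2 (n + 1))) => -[c []] /=.
    by rewrite /eps mulfV ?lt0r_neq0 ?pow2_gt0 //; lra.
  move=> t0 t1 Pt; rewrite leNgt; apply/negP => H; apply: nT.
  by have [c Ec] := dec_surj t; exists c; rewrite Ec.
have lb n : sval (Y g) n = 0 \/ exists t, [/\ sval (Y g) n - eps (n + 1) < t, 0 <= t, t <= 1 & P t g].
  have [E|E] := predNK (j (n, g)); first by left; rewrite HY E iota0 mul0r.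
  right; have [_ H] := Hj (n, g) (pow2 (n + 1)) ltac:(by
    move=> -[c []] /=; rewrite /eps mulfV ?lt0r_neq0 ?pow2_gt0 //; lra).
  have /contrapT[c [H1 H2 H3 H4]] := H (predN (j (n, g))) ltac:(rewrite -{2}E; apply: ltNS).
  exists (dec c); split=> //; move: H1; rewrite HY /= -[X in iota X * _ - _]E iotaD iota1.
  by rewrite mulrDl mul1r addrK.
have ge0 n : 0 <= sval (Y g) n.
  by rewrite HY mulr_ge0 ?iota_ge0 // ltW // eps_gt0.
have le1 n : sval (Y g) n < 1 + eps (n + 1).
  have := eps_gt0 (n + 1).
  by have [->|[t [H _ H' _]]] := lb n; lra.
have close n m : sval (Y g) n < sval (Y g) m + eps (n + 1).
  have [->|[t [H t0 t1 Pt]]] := lb n; first by have := ge0 m; have := eps_gt0 (n + 1); lra.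
  by have := ub m t t0 t1 Pt; lra.
split.
- split.
  + move=> n i; have := close n (n + i); have := close (n + i) n.
    have := eps_double n; have := eps_add (n + 1) i; rewrite addrAC.
    by have := eps_gt0 (n + 1); split; lra.
  + by move=> q [n Hn]; have := ge0 n; have := eps_gt0 n; lra.
  + by move=> q [n Hn]; have := le1 n; have := eps_double n; have := eps_gt0 (n + 1); lra.
- move=> t t0 t1 Pt [n Hn]; have := ub n t t0 t1 Pt; have := eps_gt0 n; lra.
- move=> u [n Hn]; have [E|[t [H t0 t1 Pt]]] := lb n.
    by left; have := eps_gt0 n; lra.
  right; exists t; split=> //.
  by have := eps_double n; have := eps_gt0 (n + 1); lra.
Qed.

(** Let x be the supremum of the rationals of [0,1] satisfying [P]. Some such t lies above u, and
    from t the property passes to a rational beyond x, which is absurd, unless 1 < v, and then it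
    passes to 1. *)
Lemma real_induction (P : Q -> Prop) :
  arith (fun g : ctx M [:: T0] => P (dec g.1)) -> P 0 ->
  (forall x : M T1, inI (sval x) -> exists u v, [/\ below u (sval x), above (sval x) v &
    forall t t', 0 <= t -> t' <= 1 -> u < t -> t < t' -> t' < v -> P t -> P t']) ->
  P 1.
Proof.
move=> /(@supremum [::] (fun q _ => P q))[Y [_ /(_ tt)]].
move: (Y tt) => x [Ix ub lb] P0 loc.
have [u [v [Hu Hv H]]] := loc x Ix; have [Rx x0 x1] := Ix.
have [t [ut t0 t1 Pt]] : exists t, [/\ u < t, 0 <= t, t <= 1 & P t].
  by have [u0|//] := lb u Hu; exists 0; split.
have tv : t < v.
  by rewrite ltNge; apply/negP => vt; apply: (ub t t0 t1 Pt); apply: above_le Hv.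
have [E|t1'] : t = 1 \/ t < 1 by case: (ltP t 1) => ?; [right | left; lra].
  by rewrite -E.
have [v1|v1] := ltP 1 v; first exact: (H t 1).
have [w wv Hw] := above_open Hv.
have tw : t < w.
  by rewrite ltNge; apply/negP => wt; apply: (ub t t0 t1 Pt); apply: above_le Hw.
by case: (ub w _ _ (H t w t0 _ ut tw wv Pt)) => //; lra.
Qed.

End Reals.

(** * Sequences of intervals *)

Section Intervals.

Variable M : model.
Notation N := (N M).
Notation Q := (Q M).
Notation eps := (@eps M).
Notation rseq := (rseq M).
Implicit Types (a b c d y : M (T0 ~> T1)) (X : rseq).

Definition sreal a : Prop := forall k : N, isreal (sval (ap a k)).

Definition inside a b (k : N) X : Prop :=
  (exists p, above (sval (ap a k)) p /\ below p X) /\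
  (exists p, above X p /\ below p (sval (ap b k))).

(* The margin [eps n] makes a cover of the rationals of a closed interval cover
   its reals as well. *)
Definition mcov a b (n : N) (q : Q) : Prop := exists k : N,
  ltN k n /\ above (sval (ap a k)) (q - eps n) /\ below (q + eps n) (sval (ap b k)).

Lemma ltN_addr (k n m : N) : ltN k n -> ltN k (n + m).
Proof. by rewrite -!iota_lt iotaD; have := iota_ge0 m; lra. Qed.

Lemma mcov_mono a b n m q : mcov a b n q -> mcov a b (n + m) q.
Proof.
move=> [k [kn [Ha Hb]]]; exists k; split; first exact: ltN_addr.
have := eps_add n m.
by split; [apply: above_le Ha | apply: below_le Hb]; lra.
Qed.

Lemma mcov_interval a b (k : N) (u v : Q) :
  above (sval (ap a k)) u -> below v (sval (ap b k)) ->
  exists n, forall q, u <= q -> q <= v -> mcov a b n q.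
Proof.
move=> /above_open[u' uu Hu] /below_open[v' vv Hv].
have [n Hn] : exists n, eps n < u - u' by apply: eps_small; lra.
have [m Hm] : exists m, eps m < v' - v by apply: eps_small; lra.
exists (n + (m + (k + 1))) => q uq qv; exists k; split.
  by rewrite addrA; rewrite -iota_lt !iotaD iota1; have := iota_ge0 n; have := iota_ge0 m; lra.
have := eps_add n (m + (k + 1)); have := eps_add m (n + (k + 1)); rewrite addrCA => H1 H2.
by split; [apply: above_le Hu | apply: below_le Hv]; lra.
Qed.

Lemma mcov_real a b n q X : mcov a b n q ->
  below (q - eps n) X -> above X (q + eps n) -> exists2 k, ltN k n & inside a b k X.
Proof.
move=> [k [kn [Ha Hb]]] H1 H2; exists k => //.
by split; [exists (q - eps n) | exists (q + eps n)].
Qed.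

Lemma inI_const (q : Q) : 0 <= q -> q <= 1 -> inI (fun _ : N => q).
Proof.
move=> q0 q1; split=> [|p|p]; first exact: isreal_const.
  by rewrite above_const; lra.
by rewrite below_const; lra.
Qed.

Lemma inI_approx X (e : Q) : inI X -> 0 < e ->
  exists q, [/\ 0 <= q, q <= 1, below (q - e) X & above X (q + e)].
Proof.
move=> [RX X0 X1] e0; have e2 : 0 < e / 2 by lra.
have [p [Hp Hp']] := approx X e2.
have p1 := X1 _ Hp; have p0 := X0 _ Hp'.
case: (ltP p 0) => H.
  by exists 0; split=> //; [apply: below_le Hp | apply: above_le Hp']; lra.
by exists p; split=> //; [lra | apply: below_le Hp | apply: above_le Hp']; lra.
Qed.

(** Real induction on t, for the property that some n gives a cover of the rationals of [0,t] with
    margins. The family of O and that of the balls stay separate, since only the second one is to be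
    measured in the end. *)
Lemma finite_subcover a b c d :
  (forall x : M T1, inI (sval x) ->
     (exists k, inside a b k (sval x)) \/ (exists k, inside c d k (sval x))) ->
  exists n, forall X, inI X ->
    (exists2 k, ltN k n & inside a b k X) \/ (exists2 k, ltN k n & inside c d k X).
Proof.
move=> cov; pose C (n : N) (q : Q) := mcov a b n q \/ mcov c d n q.
have Cmono n m q : C n q -> C (n + m) q.
  by case=> H; [left | right]; apply: mcov_mono.
have loc (x : M T1) : inI (sval x) -> exists u v, [/\ below u (sval x), above (sval x) v &
    exists n, forall q, u <= q -> q <= v -> C n q].
  move=> /cov[] [k [[u [Hu Hu']] [v [Hv Hv']]]]; exists u, v; split=> //.
    by have [n Hn] := mcov_interval Hu Hv'; exists n => q uq qv; left; apply: Hn.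
  by have [n Hn] := mcov_interval Hu Hv'; exists n => q uq qv; right; apply: Hn.
have [n Hn] : exists n : N, forall q : Q, 0 <= q -> q <= 1 -> C n q.
  apply: (real_induction (P := fun t => exists n : N, forall q : Q, 0 <= q -> q <= t -> C n q)).
  - rewrite /C /mcov /above /below /sval; arithmetic.
  - have [x [Rx Ex]] := const_real (0 : Q); have [] := loc x.
      by rewrite Ex; apply: inI_const.
    move=> u [v [Hu Hv [n Hn]]]; exists n => q q0 q0'; move: Hu Hv.
    by rewrite Ex below_const above_const => Hu Hv; apply: Hn; lra.
  move=> x /loc[u [v [Hu Hv [n Hn]]]]; exists u, v; split=> // t t' t0 t1 ut tt tv [m Hm].
  exists (n + m) => q q0 qt.
  case: (leP q t) => [H|H]; first by rewrite addrC; apply/Cmono/Hm.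
  by apply/Cmono/Hn; lra.
(* A rational within [eps n] of [X] suffices, because its interval has the margin [eps n]. *)
exists n => X IX; have [q [q0 q1 H1 H2]] := inI_approx IX (eps_gt0 n).
by case: (Hn q q0 q1) => H; [left | right]; apply: mcov_real H _ _.
Qed.

(* [y] maps the code of [q] to the leftmost point of [[q, 1]] outside of the
   intervals. *)
Lemma dense_uncovered a b : sreal a -> sreal b -> exists y, forall q : N,
  inI (sval (ap y q)) /\
  forall X, inI X -> (forall k, ~ inside a b k X) -> 0 <= dec q -> ~ above X (dec q) ->
  [/\ forall p, above X p -> ~ below p (sval (ap y q)), ~ above (sval (ap y q)) (dec q) &
      forall k, ~ inside a b k (sval (ap y q))].
Proof.
move=> Ra Rb.
(* The supremum of these t is the right end of the finitely coverable segment starting at q; the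
   first alternative keeps it from falling below q. *)
pose P (t : Q) (g : ctx M [:: T0]) := t <= dec g.1 \/
  exists n : N, forall p : Q, dec g.1 <= p -> p <= t -> mcov a b n p.
have aP : arith (fun g : ctx M [:: T0; T0] => P (dec g.1) g.2).
  rewrite /P /mcov /above /below /sval; arithmetic.
have [Y [[y Ey] HY]] := supremum aP.
exists y => q; have {HY} := HY (q, tt); rewrite -Ey /=; set Z := sval _ => -[IZ ub lb].
split=> // X [RX X0 X1] nX q0 qX; have [RZ Z0 Z1] := IZ.
have q1 : dec q <= 1.
  by rewrite leNgt; apply/negP => H; have [/X1|//] := located X H; lra.
have Zq : ~ above Z (dec q) by apply: ub => //; left.
have ZX p : above X p -> ~ below p Z.
  move=> Hp /lb[|[t [pt t0 t1]]]; first by have := X0 _ Hp; lra.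
  have tq : dec q < t.
    by rewrite ltNge; apply/negP => H; apply: qX; apply: above_le Hp; lra.
  case=> [/= H|[n Hn]]; first by move: H; rewrite leNgt tq.
  (* If the coverable segment went past [X], a rational [r] just to the right of [X], closer than
     [eps n], would be covered with a margin reaching [X]. *)
  have m0 : 0 < Num.min (eps n) (t - p) / 2 by rewrite divr_gt0 // lt_min eps_gt0 /=; lra.
  have [p' [Hp' Hp'']] := approx X m0.
  pose r := p' + Num.min (eps n) (t - p) / 2.
  have mn : Num.min (eps n) (t - p) <= eps n by rewrite ge_min lexx.
  have mt : Num.min (eps n) (t - p) <= t - p by rewrite ge_min lexx orbT.
  have p'p : p' < p by apply: below_lt_above Hp' Hp.
  have rt : r <= t by rewrite /r; lra.
  have qr : dec q <= r.
    by rewrite leNgt; apply/negP => H; apply: qX; apply: above_le Hp''; rewrite -/r; lra.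
  have [k _] : exists2 k, ltN k n & inside a b k X.
    by apply: mcov_real (Hn r qr rt) _ _; [apply: below_le Hp' | apply: above_le Hp''];
      rewrite -/r /r; have := eps_gt0 n; lra.
  exact: nX.
split=> // k [[u [Hu uZ]] [v [Zv Hv]]].
(* Suppose an interval contains [Z]. If [Z] is below 1, the interval prolongs the coverable segment
   beyond its supremum. Otherwise [Z] and [X] are both 1, and the interval contains [X]. *)
have [Z1'|Z1'] := pselect (above Z 1).
  have [w [wv w1 Zw]] : exists w, [/\ w <= v, w <= 1 & exists2 w', w' < w & above Z w'].
    case: (leP v 1) => H; last by exists 1; split=> //; [lra | apply: above_open].
    by exists v; split=> //; apply: above_open.
  have [w' ww Zw'] := Zw.
  have qw : dec q <= w'.
    by rewrite leNgt; apply/negP => H; apply: Zq; apply: above_le Zw'; lra.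
  apply: (ub w') => //; try lra; right => /=.
  have [n Hn] := mcov_interval Hu Hv.
  have [u0|[t [ut t0 t1 [/= tq|[m Hm]]]]] := lb u uZ.
  - by exists n => p qp pw; apply: Hn; lra.
  - by exists n => p qp pw; apply: Hn; lra.
  exists (n + m) => p qp pw.
  case: (leP p t) => H; first by rewrite addrC; apply: mcov_mono (Hm _ qp H).
  by apply: mcov_mono; apply: Hn; lra.
apply: (nX k); split.
  have [u' uu Hu'] := above_open Hu; exists u'; split=> //.
  have [//|H] := located X uu; case: (ZX u) => //.
have [v' vv Hv'] := below_open Hv; exists v'; split=> //.
have v1 : 1 <= v by rewrite leNgt; apply/negP => H; apply: Z1'; apply: above_le Zv; lra.
by have [/X1|//] := located X vv; lra.
Qed.

End Intervals.

(** * Countable subadditivity *)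

Section Clip.

Variable R : realFieldType.

(* The length of the part of [[l, r]] to the left of [t]. *)
Definition clip (l r t : R) : R := if t < l then 0 else if r < t then r - l else t - l.

Lemma clip_ge0 l r t : l <= r -> 0 <= clip l r t.
Proof. by rewrite /clip; case: (ltP t l) => ?; case: (ltP r t) => ?; lra. Qed.

Lemma clip_le l r t : l <= r -> clip l r t <= r - l.
Proof. by rewrite /clip; case: (ltP t l) => ?; case: (ltP r t) => ?; lra. Qed.

Lemma clip_mono l r t t' : l <= r -> t <= t' -> clip l r t <= clip l r t'.
Proof.
rewrite /clip; case: (ltP t l) => ?; case: (ltP r t) => ?; case: (ltP t' l) => ?;
  by case: (ltP r t') => ?; lra.
Qed.

Lemma clip_in l r t : l <= t -> t <= r -> clip l r t = t - l.
Proof. by rewrite /clip; case: (ltP t l) => ?; case: (ltP r t) => ?; lra. Qed.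

End Clip.

Section Subadditivity.

Variable M : model.
Notation N := (N M).
Notation Q := (Q M).
Notation eps := (@eps M).
Notation iota := (@iota M).
Notation rseq := (rseq M).
Implicit Types (a b c d y s : M (T0 ~> T1)) (X : rseq).

Lemma repq_if G (f h p q : ctx M G -> Q) : repq f -> repq h -> repq p -> repq q ->
  repq (fun g => if f g < h g then p g else q g).
Proof.
move=> Rf Rh Rp Rq; apply: repq_graph.
apply: (arith_iff (P := fun g : ctx M (T0 :: G) => f g.2 < h g.2 /\ dec g.1 = p g.2 \/
  ~ f g.2 < h g.2 /\ dec g.1 = q g.2)) => [g|].
  case: ifP => H; split; try by [left | right].
    by case=> [[]|[/(_ isT)]].
  by case=> [[]|[]].
by apply: arith_or; apply: arith_and; try apply: arith_not;
  (apply: arith_qlt || apply: arith_qeq); rationality.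
Qed.

Lemma sum_code (f : N -> N -> Q) : repq (fun g : ctx M [:: T0; T0] => f g.1 g.2.1) ->
  exists F : M (T0 ~> T0 ~> T0), forall t : N,
    dec (ap (ap F t) (0 : N)) = 0 /\
    forall n : N, dec (ap (ap F t) (n + 1)) = dec (ap (ap F t) n) + f n t.
Proof.
move=> /(repq_sum (f := fun n (g : ctx M [:: T0]) => f n g.1))[S [RS S0 SS]].
have [L [[F HF] EL]] := real_of_repq RS.
exists F => t; have E n : dec (ap (ap F t) n) = S n (t, tt) by rewrite -EL -HF.
by rewrite E S0; split=> // n; rewrite !E SS.
Qed.

(** Let S_n(t) be the sum of the f(m,t) for m < n. Near each real one summand already has slope at
    least 1 in t and the others are monotone, so the property that q <= S_n(q) for some n propagates
    from 0 to 1 by real induction. *)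
Lemma sums_reach_one (f : N -> N -> Q) (F : M (T0 ~> T0 ~> T0)) :
  (forall t : N, dec (ap (ap F t) (0 : N)) = 0 /\
    forall n : N, dec (ap (ap F t) (n + 1)) = dec (ap (ap F t) n) + f n t) ->
  (forall n t, 0 <= f n t) ->
  (forall n t t', dec t <= dec t' -> f n t <= f n t') ->
  (forall x : M T1, inI (sval x) -> exists u v, [/\ below u (sval x), above (sval x) v &
    exists k, forall t t', u < dec t -> dec t < dec t' -> dec t' < v ->
      dec t' - dec t <= f k t' - f k t]) ->
  exists n t : N, dec t = 1 /\ 1 <= dec (ap (ap F t) n).
Proof.
move=> HF f_ge0 f_mono loc.
have F_mono_n (t n i : N) : dec (ap (ap F t) n) <= dec (ap (ap F t) (n + i)).
  move: i; apply: N_ind; first by arithmetic.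
    by rewrite addr0.
  by move=> i H; rewrite addrA (proj2 (HF t)); have := f_ge0 (n + i) t; lra.
have F_mono (t t' n : N) : dec t <= dec t' -> dec (ap (ap F t) n) <= dec (ap (ap F t') n).
  move=> tt; move: n; apply: N_ind; first by arithmetic.
    by rewrite !(proj1 (HF _)).
  by move=> n H; rewrite !(proj2 (HF _)); have := f_mono n _ _ tt; lra.
have F_slope (t t' k i : N) : dec t <= dec t' -> dec t' - dec t <= f k t' - f k t ->
    dec t' - dec t <= dec (ap (ap F t') (k + 1 + i)) - dec (ap (ap F t) (k + 1 + i)).
  move=> tt H; move: i; apply: N_ind; first by arithmetic.
    by rewrite addr0 !(proj2 (HF _)); have := F_mono _ _ k tt; lra.
  by move=> i Hi; rewrite addrA !(proj2 (HF _)); have := f_mono (k + 1 + i) _ _ tt; lra.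
have [n [t [Et Ht]]] : exists n t : N, dec t = 1 /\ 1 <= dec (ap (ap F t) n).
  apply: (real_induction (P := fun q => exists n t : N, dec t = q /\ q <= dec (ap (ap F t) n))).
  - arithmetic.
  - have [t Et] := dec_surj (0 : Q); exists 0, t; split=> //.
    by rewrite (proj1 (HF t)).
  move=> x /loc[u [v [Hu Hv [k Hk]]]]; exists u, v; split=> // q q' q0 q1 uq qq qv [n [t [Et Ht]]].
  (* The bound [k + 1 + n] includes the summand [k], which gives the slope, and the n summands that
     reach q. *)
  have [t' Et'] := dec_surj q'; exists (k + 1 + n), t'; split=> //.
  have tt : dec t < dec t' by rewrite Et Et'.
  have := F_slope t t' k n (ltW tt) (Hk t t' _ tt _).
  have := F_mono_n t n (k + 1); rewrite addrC Et Et' => H1 H2.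
  by have := H2 uq qv; lra.
by exists n, t.
Qed.

(** The recursion for the partial sums, read off for rational upper bounds; this is how lengths
    enter [sum_of_cover]. *)
Definition is_sum a b s : Prop := [/\ sreal s,
  forall u, above (sval (ap s (0 : N))) u -> 0 < u &
  forall (n : N) u, above (sval (ap s (n + 1))) u -> exists v w z,
    [/\ above (sval (ap s n)) v, above (sval (ap b n)) w, below z (sval (ap a n)) &
        u = v + (w - z)]].

Definition is_intervals a b : Prop := [/\ sreal a, sreal b &
  forall (k : N) p, above (sval (ap b k)) p -> ~ below p (sval (ap a k))].

(* Rational endpoints of an interval that contains the [k]-th one and is longer
   by at most [4 * eps (k + j)]. *)
Definition left_end a (j k : N) : Q := sval (ap a k) (k + j) - eps (k + j).
Definition right_end b (j k : N) : Q := sval (ap b k) (k + j) + eps (k + j).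

Lemma left_end_lt a (j k : N) u : sreal a -> above (sval (ap a k)) u -> left_end a j k < u.
Proof. by move=> Ra Hu; apply: above_lb Hu. Qed.

Lemma right_end_gt b (j k : N) u : sreal b -> below u (sval (ap b k)) -> u < right_end b j k.
Proof. by move=> Rb Hu; apply: below_ub Hu. Qed.

Lemma ends_le a b (j k : N) : is_intervals a b -> left_end a j k <= right_end b j k.
Proof.
move=> [Ra Rb ab]; rewrite leNgt; apply/negP; rewrite /left_end /right_end => H.
apply: (ab k ((sval (ap a k) (k + j) + sval (ap b k) (k + j)) / 2)); exists (k + j); lra.
Qed.

Lemma ends_sub a b (j k : N) w z : is_intervals a b ->
  above (sval (ap b k)) w -> below z (sval (ap a k)) ->
  right_end b j k - left_end a j k <= w - z + 4 * eps (k + j).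
Proof.
move=> [Ra Rb ab] Hw Hz; have := above_lb (k + j) (Rb k) Hw.
by have := below_ub (k + j) (Ra k) Hz; rewrite /left_end /right_end; lra.
Qed.

Lemma clip_slope a b j (k t t' : N) u v : sreal a -> sreal b ->
  above (sval (ap a k)) u -> below v (sval (ap b k)) ->
  u < dec t -> dec t < dec t' -> dec t' < v ->
  dec t' - dec t <= clip (left_end a j k) (right_end b j k) (dec t') -
                    clip (left_end a j k) (right_end b j k) (dec t).
Proof.
move=> Ra Rb Hu Hv ut tt tv.
have := left_end_lt j Ra Hu; have := right_end_gt j Rb Hv => H1 H2.
by rewrite !clip_in; lra.
Qed.

(** Countable subadditivity for two families that cover [0,1]. Endpoints are enlarged to rational
    ones, so that the clipped lengths are rational and can be summed by recursion; an interval
    containing x contributes slope 1 near x. *)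
Lemma sum_of_cover a b s a' b' s' (e : Q) :
  is_intervals a b -> is_sum a b s -> is_intervals a' b' -> is_sum a' b' s' ->
  (forall x : M T1, inI (sval x) ->
     (exists k, inside a b k (sval x)) \/ (exists k, inside a' b' k (sval x))) ->
  e < 1 ->
  exists n : N, forall u u', above (sval (ap s n)) u -> above (sval (ap s' n)) u' -> e < u + u'.
Proof.
move=> Iab [Rs s0 sS] Iab' [Rs' s0' sS'] cov e1.
have [Ra Rb _] := Iab; have [Ra' Rb' _] := Iab'.
(* Makes the total enlargement, at most [16 * eps j], smaller than [1 - e]. *)
have [j Hj] : exists j, eps j < (1 - e) / 16 by apply: eps_small; lra.
pose f (n t : N) : Q := clip (left_end a j n) (right_end b j n) (dec t) +
                        clip (left_end a' j n) (right_end b' j n) (dec t).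
have Rf : repq (fun g : ctx M [:: T0; T0] => f g.1 g.2.1).
  by rewrite /f /clip /left_end /right_end /sval; apply: repq_add;
    (apply: repq_if; [rationality | rationality | rationality |
     apply: repq_if; rationality]).
have [F HF] := sum_code Rf.
have [||x Ix|n [t [Et Ht]]] := sums_reach_one HF.
- by move=> n t; apply: addr_ge0; apply/clip_ge0/ends_le.
- by move=> n t t' tt; apply: lerD; apply: clip_mono => //; apply: ends_le.
- case: (cov x Ix) => -[k [[u [Hu Hu']] [v [Hv Hv']]]]; exists u, v; split=> //; exists k => t t' ut tt tv.
    have := clip_slope j Ra Rb Hu Hv' ut tt tv.
    by have := clip_mono (ends_le j k Iab') (ltW tt); rewrite /f; lra.
  have := clip_slope j Ra' Rb' Hu Hv' ut tt tv.
  by have := clip_mono (ends_le j k Iab) (ltW tt); rewrite /f; lra.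
exists n => u u' Hu Hu'.
(* Each of the two families loses [4 * eps (k + j)] at index k, and the sum of [eps (k + j)] over k
   < n is [2 * (eps j - eps (n + j))]. *)
suff : dec (ap (ap F t) n) <= u + u' + 16 * (eps j - eps (n + j)).
  by have := eps_gt0 (n + j); lra.
move: n u u' Hu Hu' {Ht}.
have bound (n : N) : forall u u' : Q, above (sval (ap s n)) u -> above (sval (ap s' n)) u' ->
    dec (ap (ap F t) n) <= u + u' + 16 * (eps j - eps (n + j)).
  move: n; apply: N_ind.
  - rewrite /above /sval; arithmetic.
  - move=> u u' /s0 H /s0' H'; rewrite (proj1 (HF t)) add0r; lra.
  move=> n IH u u' /sS[v [w [z [Hv Hw Hz ->]]]] /sS'[v' [w' [z' [Hv' Hw' Hz' ->]]]].
  rewrite (proj2 (HF t)) /f [n + 1 + j]addrAC; have := IH _ _ Hv Hv'; have := eps_double (n + j).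
  have := ends_sub j Iab Hw Hz; have := ends_sub j Iab' Hw' Hz'.
  have := clip_le (dec t) (ends_le j n Iab); have := clip_le (dec t) (ends_le j n Iab').
  lra.
exact: bound.
Qed.

End Subadditivity.

(** * From Lusin's theorem to the covering principle *)

Section Main.

Variable M : model.
Notation N := (N M).
Notation Q := (Q M).
Notation eps := (@eps M).
Notation rseq := (rseq M).
Implicit Types (a b c d y s : M (T0 ~> T1)) (X : rseq).

Lemma insideE a b (k : N) (x : M T1) : sreal a -> sreal b -> Sem.is_real x ->
  inside a b k (sval x) <-> Sem.r_lt (Sem.val (ap a k)) (Sem.val x) /\
                            Sem.r_lt (Sem.val x) (Sem.val (ap b k)).
Proof.
by move=> Ra Rb Rx; rewrite /inside !val_ltE //; apply/is_realE; [apply: Rb | apply: Ra].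
Qed.

Lemma cover_with_sumsE E a b s : Sem.cover_with_sums E a b s ->
  [/\ is_intervals a b, is_sum a b s &
      forall x, Sem.is_real x -> E x -> exists k, inside a b k (sval x)].
Proof.
move=> [[ab cov] [/= Rs [s0 sS]]].
have Ra : sreal a by move=> k; apply/is_realE; case: (ab k).
have Rb : sreal b by move=> k; apply/is_realE; case: (ab k) => _ [].
have Rs' : sreal s by move=> k; apply/is_realE.
split.
- split=> // k p Hp Hp'; have [_ [_ []]] := ab k.
  by rewrite val_ltE; [exists p | apply/is_realE | apply/is_realE].
- split=> //.
    move=> u Hu; have := proj1 (reads_eq (@reads_val _ _) (@reads_zero M)) s0.
    by move=> /(seqv_above (Rs' _) (isreal_const 0))/(_ Hu)/above_const.
  move=> n u Hu.
  have := proj1 (reads_eq (@reads_val _ _) (reads_add (@reads_val _ _)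
    (reads_sub (@reads_val _ _) (@reads_val _ _)))) (sS n).
  have Rd : isreal (ssub (sval (ap b n)) (sval (ap a n))) by apply: isreal_sub.
  move=> /(seqv_above (Rs' _) (isreal_add (Rs' _) Rd))/(_ Hu).
  move=> /(above_add _ (Rs' _) Rd)[v [w [Hv /(above_sub _ (Rb _) (Ra _))[w' [z [Hw Hz ->]] ->]]]].
  by exists v, w', z.
- move=> x Rx /(cov x Rx)[k Hk]; exists k; exact/insideE.
Qed.

(** The finite subcover exists for sequences of intervals in the model; the ends of the balls form
    such sequences with [y] and [Psi] as parameters. *)
Lemma internal_families (y : M (T0 ~> T1)) (Psi : M (T1 ~> T1)) :
  exists c d : M (T0 ~> T1), forall j : N,
    sval (ap c j) = ssub (sval (ap y j)) (sval (ap Psi (ap y j))) /\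
    sval (ap d j) = sadd (sval (ap y j)) (sval (ap Psi (ap y j))).
Proof.
have [C [[c Hc] EC]] := @real_of_repq M [:: T0] (fun n g =>
  ssub (sval (ap y g.1)) (sval (ap Psi (ap y g.1))) n)
  ltac:(rewrite /ssub /sval; rationality).
have [D [[d Hd] ED]] := @real_of_repq M [:: T0] (fun n g =>
  sadd (sval (ap y g.1)) (sval (ap Psi (ap y g.1))) n)
  ltac:(rewrite /sadd /sval; rationality).
exists c, d => j; split; apply/funext => n.
  by rewrite -(EC (j, tt)) -Hc.
by rewrite -(ED (j, tt)) -Hd.
Qed.

(** With 0 < p < Psi(x) = g(x), continuity gives g > p/2 near x. A center z in C close to x then has
    Psi(z) = g(z) > p/2, which exceeds its distance from x. *)
Lemma balls_cover (Psi g : M (T1 ~> T1)) a b y c d :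
  (forall x, Sem.in_I x -> isreal (sval (ap Psi x))) ->
  (forall x, Sem.in_I x -> isreal (sval (ap g x))) ->
  (forall x, Sem.in_I x -> exists2 q, 0 < q & below q (sval (ap Psi x))) ->
  Sem.continuous_I g ->
  (forall x, Sem.in_I x -> (forall k, ~ inside a b k (sval x)) ->
     seqv (sval (ap Psi x)) (sval (ap g x))) ->
  (forall q : N, inI (sval (ap y q)) /\
    forall X, inI X -> (forall k, ~ inside a b k X) -> 0 <= dec q -> ~ above X (dec q) ->
    [/\ forall p, above X p -> ~ below p (sval (ap y q)), ~ above (sval (ap y q)) (dec q) &
        forall k, ~ inside a b k (sval (ap y q))]) ->
  (forall j : N, sval (ap c j) = ssub (sval (ap y j)) (sval (ap Psi (ap y j))) /\
    sval (ap d j) = sadd (sval (ap y j)) (sval (ap Psi (ap y j)))) ->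
  forall x, Sem.in_I x -> (forall k, ~ inside a b k (sval x)) ->
  exists j, inside c d j (sval x).
Proof.
move=> RP Rg Ppos gcont Pg Hy Hcd x Ix nx; have /in_IE IX := Ix; have [RX X0 X1] := IX.
have [p p0 Hp] := Ppos x Ix.
have Hgp := seqv_below (RP x Ix) (Rg x Ix) (Pg x Ix nx) Hp.
have [e [Re Ee]] := const_real (p / 2).
have pe : Sem.pos_real e.
  split=> //; apply/zero_ltE => //; rewrite Ee; exists (p / 4); first lra.
  by apply/below_const; lra.
have [delta [[Rdelta /(zero_ltE Rdelta)[dl dl0 Hdl]] Hdelta]] := gcont x Ix e pe.
(* [r <= dl] serves continuity and [r <= p / 2] the radius; the center found below is at distance
   less than 3r/4. *)
pose r := Num.min dl (p / 2).
have r0 : 0 < r by rewrite lt_min dl0 /=; lra.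
have rd : r <= dl by rewrite ge_min lexx.
have rp : r <= p / 2 by rewrite ge_min lexx orbT.
have r2 : 0 < r / 2 by lra.
have [w [Hw Hw']] := approx (sval x) r2.
(* The lower approximation of x is replaced by 0 if negative, since the points of [y] are described
   only for nonnegative q. *)
have [q [q0 Hqx Hq']] : exists q, [/\ 0 <= q, ~ above (sval x) q & above (sval x) (q + r / 2)].
  case: (ltP w 0) => H.
    exists 0; split=> //; last by apply: above_le Hw'; lra.
    by move=> /X0; rewrite ltxx.
  by exists w; split=> // H'; have := below_lt_above RX Hw H'; rewrite ltxx.
have [j Ej] := dec_surj q; rewrite -Ej in q0 Hqx Hq'.
have [IY /(_ _ IX nx q0 Hqx)[YX qY nY]] := Hy j.
set z := ap y j in IY YX qY nY.
have Iz : Sem.in_I z by apply/in_IE.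
have [RY Y0 Y1] := IY.
have r4 : 0 < r / 4 by lra.
have [v [Hv Hv']] := approx (sval x) r4.
have Yv : above (sval z) (v + r / 2).
  have lt : v + r / 4 < v + r / 2 by lra.
  have [H|//] := located (sval z) lt.
  by case: (YX _ Hv' H).
have Yq : below (dec j - r / 4) (sval z).
  have lt : dec j - r / 4 < dec j by lra.
  by have [//|/qY//] := located (sval z) lt.
have near : Sem.r_near (Sem.val x) (Sem.val z) (Sem.val delta).
  have L := @reads_val M; have RD : isreal (sval delta) by apply/is_realE.
  split; apply/(r_ltE (reads_sub (L _) (L _)) (L _) (isreal_sub _ _) RD) => //.
    exists (dec j + r / 2 - (dec j - r / 4)); split; last by apply: below_le Hdl; lra.
    by apply/above_sub => //; exists (dec j + r / 2), (dec j - r / 4).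
  exists (v + r / 2 - v); split; last by apply: below_le Hdl; lra.
  by apply/above_sub => //; exists (v + r / 2), v.
have [Hnear _] := Hdelta z Iz near.
have Hgz : below (p / 2) (sval (ap g z)).
  move: Hnear; have L := @reads_val M; have RE : isreal (sval e) by apply/is_realE.
  move=> /(r_ltE (reads_sub (L _) (L _)) (L _) (isreal_sub (Rg _ Ix) (Rg _ Iz)) RE)[t [Ht]].
  rewrite Ee below_const => Ht'.
  move: Ht => /(above_sub _ (Rg _ Ix) (Rg _ Iz))[u [u' [Hu Hu' Et]]].
  apply: below_le Hu'; have := below_lt_above (Rg _ Ix) Hgp Hu; lra.
(* Here it matters that the center itself lies outside of the intervals. *)
have HPz : below (p / 2) (sval (ap Psi z)).
  by apply: seqv_below (seqv_sym (Pg z Iz nY)) Hgz; [apply: Rg | apply: RP].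
exists j; rewrite /inside; have [-> ->] := Hcd j; split.
  exists (v + r / 2 - p / 2); split.
    by apply/above_sub => //; [apply: RP | exists (v + r / 2), (p / 2)].
  by apply: below_le Hv; lra.
exists (dec j + r / 2); split=> //.
apply: (@below_le _ _ (dec j - r / 4 + p / 2)); first by lra.
by apply/below_add => //; [apply: RP | exists (dec j - r / 4), (p / 2)].
Qed.

Theorem LUS_WHBU : Sem.LUS' M -> Sem.WHBU_m M.
Proof.
move=> LUS Psi Pfun Ppos Pmeas eps0 peps.
have [g [gfun [gcont [a [b [s [/cover_with_sumsE[Iab Sab cov]]]]]]]] := LUS Psi Pfun Pmeas eps0 peps.
move=> [c0 [Rc0 [c0eps sc0]]].
have [Ra Rb _] := Iab; have [Reps _] := peps.
have in_I_real (x : M T1) : Sem.in_I x -> Sem.is_real x by case.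
have RP x : Sem.in_I x -> isreal (sval (ap Psi x)) by move=> /(proj1 Pfun)/is_realE.
have Rg x : Sem.in_I x -> isreal (sval (ap g x)) by move=> /(proj1 gfun)/is_realE.
have L := @reads_val M.
have Pg x : Sem.in_I x -> (forall k, ~ inside a b k (sval x)) ->
    seqv (sval (ap Psi x)) (sval (ap g x)).
  move=> Ix nx; apply/(reads_eq (L _) (L _)); apply: contrapT => H.
  have [k] := cov x (in_I_real x Ix) (Logic.conj Ix H); exact: nx.
have Ppos' x : Sem.in_I x -> exists2 q, 0 < q & below q (sval (ap Psi x)).
  by move=> Ix; apply/zero_ltE; [apply: (proj1 Pfun) | apply: Ppos].
have [y Hy] := dense_uncovered Ra Rb.
have [c [d Hcd]] := internal_families y Psi.
have Iy (j : N) : Sem.in_I (ap y j) by apply/in_IE; case: (Hy j).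
have Ry j : isreal (sval (ap y j)) by apply/is_realE; case: (Iy j).
have balls := balls_cover RP Rg Ppos' gcont Pg Hy Hcd.
have [|n Hn] := @finite_subcover M a b c d.
  move=> x /in_IE Ix; case: (pselect (exists k, inside a b k (sval x))) => H; first by left.
  by right; apply: balls => // k Hk; apply: H; exists k.
(* Balls with index up to n are allowed, those below n suffice. *)
exists n, y; split=> [i _|]; first exact: Iy.
move=> a' b' s' /cover_with_sumsE[Iab' Sab' cov'] e Re He.
have [Rs' _ _] := Sab'; have [Rs _ _] := Sab.
have RE : isreal (sval eps0) by apply/is_realE.
have RC : isreal (sval e) by apply/is_realE.
have [q [Hq Hq']] := proj1 (r_ltE (L _) (reads_sub (@reads_one M) (L _)) RC
  (isreal_sub (isreal_const 1) RE)) He.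
have [u [v [/below_const u1 Hv Eq]]] := proj1 (below_sub _ (isreal_const 1) RE) Hq'.
have [p [Hp Hp']] := proj1 (val_ltE Rc0 Reps) c0eps.
have pv : p < v by apply: below_lt_above RE Hp' Hv.
(* All partial sums of O stay below a rational p, and p < v < eps. *)
have ps (k : N) : above (sval (ap s k)) p.
  have [p' p'p Hp1] := above_open Hp.
  have [H|//] := located (sval (ap s k)) p'p.
  case: (sc0 k); apply/val_ltE => //; first by apply/is_realE; apply: Rs.
  by exists p'.
(* The target 1 - eps > q is written as q = u - v with u < 1. The intervals of O and the given cover
   of the balls together have length above u, of which O accounts for less than p < v. *)
have [|k Hk] := sum_of_cover Iab Sab Iab' Sab' _ u1.
  move=> x IX; have Rx : Sem.is_real x by apply/is_realE; case: IX.
  have [[k kn Hk]|[k kn Hk]] := Hn _ IX; [left; by exists k | right].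
  apply: cov' => //; exists k; split; first exact: ltN_addr.
  have [E1 E2] := Hcd k; have [[w [Hw Hw']] [z [Hz Hz']]] := Hk.
  have RPk := RP _ (Iy k).
  split; [apply/(r_ltE (reads_sub (L _) (L _)) (L _)) | apply/(r_ltE (L _) (reads_add (L _) (L _)))].
  - exact: isreal_sub.
  - by case: IX.
  - by exists w; rewrite -E1.
  - by case: IX.
  - exact: isreal_add.
  - by exists z; rewrite -E2.
exists k; apply/val_ltE => //; first by apply/is_realE; apply: Rs'.
exists q; split=> //.
have lt : q < u - p by rewrite Eq; lra.
have [//|H] := located (sval (ap s' k)) lt.
by have := Hk _ _ (ps k) H; lra.
Qed.

End Main.

Theorem theorem3p16 : proves ACA0w (closed_form (impl LUS' WHBU_m)).
Proof.
apply: completeness => M HM rho; rewrite sat_statement.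
exact: (@LUS_WHBU (Model HM)).
Qed.
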